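(* Let $d$ and $n$ be positive integers. Let $K$ be a number field with $k=[K:\mathbb{Q}]$, let $\mathfrak{o}$ be its ring of integers and let $\mathbb{E}$ be an integral basis of $\mathfrak{o}$. For each $\mathfrak{p}\in\mathcal{P}_K$, let $U_\mathfrak{p}\subseteq\mathfrak{o}_\mathfrak{p}^d$ be such that $\nu_\mathfrak{p}(\partial(U_\mathfrak{p}))=0$ and define $s_\mathfrak{p}=\nu_\mathfrak{p}(U_\mathfrak{p})$. Let $U_\infty\subseteq k_\infty^d$ be such that $\mu_\infty(\partial(U_\infty))=0$ and $\mathbb{R}_{\geq 0}\cdot U_\infty=U_\infty$, and define $s_\infty=\frac{1}{2^{dk}}\nu_\infty(U_\infty\cap B_\mathbb{E}^d)$. Assume that $$\lim_{M\to\infty}\overline{\rho}_\mathbb{E}\Big(\mathfrak{o}^d\cap\bigcup_{p>M}\ \bigcup_{\mathfrak{p}\in\mathcal{P}_K,\ \mathfrak{p}\mid p}U_\mathfrak{p}\Big)=0.$$ Assume further that for some $\alpha\in[0,\infty]$ there exist absolute constants $c',c\in\mathbb{Z}$ such that for all integers $H\geq 1$ and all $A\in O(H,\mathbb{E})^d_I$ one has $$\big|\{\mathfrak{p}\in\mathcal{P}_K \mid \mathfrak{p}\succ c'H^\alpha,\ A\in U_\mathfrak{p}\}\big|<c,$$ and that there exists a sequence of real numbers $(v_\mathfrak{p})_{\mathfrak{p}\in\mathcal{P}_K}$ such that for all integers $H\ge 1$ and all $\mathfrak{p}_1,\dots,\mathfrak{p}_n\in\mathcal{P}_K$ with $\mathfrak{p}_1,\dots,\mathfrak{p}_n\preceq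 c'H^\alpha$ one has $$\Big|\bigcap_{j=1}^n U_{\mathfrak{p}_j}\cap O(H,\mathbb{E})^d_I\Big|\leq(2H)^{kd}\prod_{j=1}^n v_{\mathfrak{p}_j},$$ and such that $\sum_{\mathfrak{p}\in\mathcal{P}_K}v_\mathfrak{p}$ converges. Then the limit $$\mu_{n,\mathbb{E}}=\lim_{H\to\infty}\frac{\sum_{A\in O(H,\mathbb{E})^d_I}\big|\{\eta\in N_K\mid A\in U_\eta\}\big|^n}{(2H)^{kd}}$$ exists and $\mu_{n,\mathbb{E}}<\infty$. Moreover, for $\tau=(\tau_1,\dots,\tau_n)\in\mathbb{N}^n$ (where $0\in\mathbb{N}$) with $\sum_{j=1}^n j\tau_j=n$, let $\ell(\tau)=\sum_{j=1}^n\tau_j$ and let $c(\tau)$ be the number of set partitions of $\{1,\dots,n\}$ which contain exactly $\tau_j$ sets of cardinality $j$ for each $j$. Then $$\mu_{n,\mathbb{E}}=\sum_{\tau\in\mathbb{N}^n,\ \sum_{j=1}^n j\tau_j=n}c(\tau)\sum_{\substack{(\eta_1,\dots,\eta_{\ell(\tau)})\in N_K^{\ell(\tau)}\\ \eta_i\neq\eta_j\ \text{for all}\ i<j}}\ \prod_{m=1}^{\ell(\tau)}s_{\eta_m}.$$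
   Context: $\mathcal{P}_K$ is the set of non-zero prime ideals of $\mathfrak{o}$ and $N_K=\mathcal{P}_K\cup\{\infty\}$, with $\infty$ a formal symbol. For $\mathfrak{p}\in\mathcal{P}_K$, $K_\mathfrak{p}$ is the $\mathfrak{p}$-adic completion of $K$, $\mathfrak{o}_\mathfrak{p}$ its ring of integers, and $\nu_\mathfrak{p}$ the Haar measure normalized to total mass $1$ (on $\mathfrak{o}_\mathfrak{p}$, and likewise on $\mathfrak{o}_\mathfrak{p}^d$). $\partial$ denotes topological boundary. $\mathfrak{p}\mid p$ means $\mathfrak{p}\cap\mathbb{Z}=p\mathbb{Z}$, $p$ a rational prime. For real $M$ and $\mathfrak{p}\mid p$: $\mathfrak{p}\succ M$ means $p>M$, and $\mathfrak{p}\preceq M$ means $p\leq M$; when $\alpha=\infty$ the threshold $c'H^\alpha$ is read as $+\infty$, so that every $\mathfrak{p}\preceq c'H^{\alpha}$. $k_\infty=\mathfrak{o}\otimes_\mathbb{Z}\mathbb{R}$, a real vector space of dimension $k$; $\mu_\infty$ is Lebesgue measure on $k_\infty^d$ (via a linear identification with $\mathbb{R}^{kd}$), and $\nu_\infty$ is the Haar measure on $k_\infty^d$ normalized so that the lattice $\mathfrak{o}^d$ has covolume $1$. For the integral basis $\mathbb{E}=\{e_1,\dots,e_k\}$ put $B_\mathbb{E}=\{\sum_{j=1}^k e_j\otimes a_j : a_j\in[-1,1]\}\subset k_\infty$, and for a positive integer $H$ put $O(H,\mathbb{E})=\{\sum_{j=1}^k a_je_j : a_j\in[-H,H)\cap\mathbb{Z}\}\subset\mathfrak{o}$.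 For $T\subseteq\mathfrak{o}^d$, the upper density is $\overline{\rho}_\mathbb{E}(T)=\limsup_{H\to\infty}\frac{|T\cap O(H,\mathbb{E})^d|}{(2H)^{dk}}$. For $A\in\mathfrak{o}^d$, ''$A\in U_\eta$'' means that the image of $A$ under the natural map $\mathfrak{o}^d\to\mathfrak{o}_\mathfrak{p}^d$ (if $\eta=\mathfrak{p}$), respectively $\mathfrak{o}^d\to k_\infty^d$ (if $\eta=\infty$), lies in $U_\eta$; intersections of $U_\eta$ with subsets of $\mathfrak{o}^d$ are understood accordingly. Let $I=\{A\in\mathfrak{o}^d\mid A\in U_\eta\text{ for infinitely many }\eta\in N_K\}$ and $O(H,\mathbb{E})^d_I=O(H,\mathbb{E})^d\setminus I$. *)

(* Defs.v *)
From HB Require Import structures.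
From mathcomp Require Import all_boot all_order all_algebra all_field.
From mathcomp Require Import ring_quotient mxpoly finmap.
From mathcomp Require Import all_classical all_reals all_analysis.

Set Implicit Arguments.
Unset Strict Implicit.
Unset Printing Implicit Defensive.

Import Order.TTheory GRing.Theory Num.Theory.
Import numFieldNormedType.Exports.

Local Open Scope classical_set_scope.
Local Open Scope ring_scope.

Definition set_card (T : choiceType) (S : set T) : nat :=
  (#|` fset_set S |)%fset.

Definition boundary (T : topologicalType) (A : set T) : set T :=
  closure A `\` interior A.

Definition borel_sets (T : topologicalType) : set (set T) := <<s @open T >>.

Definition borel (T : ptopologicalType) := g_sigma_algebraType (@open T).

HB.instance Definition _ (T : ptopologicalType) := Measurable.on (borel T).

Definition translation_invariant (R : realType) (V : zmodType)
    (G : set (set V)) (mu : set V -> \bar R) : Prop :=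
  forall (x : V) (A : set V), G A -> mu [set x + a | a in A] = mu A.

(* The outer measure [mu_ext mu] extends [mu] to non-Borel sets; on sets that
   are measurable for the completion of [mu], in particular on sets with null
   boundary, it is the completed measure. *)
Definition vol (T : ptopologicalType) (R : realType)
    (mu : {measure set (borel T) -> \bar R}) (A : set T) : R :=
  fine (mu_ext mu A).

Section RingOfIntegers.
Variable K : fieldExtType rat.

Definition integral_elt : {pred K} :=
  fun x => `[< integralOver (intr : int -> K) x >].

Lemma integral_eltP x :
  reflect (integralOver (intr : int -> K) x) (x \in integral_elt).
Proof. exact: asboolP. Qed.

Lemma integral_elt_subring : subring_closed integral_elt.
Proof.
split; first exact/integral_eltP/integral1.
- by move=> x y /integral_eltP hx /integral_eltP hy;
  apply/integral_eltP/integral_sub.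
- by move=> x y /integral_eltP hx /integral_eltP hy;
  apply/integral_eltP/integral_mul.
Qed.

HB.instance Definition _ :=
  GRing.isSubringClosed.Build K integral_elt integral_elt_subring.

Record ringInt := RingInt { ringInt_val :> K; _ : ringInt_val \in integral_elt }.

HB.instance Definition _ := [isSub for ringInt_val].
HB.instance Definition _ := [Choice of ringInt by <:].
HB.instance Definition _ := [SubChoice_isSubComNzRing of ringInt by <:].

Record nzprime := NzPrime {
  nzprime_pred :> ringInt -> bool;
  nzprime_ideal : idealr_closed nzprime_pred;
  nzprime_prime : prime_idealr_closed nzprime_pred;
  nzprime_neq0 : exists2 x, nzprime_pred x & x != 0 }.

HB.instance Definition _ := gen_eqMixin nzprime.
HB.instance Definition _ := gen_choiceMixin nzprime.

Definition lies_over (P : nzprime) (p : nat) : Prop :=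
  prime p /\ forall z : int, P z%:~R = (p%:Z %| z)%Z.

Definition ideal_mul (I J : set ringInt) : set ringInt :=
  [set x | exists2 s : seq (ringInt * ringInt),
     (forall u, u \in s -> I u.1 /\ J u.2) & x = \sum_(u <- s) u.1 * u.2].

Fixpoint ideal_exp (I : set ringInt) (m : nat) : set ringInt :=
  if m is m'.+1 then ideal_mul I (ideal_exp I m') else setT.

Definition integral_basis (E : 'I_(\dim {:K}) -> ringInt) : Prop :=
  forall x : ringInt,
    exists! a : 'rV[int]_(\dim {:K}), x = \sum_j (a 0 j)%:~R * E j.

Definition coord_int (E : 'I_(\dim {:K}) -> ringInt) (x : ringInt)
    : 'rV[int]_(\dim {:K}) :=
  xget 0 [set a : 'rV[int]_(\dim {:K}) | x = \sum_j (a 0 j)%:~R * E j].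

End RingOfIntegers.

Section Completion.
Variables (R : realType) (K : fieldExtType rat).

(* A completion of [K] for the [P]-adic absolute value.  [pc_padic] gives that
   absolute value on nonzero integers, v_P(a) being the m with a in P^m but
   not in P^(m+1); since K = Frac(o), [pc_absM] then fixes it on all of K.  The
   base p of the absolute value is a normalisation that does not affect the
   topology. *)
Record padic_completion (P : nzprime K) := PadicCompletion {
  pc_field :> fieldType;
  pc_inj : {rmorphism K -> pc_field};
  pc_abs : pc_field -> R;
  pc_abs_ge0 : forall x, 0 <= pc_abs x;
  pc_abs_eq0 : forall x, pc_abs x = 0 <-> x = 0;
  pc_absM : forall x y, pc_abs (x * y) = pc_abs x * pc_abs y;
  pc_absD : forall x y, pc_abs (x + y) <= Num.max (pc_abs x) (pc_abs y);
  pc_padic : forall (a : ringInt K) (p m : nat), lies_over P p ->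
    ideal_exp [set b | P b] m a -> ~ ideal_exp [set b | P b] m.+1 a ->
    pc_abs (pc_inj (ringInt_val a)) = p%:R ^- m;
  pc_dense : forall x (e : R), 0 < e -> exists y : K, pc_abs (x - pc_inj y) < e;
  pc_complete : forall u : nat -> pc_field,
    (forall e : R, 0 < e -> exists N, forall i j, (N <= i)%N -> (N <= j)%N ->
       pc_abs (u i - u j) < e) ->
    exists l, forall e : R, 0 < e -> exists N, forall i, (N <= i)%N ->
       pc_abs (u i - l) < e }.

Variables (P : nzprime K) (C : padic_completion P).

Lemma pc_abs0 : pc_abs (0 : C) = 0.
Proof. exact/pc_abs_eq0. Qed.

Lemma pc_abs1 : pc_abs (1 : C) = 1.
Proof.
have h : pc_abs (1 : C) != 0.
  by apply/negP => /eqP/pc_abs_eq0/eqP; rewrite oner_eq0.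
by apply: (mulfI h); rewrite -pc_absM !mulr1.
Qed.

Lemma pc_absN (x : C) : pc_abs (- x) = pc_abs x.
Proof.
have h : pc_abs (-1 : C) = 1.
  apply/eqP; rewrite -(@pexpr_eq1 _ _ 2) ?pc_abs_ge0//.
  by rewrite expr2 -pc_absM mulrNN mulr1 pc_abs1.
by rewrite -mulN1r pc_absM h mul1r.
Qed.

Definition pc_int : {pred C} := fun x => pc_abs x <= 1.

Lemma pc_int_subring : subring_closed pc_int.
Proof.
split; first by rewrite unfold_in pc_abs1.
- move=> x y; rewrite !unfold_in => hx hy.
  by apply: (le_trans (pc_absD _ _)); rewrite ge_max hx pc_absN.
- move=> x y; rewrite !unfold_in => hx hy.
  by rewrite pc_absM mulr_ile1 ?pc_abs_ge0.
Qed.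

HB.instance Definition _ := GRing.isSubringClosed.Build C pc_int pc_int_subring.

Record pcInt := PcInt { pcInt_val :> C; _ : pcInt_val \in pc_int }.

HB.instance Definition _ := [isSub for pcInt_val].
HB.instance Definition _ := [Choice of pcInt by <:].
HB.instance Definition _ := [SubChoice_isSubComNzRing of pcInt by <:].
HB.instance Definition _ := isPointed.Build pcInt 0.

Definition pc_dist (x y : pcInt) : R := pc_abs (pcInt_val x - pcInt_val y).

Lemma pc_distxx x : pc_dist x x = 0.
Proof. by rewrite /pc_dist subrr pc_abs0. Qed.

Lemma pc_dist_pos x y : pc_dist x y = 0 -> x = y.
Proof. by move/pc_abs_eq0/eqP; rewrite subr_eq0 => /eqP/val_inj. Qed.

Lemma pc_dist_sym x y : pc_dist x y = pc_dist y x.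
Proof. by rewrite /pc_dist -pc_absN opprB. Qed.

Lemma pc_dist_triangle y x z : pc_dist x z <= pc_dist x y + pc_dist y z.
Proof.
rewrite /pc_dist -(subrKA (pcInt_val y)) (le_trans (pc_absD _ _))//.
by rewrite ge_max lerDl lerDr !pc_abs_ge0.
Qed.

HB.instance Definition _ :=
  isMetric.Build R pcInt pc_distxx pc_dist_pos pc_dist_sym pc_dist_triangle.

Lemma pc_inj_int (a : ringInt K) : pc_inj C (ringInt_val a) \in pc_int.
Proof.
case: a => x /= /integral_eltP[p mon_p /rootP px0].
rewrite unfold_in leNgt; apply/negP => x1.
set y := pc_inj C x in x1.
have hint (z : int) : (z%:~R : C) \in pc_int by exact: rpred_int.
have hsz : (size p).-1.+1 = size p.
  by rewrite prednK// lt0n size_poly_eq0 monic_neq0.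
have hy : y ^+ (size p).-1 = - \sum_(i < (size p).-1) (p`_i)%:~R * y ^+ i.
  apply/eqP; rewrite -addr_eq0; apply/eqP.
  have := congr1 (pc_inj C) px0; rewrite rmorph0 horner_coef size_map_poly_id0.
    rewrite -hsz big_ord_recr/= rmorphD rmorph_sum/= => h; rewrite -[RHS]h addrC.
    congr (_ + _); last first.
      have -> : (map_poly intr p)`_(size p).-1 = 1 :> K.
        by rewrite coef_map/= -lead_coefE (monicP mon_p).
      by rewrite mul1r rmorphXn.
    by apply: eq_bigr => i _; rewrite coef_map rmorphM rmorph_int rmorphXn.
  by rewrite (monicP mon_p) oner_neq0.
have absX n : pc_abs (y ^+ n) = pc_abs y ^+ n.
  by elim: n => [|n ih]; rewrite ?expr0 ?pc_abs1// !exprS pc_absM ih.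
case en : (size p).-1 hy => [|n] hy.
  move: hy; rewrite big_ord0 oppr0 expr0 => /eqP.
  by rewrite oner_eq0.
have bnd : pc_abs (y ^+ n.+1) <= pc_abs y ^+ n.
  rewrite hy pc_absN; elim/big_ind: _ => [|u v hu hv|i _].
  - by rewrite pc_abs0 exprn_ge0// pc_abs_ge0.
  - by rewrite (le_trans (pc_absD _ _))// ge_max hu.
  rewrite pc_absM absX -[leRHS]mul1r ler_pM ?pc_abs_ge0 ?exprn_ge0//.
  - exact: pc_abs_ge0.
  - exact: hint.
  - by rewrite ler_weXn2l// 1?ltW// -ltnS ltn_ord.
move: bnd; rewrite absX exprS ger_pMl ?exprn_gt0 ?(lt_trans _ x1)//.
by rewrite leNgt x1.
Qed.

Definition to_pcInt (a : ringInt K) : pcInt := PcInt (pc_inj_int a).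

End Completion.

Section Density.
Variables (R : realType) (d : nat) (K : fieldExtType rat).
Local Notation k := (\dim {:K}).
Variable E : 'I_k -> ringInt K.

(* k_oo = o (x) R is identified with R^k through the basis (e_j (x) 1)_j, so
   that k_oo^d is the space of d x k real matrices. *)
Definition kinfd : Type := 'M[R]_(d, k).

Definition to_kinf (A : 'rV[ringInt K]_d) : kinfd :=
  \matrix_(i < d, j < k) (coord_int E (A 0 i) 0 j)%:~R.

Definition BE : set kinfd := [set x | forall i j, -1 <= x i j <= 1].

Definition unit_cube : set kinfd := [set x | forall i j, 0 <= x i j <= 1].

(* The Borel measure on k_oo^d = R^(dk) that is translation invariant and gives
   the unit cube mass 1; it is unique. *)
Definition is_lebesgue (mu : set kinfd -> \bar R) : Prop :=
  translation_invariant (@borel_sets kinfd) mu /\ mu unit_cube = 1%E.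

(* The covolume of a lattice is the measure of any of its fundamental
   domains; [range (to_kinf E)] is the image of o^d. *)
Definition fundamental_domain (F : set kinfd) : Prop :=
  borel_sets F /\
  forall x : kinfd, exists! l : kinfd, range to_kinf l /\ F (x - l).

Definition is_haar_covol1 (nu : set kinfd -> \bar R) : Prop :=
  translation_invariant (@borel_sets kinfd) nu /\
  forall F, fundamental_domain F -> nu F = 1%E.

Definition box (H : nat) : set 'rV[ringInt K]_d :=
  [set A | forall i, exists a : 'I_k -> int,
     (forall j, - H%:Z <= a j < H%:Z) /\ A 0 i = \sum_j (a j)%:~R * E j].

Definition upper_density (T : set 'rV[ringInt K]_d) : \bar R :=
  limn_esup (fun H : nat =>
    ((set_card (T `&` box H))%:R / (2 * H%:R) ^+ (d * k))%:E).

End Density.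

Section LocalConditions.
Variables (R : realType) (d : nat) (K : fieldExtType rat).
Local Notation k := (\dim {:K}).
Variable E : 'I_k -> ringInt K.
Variable C : forall P : nzprime K, padic_completion R P.
Variable U : forall P : nzprime K, set 'rV[pcInt (C P)]_d.
Variable Uinf : set (kinfd R d K).

(* The index set N_K is [option (nzprime K)], [None] being the symbol oo. *)
Definition in_local (A : 'rV[ringInt K]_d) (eta : option (nzprime K)) : Prop :=
  match eta with
  | Some P => U (map_mx (@to_pcInt R K P (C P)) A)
  | None => Uinf (to_kinf R E A)
  end.

Definition I_set : set 'rV[ringInt K]_d :=
  [set A | infinite_set [set eta | in_local A eta]].

Definition box_I (H : nat) : set 'rV[ringInt K]_d := box E H `\` I_set.

(* Each term of the moment is finite, as A runs over the complement of I. *)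
Definition moment (n H : nat) : R :=
  (\sum_(A \in box_I H) ((set_card [set eta | in_local A eta])%:R ^+ n : R))
    / (2 * H%:R) ^+ (k * d).

Variable nu : forall P : nzprime K,
  probability (borel 'rV[pcInt (C P)]_d) R.
Variable nu_inf : {measure set (borel (kinfd R d K)) -> \bar R}.

Definition s_local (eta : option (nzprime K)) : R :=
  match eta with
  | Some P => vol (nu P) (@U P)
  | None => vol nu_inf (Uinf `&` @BE R d K) / 2 ^+ (d * k)
  end.

End LocalConditions.

Section Thresholds.
Variables (R : realType) (K : fieldExtType rat).

Definition above (P : nzprime K) (M : \bar R) : Prop :=
  exists2 p : nat, lies_over P p & (M < p%:R%:E)%E.

Definition below (P : nzprime K) (M : \bar R) : Prop :=
  exists2 p : nat, lies_over P p & (p%:R%:E <= M)%E.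

(* c' H^alpha, read as +oo when alpha = +oo whatever c' is. *)
Definition threshold (c' : int) (H : nat) (alpha : \bar R) : \bar R :=
  match alpha with
  | r%:E => (c'%:~R * (H%:R `^ r))%:E
  | _ => +oo%E
  end.

End Thresholds.

(* [tau j] is the multiplicity of parts of size j + 1; as each multiplicity is
   at most n, values in 'I_n.+1 lose nothing. *)
Definition partition_type (n : nat) (tau : {ffun 'I_n -> 'I_n.+1}) : bool :=
  (\sum_(j < n) j.+1 * tau j == n)%N.

Definition ell (n : nat) (tau : {ffun 'I_n -> 'I_n.+1}) : nat :=
  (\sum_(j < n) tau j)%N.

Definition num_partitions (n : nat) (tau : {ffun 'I_n -> 'I_n.+1}) : nat :=
  #|[set Q : {set {set 'I_n}} | finset.partition Q [set: 'I_n] &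
      [forall j : 'I_n, #|[set B in Q | #|B| == j.+1]| == tau j]]|%SET.

(* Main.v *)
(* A set with null boundary is squeezed between finite unions of cells: residue
   classes at a prime, dyadic cubes at infinity (the latter after dividing by H,
   as the condition at infinity is a cone).  By the Chinese remainder theorem,
   cells for finitely many places are jointly equidistributed among the lattice
   points of the box, because translations by suitable integers permute them; so
   finitely many local conditions are independent with densities s_eta.  The
   n-th power of the number of conditions met at places up to M then expands
   into a sum over maps from {1, ..., n} to these places; grouping the maps by
   their kernel, a set partition, gives the truncated formula.  The error of the
   truncation is supported on the tail set of M, where the count is at most a
   constant plus the number of places below the threshold; the n-th power of the
   latter is summed through the v_p, so that the error tends to 0. *)

Require Import Defs.
From HB Require Import structures.
From mathcomp Require Import all_boot all_order all_algebra all_field.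
From mathcomp Require Import ring_quotient mxpoly finmap.
From mathcomp Require Import all_classical all_reals all_analysis.
From mathcomp Require Import zify ring lra.

Set Implicit Arguments.
Unset Strict Implicit.
Unset Printing Implicit Defensive.

Import Order.TTheory GRing.Theory Num.Theory.
Import numFieldNormedType.Exports.

Local Open Scope classical_set_scope.
Local Open Scope ring_scope.

(** * Integers and prime ideals of a number field *)

Section Coordinates.
Variables (K : fieldExtType rat) (E : 'I_(\dim {:K}) -> ringInt K).
Local Notation k := (\dim {:K}).
Local Notation o := (ringInt K).

(** The measures are abstract as well, known only through translation invariance and a
    normalisation. Hence the mass of a cell is not computed as an index: the cells of one level are
    translates of each other, so they share the total equally, and lattice translations do the same
    for lattice points. At infinity the null boundary is a statement about Lebesgue measure, whereas
    s_oo is a Haar volume; what passes from one to the other is the number of cubes that meet the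
    cone without lying in it, a quantity free of measures. Finally, points of I are excluded from
    the moment but not from the truncated one, which counts all points of the box. They satisfy
    conditions outside every finite set of places, so they lie in the tail set of every level, and
    that level may be chosen after M. *)

Definition of_coord (a : 'rV[int]_k) : o := \sum_j (a 0 j)%:~R * E j.

Lemma of_coordD a b : of_coord (a + b) = of_coord a + of_coord b.
Proof.
by rewrite -big_split/=; apply: eq_bigr => j _; rewrite mxE intrD mulrDl.
Qed.

Lemma of_coordZ z a : of_coord (z *: a) = z%:~R * of_coord a.
Proof.
by rewrite mulr_sumr; apply: eq_bigr => j _; rewrite mxE intrM mulrA.
Qed.

Hypothesis hE : integral_basis E.

Lemma coord_intK x : of_coord (coord_int E x) = x.
Proof.
have [a [ha _]] := hE x.
by rewrite /coord_int; case: xgetP => [b _ /= hb|/(_ a)].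
Qed.

Lemma of_coordK a : coord_int E (of_coord a) = a.
Proof.
have [b [_ hb]] := hE (of_coord a).
by rewrite -[RHS](hb a erefl); apply/esym/hb/esym/coord_intK.
Qed.

(** The class of [x] modulo N + 1, read off its coordinates; values in a finite type make the
    pigeonhole principle applicable. The modulus is a successor so that it is never 0. *)
Definition res N (x : o) : {ffun 'I_k -> 'I_N.+1} :=
  [ffun j => inord `|(coord_int E x ord0 j %% N.+1)%Z|].

Lemma res_eq N x y : res N x = res N y -> exists z, x - y = N.+1%:R * z.
Proof.
move=> /ffunP h; pose a := coord_int E x; pose b := coord_int E y.
have hab j : exists z, a 0 j - b 0 j = N.+1%:Z * z.
  have := h j; rewrite !ffunE => /(congr1 (fun i : 'I_N.+1 => (i : nat)%:Z)).
  rewrite !inordK; last 2 first.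
  - by rewrite -ltz_nat gez0_abs ?modz_ge0// ltz_pmod.
  - by rewrite -ltz_nat gez0_abs ?modz_ge0// ltz_pmod.
  rewrite !gez0_abs ?modz_ge0// -/a -/b => /eqP.
  by rewrite eqz_mod_dvd => /dvdzP[q ->]; exists q; rewrite mulrC.
have [z hz] := choice hab.
exists (of_coord (\row_j z j)).
rewrite -[x]coord_intK -[y]coord_intK -/a -/b.
have -> : a = b + N.+1%:Z *: \row_j z j.
  by apply/rowP => j; rewrite !mxE -hz addrC subrK.
by rewrite of_coordD of_coordZ addrC addKr.
Qed.

End Coordinates.

Section RingOfIntegersTheory.
Variable K : fieldExtType rat.
Local Notation o := (ringInt K).

Lemma ringInt_valD (x y : o) : ringInt_val (x + y) = ringInt_val x + ringInt_val y.
Proof. exact: (raddfD (val : o -> K)). Qed.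

Lemma ringInt_valM (x y : o) : ringInt_val (x * y) = ringInt_val x * ringInt_val y.
Proof. exact: (rmorphM (val : o -> K)). Qed.

Lemma ringInt_val1 : ringInt_val (1 : o) = 1.
Proof. exact: (rmorph1 (val : o -> K)). Qed.

Lemma ringInt_val0 : ringInt_val (0 : o) = 0.
Proof. exact: (raddf0 (val : o -> K)). Qed.

Lemma ringInt_valN (x : o) : ringInt_val (- x) = - ringInt_val x.
Proof. exact: (raddfN (val : o -> K)). Qed.

Lemma ringInt_val_nat n : ringInt_val (n%:R : o) = n%:R.
Proof. exact: (rmorph_nat (val : o -> K)). Qed.

Lemma ringInt_valX (x : o) n : ringInt_val (x ^+ n) = ringInt_val x ^+ n.
Proof. exact: (rmorphXn (val : o -> K)). Qed.

Lemma ringInt_val_inj : injective (@ringInt_val K).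
Proof. exact: val_inj. Qed.

Lemma ringInt_val_eq0 (x : o) : (ringInt_val x == 0) = (x == 0).
Proof. by rewrite -ringInt_val0 (inj_eq val_inj). Qed.

Lemma natr_ringInt_eq0 n : ((n%:R : o) == 0) = (n == 0%N).
Proof.
have /pcharf0P hK : [pchar K] =i pred0 := ftrans (pchar_lalg K) (pchar_num _).
by rewrite -ringInt_val_eq0 ringInt_val_nat hK.
Qed.

(** If the integer a clears the denominators of the minimal polynomial p of y, of degree n, then a^n
    p(X/a) is monic with integer coefficients and vanishes at a y. As a may be negative, its
    absolute value is used and the sign goes into [x]. *)
Lemma frac_ringInt (y : K) : exists N (x : o), ringInt_val x = N.+1%:R * y.
Proof.
have /polyOver1P[q0 hq] := minPolyOver 1 y.
have [q [a a0 hqa]] := rat_poly_scale q0.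
pose p := minPoly 1 y; pose n := (size p).-1.
have mon_p : p \is monic := monic_minPoly 1 y.
have szp : size p = n.+1 by rewrite prednK// size_poly_gt0 monic_neq0.
have pn : p`_n = 1 by move/monicP: mon_p; rewrite lead_coefE.
have hint : integralOver (intr : int -> K) (a%:~R * y).
  pose r := \poly_(i < n.+1) (a%:~R ^+ (n - i) * p`_i).
  have rn : r`_n = 1 by rewrite coef_poly ltnS leqnn subnn pn mulr1.
  have szr : size r = n.+1 by rewrite size_poly_eq// subnn pn mulr1 oner_neq0.
  apply: (@integral_root_monic _ _ _ _ r).
  - by rewrite monicE lead_coefE szr rn.
  - apply/eqP; rewrite horner_poly.
    transitivity (a%:~R ^+ n * p.[y]); last first.
      by have /eqP -> := root_minPoly 1 y; rewrite mulr0.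
    rewrite horner_coef szp mulr_sumr; apply: eq_bigr => i _.
    rewrite exprMn mulrACA mulrA -exprD subnK -1?mulrA// -ltnS; exact: ltn_ord.
  - move=> _ /(nthP 0)[i + <-]; rewrite szr ltnS => ilen.
    suff -> : r`_i = ((if i == n then 1 else a ^+ (n - i.+1) * q`_i) : int)%:~R.
      exact: integral_id.
    rewrite coef_poly ltnS ilen; case: eqP => [->|/eqP ne].
      by rewrite subnn pn mulr1.
    have ltin : (i < n)%N by rewrite ltn_neqAle ne.
    have -> : (n - i = (n - i.+1).+1)%N by lia.
    rewrite exprSr -mulrA intrM rmorphXn/=; congr (_ * _).
    rewrite /p hq coef_map/= hqa coefZ coef_map/=.
    have ha : (a%:~R : K) = in_alg K a%:~R by rewrite rmorph_int.
    rewrite ha -rmorphM mulrA mulfV ?intr_eq0// mul1r rmorph_int//.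
have hx : a%:~R * y \in @integral_elt K by apply/integral_eltP.
suff [x hx'] : exists x : o, ringInt_val x = `|a|%N%:R * y.
  by exists `|a|.-1, x; rewrite prednK ?absz_gt0.
case: a {hqa a0 hint} hx => m hx; first by exists (RingInt hx).
exists (- RingInt hx); rewrite ringInt_valN/= -mulNr.
by rewrite NegzE intrN opprK.
Qed.

Lemma dvd_nat_ringInt (x : o) : x != 0 -> exists N (y : o), N.+1%:R = x * y.
Proof.
move=> x0; have [N [y hy]] := frac_ringInt (ringInt_val x)^-1.
exists N, y; apply: ringInt_val_inj; rewrite ringInt_valM hy ringInt_val_nat.
by rewrite mulrCA mulfV ?mulr1// ringInt_val_eq0.
Qed.

End RingOfIntegersTheory.
Lemma pigeonhole_seq (T : finType) (f : nat -> T) :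
  exists i j, (i < j)%N /\ f i = f j.
Proof.
pose g (i : 'I_#|T|.+1) := f i.
have /injectivePn[i [j ij gij]] : ~~ injectiveb g.
  by apply/negP => /injectiveP/leq_card; rewrite card_ord ltnn.
wlog lt_ij : i j ij gij / (i < j)%N.
  move=> h; have [lt|] := ltnP i j; first exact: (h i j).
  rewrite leq_eqVlt => /predU1P[e|lt]; last by apply: (h j i); rewrite // eq_sym.
  by case/eqP: ij; apply/val_inj.
by exists i, j.
Qed.

Section PrimeIdeals.
Variable K : fieldExtType rat.
Local Notation o := (ringInt K).
Implicit Types P Q : nzprime K.

Lemma nzprime0 P : P 0. Proof. by have [] := @nzprime_ideal _ P. Qed.

Lemma nzprime1 P : ~~ P 1. Proof. by have [] := @nzprime_ideal _ P. Qed.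

Lemma nzprimeMl P a x : P x -> P (a * x).
Proof.
have [h0 _ h] := @nzprime_ideal _ P => hx.
by rewrite -[a * x]addr0; apply: h.
Qed.

Lemma nzprimeD P x y : P x -> P y -> P (x + y).
Proof.
have [h0 _ h] := @nzprime_ideal _ P => hx hy.
by rewrite -[x]mul1r; apply: h.
Qed.

Lemma nzprimeN P x : P x -> P (- x).
Proof. by rewrite -mulN1r; apply: nzprimeMl. Qed.

Lemma nzprimeDr P x y : P x -> P (x + y) = P y.
Proof.
move=> hx; apply/idP/idP => h; last exact: nzprimeD.
by rewrite -[y](addKr x); apply: nzprimeD => //; apply: nzprimeN.
Qed.

Lemma nzprimeM P x y : P (x * y) = P x || P y.
Proof.
apply/idP/orP => [h|[h|h]]; last exact: nzprimeMl.
- by apply/orP; exact: (@nzprime_prime _ P x y h).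
- by rewrite mulrC nzprimeMl.
Qed.

Lemma nzprimeX P x n : P (x ^+ n) = (0 < n)%N && P x.
Proof.
elim: n => [|n ih]; first by rewrite expr0 (negPf (nzprime1 P)).
by rewrite exprS nzprimeM ih /=; case: (P x); rewrite ?andbF.
Qed.

Lemma nzprime_prod P (I : Type) (s : seq I) (F : I -> o) :
  (forall i, ~~ P (F i)) -> ~~ P (\prod_(i <- s) F i).
Proof.
move=> h; apply: (big_ind (fun x => ~~ P x)) => //; first exact: nzprime1.
by move=> x y; rewrite nzprimeM negb_or => -> ->.
Qed.

Lemma nzprime_ext P Q : P =1 Q -> P = Q.
Proof.
case: P Q => p a b c [q a' b' c'] /= /funext e; subst q.
by rewrite (Prop_irrelevance a a') (Prop_irrelevance b b') (Prop_irrelevance c c').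
Qed.

(** A non-zero element of P divides a positive integer, which then lies in P; by primality so does
    one of its prime factors p, and Bezout keeps the integers prime to p out of P. *)
Lemma lies_over_exists P : exists p, lies_over P p.
Proof.
have [x hx x0] := nzprime_neq0 P.
have [N [y hN]] := dvd_nat_ringInt x0.
have {x hx x0 y hN} hN : P N.+1%:R by rewrite hN mulrC nzprimeMl.
have [p pp hp] : exists2 p, prime p & P p%:R.
  elim/ltn_ind: N hN => N ih hN.
  have [N1|N1] := leqP N.+1 1.
    by move: hN; case: N ih N1 => // _ _ h1; move: (nzprime1 P); rewrite h1.
  have [q qN qp] := pdivP N1; move/dvdnP: qp hN => [m em]; move: (N1).
  rewrite em natrM nzprimeM => N1' /orP[h|]; last by exists q.
  apply: (ih m.-1); last by rewrite prednK//; move: em; case: (m).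
  have := prime_gt1 qN; nia.
exists p; split=> // z; apply/idP/idP => [hz|/dvdzP[q ->]]; last first.
  by rewrite intrM nzprimeMl.
apply: contraT => ndvd; have /eqP cop : coprimez p z.
  by rewrite coprimezE prime_coprime.
have [u [v]] := Bezoutz p z; rewrite cop => huv.
suff : P 1 by rewrite (negPf (nzprime1 P)).
have -> : (1 : o) = (u * p + v * z)%:~R by rewrite huv.
by rewrite intrD !intrM nzprimeD ?nzprimeMl.
Qed.

Lemma lies_over_mem P p : lies_over P p -> P p%:R.
Proof. by case=> pp h; have := h p; rewrite dvdzz. Qed.

Lemma nzprime_nat P : exists N, P N.+1%:R.
Proof.
have [p hp] := lies_over_exists P.
by exists p.-1; rewrite prednK ?prime_gt0//; [exact: lies_over_mem|case: hp].
Qed.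

Variable E : 'I_(\dim {:K}) -> o.
Hypothesis hE : integral_basis E.

Lemma nzprime_res P N x y : P N.+1%:R -> res E N x = res E N y -> P x = P y.
Proof.
move=> hN /(res_eq hE)[z hz].
by rewrite -[x](subrK y) hz nzprimeDr// mulrC nzprimeMl.
Qed.

(** Such a P contains p, so it is a union of residue classes modulo p and is determined by its image
    in the finite ring o/p. *)
Lemma finite_lies_over p : finite_set [set P : nzprime K | lies_over P p].
Proof.
have [|p0] := posnP p.
  by move=> e; apply: (@sub_finite_set _ _ set0) => // P /= []; rewrite e.
pose f (P : nzprime K) := [set t | `[< exists2 x, P x & res E p.-1 x = t >]]%SET.
have finj : {in [set P : nzprime K| lies_over P p] &, injective f}.
  move=> P Q; rewrite !inE => hP hQ fPQ.
  have fE P' x : lies_over P' p -> P' x = (res E p.-1 x \in f P').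
    move=> hP'; rewrite inE; apply/idP/asboolP => [hx|[y hy hxy]]; first by exists x.
    rewrite (@nzprime_res _ p.-1 x y)//.
    by rewrite prednK//; apply: lies_over_mem.
  by apply: nzprime_ext => x; rewrite !fE// fPQ.
rewrite -(eq_finite_set (inj_card_eq finj)); exact: finite_finset.
Qed.

(** The powers of [x] repeat modulo an integer of P, and the common factor [x ^+ i] cancels because
    it is outside P. This yields inverses modulo P. *)
Lemma nzprime_exp1 P x : ~~ P x -> exists t, P (1 - x ^+ t.+1).
Proof.
have [N hN] := nzprime_nat P.
have [i [j [ij hij]]] := pigeonhole_seq (fun i => res E N (x ^+ i)).
move=> nx; have [z hz] := res_eq hE hij.
exists (j - i).-1; rewrite prednK ?subn_gt0//.
have : P (x ^+ i * (1 - x ^+ (j - i))).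
  by rewrite mulrBr -exprD subnKC 1?ltnW// mulr1 hz mulrC nzprimeMl.
by rewrite nzprimeM nzprimeX (negPf nx) andbF.
Qed.

(** Non-zero primes are maximal: were x in Q but not in P, then [1 - x ^+ t.+1] would lie in P,
    hence in Q, and 1 with it. *)
Lemma nzprime_sub P Q : (forall x, P x -> Q x) -> P = Q.
Proof.
move=> h; apply: nzprime_ext => x; apply/idP/idP; first exact: h.
apply: contraLR => /nzprime_exp1[t /h ht]; apply: contra (nzprime1 Q) => hx.
by rewrite -[1](subrK (x ^+ t.+1)) nzprimeD// nzprimeX.
Qed.

End PrimeIdeals.

(** * A uniformizer at P up to elements outside P *)

Section LocalUniformizer.
Variables (K : fieldExtType rat) (E : 'I_(\dim {:K}) -> ringInt K).
Hypothesis hE : integral_basis E.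
Local Notation o := (ringInt K).
Variable P : nzprime K.

Let dvd N (x : o) := exists y, x = N.+1%:R * y.

Let dvdMl N a x : dvd N x -> dvd N (a * x).
Proof. by move=> [y ->]; exists (a * y); rewrite mulrCA. Qed.

Let dvdD N x y : dvd N x -> dvd N y -> dvd N (x + y).
Proof. by move=> [a ->] [b ->]; exists (a + b); rewrite mulrDr. Qed.

Let dvd_res N s s' x : res E N s = res E N s' -> dvd N (s * x) -> dvd N (s' * x).
Proof.
move=> /esym/(res_eq hE)[z hz] h.
rewrite -[s'](subrK s) hz mulrDl; apply: dvdD => //.
by exists (z * x); rewrite mulrA.
Qed.

(* An element annihilating P in o/N is found as [s * x], where x is chosen so
   that its annihilator is maximal among those contained in P. *)
Lemma nzprime_socle N : P N.+1%:R ->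
  exists a, ~ dvd N a /\ forall y, P y -> dvd N (a * y).
Proof.
move=> hN; pose T := {ffun 'I_(\dim {:K}) -> 'I_N.+1}.
pose G x := forall s, dvd N (s * x) -> P s.
pose ann x := [set t : T | `[< exists2 s, res E N s = t & dvd N (s * x) >]]%SET.
have annP s x : reflect (dvd N (s * x)) (res E N s \in ann x).
  rewrite inE; apply: (iffP idP) => [/asboolP[s' e]|h]; first exact: dvd_res.
  by apply/asboolP; exists s.
have ex : exists n, `[< exists2 x, G x & #|ann x| = n >].
  exists #|ann 1|; apply/asboolP; exists 1 => // s; rewrite mulr1 => -[y ->].
  by rewrite mulrC nzprimeMl.
have ub n : `[< exists2 x, G x & #|ann x| = n >] -> (n <= #|T|)%N.
  by move=> /asboolP[x _ <-]; exact: max_card.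
case: (ex_maxnP ex ub) => _ /asboolP[x Gx <-] xmax.
(* Otherwise [y * x] also has its annihilator inside P; by maximality it has the same annihilator as
   [x], so factors y cancel in front of [x]. Two powers of y congruent modulo N then put
   [1 - y ^+ (j - i)] into that annihilator, hence into P, although y is in P. *)
have step y : P y -> exists2 s, ~~ P s & dvd N (s * y * x).
  move=> hy; apply: contrapT => hno.
  have Gyx : G (y * x).
    move=> s; rewrite mulrA => h; apply: contrapT => /negP ns.
    by apply: hno; exists s.
  have sub : ann x \subset ann (y * x).
    apply/fintype.subsetP => t; rewrite !inE => -[s e h].
    by exists s => //; rewrite mulrCA; exact: dvdMl.
  have annE : ann x = ann (y * x).
    apply/eqP; rewrite eqEcard sub; apply: xmax.
    by apply/asboolP; exists (y * x).
  have cancel t s : dvd N (s * y ^+ t * x) -> dvd N (s * x).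
    elim: t s => [|t ih] s; first by rewrite expr0 mulr1.
    rewrite exprSr mulrA -mulrA => h; apply: ih.
    by apply/annP; rewrite annE; apply/annP.
  have [i [j [ij hij]]] := pigeonhole_seq (fun i => res E N (y ^+ i)).
  have [z hz] := res_eq hE hij.
  have : P (1 - y ^+ (j - i)).
    apply: Gx; apply: (cancel i).
    rewrite mulrBl mul1r -exprD subnK 1?ltnW// hz.
    by exists (z * x); rewrite mulrA.
  move=> h; move: (nzprime1 P).
  by rewrite -[1](subrK (y ^+ (j - i))) nzprimeDr// nzprimeX subn_gt0 ij hy.
(* One multiplier per residue class suffices; the product of all of them stays outside P and serves
   every y at once. *)
have /choice[s hs] : forall t : T, exists s, ~~ P s /\
    forall y, P y -> res E N y = t -> dvd N (s * y * x).
  move=> t.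
  have [[y [hy yt]]|hno] := pselect (exists y, P y /\ res E N y = t).
    have [s ns hs] := step y hy; exists s; split=> // y' _ y't.
    rewrite (mulrC s) -mulrA; apply: (@dvd_res _ y); first by rewrite yt.
    by rewrite mulrA (mulrC y).
  by exists 1; split; [exact: nzprime1|move=> y hy yt; case: hno; exists y].
exists ((\prod_(t : T) s t) * x); split.
  by move=> /Gx; apply/negP; apply: nzprime_prod => t; case: (hs t).
move=> y hy; rewrite (bigD1 (res E N y))//=; set q := (\prod_(_ | _) _).
have -> : s (res E N y) * q * x * y = q * (s (res E N y) * y * x) by ring.
by apply: dvdMl; apply (hs _).2.
Qed.

(** P becomes principal once [u] is inverted. Let a P be contained in N o with a not in N o. If a pi
    = N u for some pi in P and u outside P, then b' = a b / N works for every b in P. Otherwise a /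
    N maps P into itself, so it is integral and N divides a. *)
Lemma nzprime_uniformizer :
  exists pi u, [/\ P pi, ~~ P u & forall b, P b -> exists b', u * b = pi * b'].
Proof.
have [N hN] := nzprime_nat P.
have [a [na ha]] := nzprime_socle hN.
have N0 : (N.+1%:R : K) != 0 by rewrite -ringInt_val_nat ringInt_val_eq0 natr_ringInt_eq0.
have [[pi [u [hpi hu e]]]|hno] :=
    pselect (exists pi u, [/\ P pi, ~~ P u & a * pi = N.+1%:R * u]).
  exists pi, u; split=> // b hb; have [b' hb'] := ha b hb.
  exists b'; apply: ringInt_val_inj; apply: (mulfI N0).
  rewrite -ringInt_val_nat -!ringInt_valM; congr ringInt_val.
  have -> : N.+1%:R * (pi * b') = pi * (a * b) by rewrite hb'; ring.
  by rewrite !mulrA -e; ring.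
(* If x P is contained in P, all powers of x lie in (1/N) o; two of them are
   congruent modulo o by pigeonhole, which makes x integral. *)
case: na; pose x := ringInt_val a / N.+1%:R.
have xX m : exists2 b, P b & ringInt_val b = N.+1%:R * x ^+ m.
  elim: m => [|m [b hb e]]; first by exists N.+1%:R; rewrite // expr0 mulr1 ringInt_val_nat.
  have [b' hb'] := ha b hb; exists b'.
    by apply: contrapT => /negP nb'; apply: hno; exists b, b'.
  apply: (mulfI N0); rewrite -[in LHS]ringInt_val_nat -ringInt_valM -hb'.
  by rewrite ringInt_valM e exprS mulrCA (mulrA N.+1%:R x) [_ * x]mulrC divfK.
have [f hf] := choice (fun m => let: ex_intro2 b _ e := xX m in ex_intro _ b e).
have [i [j [ij hij]]] := pigeonhole_seq (fun i => res E N (f i)).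
have [z hz] := res_eq hE hij.
have hxz : x ^+ j - x ^+ i = ringInt_val (- z).
  apply: (mulfI N0); rewrite mulrBr -!hf -ringInt_valN -ringInt_valD -opprB hz.
  by rewrite !ringInt_valN ringInt_valM ringInt_val_nat mulrN.
suff /integral_eltP hx : integralOver (intr : int -> K) x.
  exists (RingInt hx); apply: ringInt_val_inj.
  by rewrite ringInt_valM ringInt_val_nat /x/= mulrC divfK.
pose p : {poly K} := 'X^j - ('X^i + (ringInt_val (- z))%:P).
have szlt : (size ('X^i + (ringInt_val (- z))%:P : {poly K})%R < size ('X^j : {poly K})%R)%N.
  rewrite size_polyXn ltnS (leq_trans (size_polyD _ _))// geq_max size_polyXn ij/=.
  by rewrite (leq_trans (size_polyC_leq1 _))//; lia.
apply: (@integral_root_monic _ _ _ _ p).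
- by rewrite monicE lead_coefDl ?size_polyN// lead_coefXn.
- by rewrite /root !hornerE -hxz; apply/eqP; ring.
- have intB b : integralOver (intr : int -> K) (b%:R) by exact: integral_nat.
  move=> _ /(nthP 0)[n _ <-]; rewrite !coefB coefD !coefXn coefC.
  apply: integral_sub => //; apply: integral_add => //.
  have h0 := integral_nat (intr : int -> K) 0.
  by case: (n == 0)%N; [case: (- z) => y /= /integral_eltP|exact: h0].
Qed.

End LocalUniformizer.
(** * The P-adic absolute value on integers *)

Lemma expr_small (R : realType) (r e : R) : 0 <= r < 1 -> 0 < e ->
  exists n, r ^+ n < e.
Proof.
move=> /andP[r0 r1] e0.
have /cvgrPdist_lt/(_ e e0)[N _ /(_ N (leqnn N))] : r ^+ n @[n --> \oo] --> (0 : R).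
  by apply: cvg_expr; rewrite ger0_norm.
by rewrite /= sub0r normrN ger0_norm ?exprn_ge0//; exists N.
Qed.

Lemma subr_exp_factor (R : comPzRingType) (y : R) n :
  exists q, 1 - (1 - y) ^+ n = y * q.
Proof.
exists (\sum_(i < n) (1 - y) ^+ i).
by rewrite -[LHS]opprB subrX1 -mulNr; congr (_ * _); ring.
Qed.

Section AdicAbs.
Variables (R : realType) (K : fieldExtType rat) (E : 'I_(\dim {:K}) -> ringInt K).
Hypothesis hE : integral_basis E.
Local Notation o := (ringInt K).
Variables (P : nzprime K) (C : padic_completion R P).

Definition iabs (a : o) : R := pc_abs (pc_inj C (ringInt_val a)).

Lemma iabs_ge0 a : 0 <= iabs a. Proof. exact: pc_abs_ge0. Qed.

Lemma iabs_le1 a : iabs a <= 1. Proof. exact: pc_inj_int. Qed.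

Lemma iabsM a b : iabs (a * b) = iabs a * iabs b.
Proof. by rewrite /iabs ringInt_valM rmorphM pc_absM. Qed.

Lemma iabs1 : iabs 1 = 1.
Proof. by rewrite /iabs ringInt_val1 rmorph1 pc_abs1. Qed.

Lemma iabsX a n : iabs (a ^+ n) = iabs a ^+ n.
Proof. by elim: n => [|n ih]; rewrite ?expr0 ?iabs1// !exprS iabsM ih. Qed.

Lemma iabsD a b : iabs (a + b) <= Num.max (iabs a) (iabs b).
Proof. by rewrite /iabs ringInt_valD rmorphD pc_absD. Qed.

Lemma iabsMl_le a b : iabs (a * b) <= iabs b.
Proof. by rewrite iabsM ler_piMl ?iabs_ge0 ?iabs_le1. Qed.

Lemma iabs_eq0 a : (iabs a == 0) = (a == 0).
Proof.
rewrite -ringInt_val_eq0 -(fmorph_eq0 (pc_inj C)).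
by apply/eqP/eqP => /pc_abs_eq0.
Qed.

Lemma ideal_mul_sub J a : ideal_mul [set b | P b] J a -> P a.
Proof.
move=> [s hs ->]; rewrite big_seq.
apply: (big_ind (fun x => P x)); first exact: nzprime0.
  by move=> x y; exact: nzprimeD.
by move=> v /hs[hv _]; rewrite mulrC nzprimeMl.
Qed.

Lemma iabs_notin a : ~~ P a -> iabs a = 1.
Proof.
move=> na; have [p hp] := lies_over_exists P.
rewrite [LHS](@pc_padic _ _ _ C a p 0 hp) ?expr0 ?invr1//=.
by move/ideal_mul_sub; apply/negP.
Qed.

(** This ties the abstract absolute value to P: [pi] has absolute value 1/p because it is not in
    P^2. If it were, then u pi = pi w with w in P, which forces u = w. *)
Lemma iabs_uniformizer : exists pi u, [/\ pi != 0, P pi, ~~ P u, iabs pi < 1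
  & forall b, P b -> exists b', u * b = pi * b'].
Proof.
have [p hp] := lies_over_exists P.
have [pi [u [hpi hu h]]] := nzprime_uniformizer hE P.
have pi0 : pi != 0.
  apply/negP => /eqP pi0; have [b hb b0] := nzprime_neq0 P.
  have [b'] := h b hb; rewrite pi0 mul0r => /(congr1 (@ringInt_val K))/eqP.
  rewrite ringInt_valM mulf_eq0 !ringInt_val_eq0 (negPf b0) orbF => /eqP u0.
  by move: hu; rewrite u0 nzprime0.
exists pi, u; split=> //.
have p1 : (1 < p)%N by apply: prime_gt1; case: hp.
rewrite [X in X < _](@pc_padic _ _ _ C pi p 1 hp); first 1 last.
- exists [:: (pi, 1)] => [v|]; last by rewrite big_seq1 mulr1.
  by rewrite inE => /eqP ->.
- move=> [s hs e].
  suff [w hw ew] : exists2 w, P w & u * pi = pi * w.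
    case/negP: hu; suff -> : u = w by [].
    apply: ringInt_val_inj; apply: (@mulIf _ (ringInt_val pi)).
      by rewrite ringInt_val_eq0.
    by rewrite -!ringInt_valM ew mulrC.
  rewrite [X in u * X]e mulr_sumr big_seq.
  apply: (big_ind (fun x => exists2 w, P w & x = pi * w)).
  + by exists 0; rewrite ?mulr0// nzprime0.
  + move=> _ _ [a ha ->] [b hb ->]; exists (a + b); first exact: nzprimeD.
    by rewrite mulrDr.
  + move=> v /hs[hv /ideal_mul_sub hv2]; have [b' hb'] := h _ hv.
    by exists (b' * v.2); [exact: nzprimeMl|rewrite mulrA hb' mulrA].
- by rewrite expr1 invf_lt1 ?ltr1n// ltr0n ltnW.
Qed.

Lemma iabs_lt1 a : (iabs a < 1) = P a.
Proof.
have [pi [u [pi_neq0 hpi hu pi1 h]]] := iabs_uniformizer.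
apply/idP/idP => [|ha]; first by apply: contraLR => /iabs_notin ->; rewrite ltxx.
have [b hb] := h a ha.
have : iabs (u * a) < 1 by rewrite hb mulrC (le_lt_trans (iabsMl_le _ _)).
by rewrite iabsM iabs_notin// mul1r.
Qed.

(** Write numerator and denominator of x, up to powers of [u], as powers of [pi] times elements
    outside P; the bound on x says that the power of [pi] in the denominator is the smaller one, so
    it cancels. *)
Lemma clear_denominator (x : K) : pc_abs (pc_inj C x) <= 1 ->
  exists c a : o, ~~ P c /\ ringInt_val c * x = ringInt_val a.
Proof.
have [pi [u [pi_neq0 hpi hu pi1 h]]] := iabs_uniformizer.
(* The inequality |pi|^n < |a| limits how often [pi] can be split off: each splitting lowers n by
   one, and n = 0 is impossible as |a| <= 1. *)
have fact (a : o) : a != 0 ->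
    exists i a', ~~ P a' /\ u ^+ i * a = pi ^+ i * a'.
  move=> a0.
  have [n hn] : exists n, iabs pi ^+ n < iabs a.
    by apply: expr_small; rewrite ?iabs_ge0// lt_neqAle eq_sym iabs_eq0 a0 iabs_ge0.
  elim: n a a0 hn => [|n ih] a a0 hn.
    by move: hn; rewrite expr0 ltNge iabs_le1.
  have [ha|na] := boolP (P a); last by exists 0%N, a; rewrite !expr0 !mul1r.
  have [b hb] := h a ha.
  have eb : iabs a = iabs pi * iabs b by rewrite -iabsM -hb iabsM (iabs_notin hu) mul1r.
  have b0 : b != 0.
    by apply: contraNneq a0 => b0; rewrite -iabs_eq0 eb mulf_eq0 !iabs_eq0 b0 eqxx orbT.
  have pi0 : 0 < iabs pi by rewrite lt_neqAle iabs_ge0 andbT eq_sym iabs_eq0.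
  have [|i [a' [na' e]]] := ih b b0; first by move: hn; rewrite exprS eb ltr_pM2l.
  exists i.+1, a'; split=> //.
  by rewrite exprSr -mulrA hb mulrCA e mulrA -exprS.
move=> x1; have [->|x0] := eqVneq x 0.
  by exists 1, 0; rewrite nzprime1 mulr0 ringInt_val0.
have [N [a ea]] := frac_ringInt x; rewrite -(ringInt_val_nat K) in ea.
set b : o := N.+1%:R in ea.
have b0 : b != 0 by rewrite natr_ringInt_eq0.
have a0 : a != 0 by rewrite -ringInt_val_eq0 ea mulf_neq0// ringInt_val_eq0.
have [i [a' [na' ea']]] := fact a a0.
have [j [b' [nb' eb']]] := fact b b0.
have ia : iabs a = iabs pi ^+ i.
  by have := congr1 iabs ea'; rewrite !iabsM !iabsX !(iabs_notin hu, iabs_notin na') expr1n mul1r mulr1.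
have ib : iabs b = iabs pi ^+ j.
  by have := congr1 iabs eb'; rewrite !iabsM !iabsX !(iabs_notin hu, iabs_notin nb') expr1n mul1r mulr1.
have b0' : 0 < iabs b by rewrite lt_neqAle eq_sym iabs_eq0 b0 iabs_ge0.
have pi0 : 0 < iabs pi by rewrite lt_neqAle iabs_ge0 andbT eq_sym iabs_eq0.
have ji : (j <= i)%N.
  have : iabs a <= iabs b.
    by rewrite /iabs ea rmorphM pc_absM ler_piMr ?pc_abs_ge0.
  by rewrite ia ib ler_iXn2l.
exists (b' * u ^+ i), (u ^+ j * pi ^+ (i - j) * a').
rewrite nzprimeM negb_or nb' nzprimeX negb_and hu orbT; split=> //.
have pij : ringInt_val pi ^+ j != 0 by rewrite expf_neq0// ringInt_val_eq0.
apply: (mulfI pij).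
have -> : ringInt_val pi ^+ j * (ringInt_val (b' * u ^+ i) * x) =
    ringInt_val (u ^+ j * u ^+ i) * (ringInt_val b * x).
  rewrite 2!mulrA; congr (_ * x); rewrite -ringInt_valX -!ringInt_valM.
  by congr ringInt_val; rewrite mulrA -eb'; ring.
rewrite -ea -ringInt_valX -!ringInt_valM; congr ringInt_val.
by rewrite -mulrA ea' -[in LHS](subnKC ji) exprD; ring.
Qed.

End AdicAbs.

(** * Weak approximation by integers *)

Section WeakApproximation.
Variables (R : realType) (K : fieldExtType rat) (E : 'I_(\dim {:K}) -> ringInt K).
Hypothesis hE : integral_basis E.
Local Notation o := (ringInt K).
Variable C : forall P : nzprime K, padic_completion R P.

Lemma pc_absD_lt (P : nzprime K) (x y : C P) e :
  pc_abs x < e -> pc_abs y < e -> pc_abs (x + y) < e.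
Proof.
by move=> hx hy; apply: (le_lt_trans (pc_absD _ _)); rewrite gt_max hx.
Qed.

Lemma pc_dist_toE (P : nzprime K) (x : pcInt (C P)) a :
  pc_dist x (to_pcInt (C P) a) = pc_abs (pcInt_val x - pc_inj (C P) (ringInt_val a)).
Proof. by []. Qed.

(** Some power of c is 1 modulo P, so the powers of [1 - c ^+ t.+1] tend to 0; and 1 minus such a
    power is a multiple of c. *)
Lemma iabs_inv_approx (P : nzprime K) (c : o) (e : R) : 0 < e -> ~~ P c ->
  exists c', iabs (C P) (1 - c * c') < e.
Proof.
move=> e0 nc; have [t ht] := nzprime_exp1 hE nc.
have [n hn] : exists n, iabs (C P) (1 - c ^+ t.+1) ^+ n < e.
  by apply: expr_small; rewrite // iabs_ge0 (iabs_lt1 hE).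
have [q hq] := subr_exp_factor (c ^+ t.+1) n.
exists (c ^+ t * q).
by rewrite mulrA -exprS -hq opprB addrC subrK iabsX.
Qed.

(** Density of K gives a close y, with |y| <= 1 because the distance is also taken below 1. Then y =
    a / c with c outside P, and the division by c is replaced by multiplication with an approximate
    inverse. *)
Lemma pcInt_dense (P : nzprime K) (x : pcInt (C P)) (e : R) : 0 < e ->
  exists a : o, pc_dist x (to_pcInt (C P) a) < e.
Proof.
move=> e0; have := @pc_dense _ _ _ (C P) (pcInt_val x) (Num.min e 1).
rewrite lt_min e0 ltr01 => /(_ isT)[y]; rewrite lt_min => /andP[ye y1].
have y1' : pc_abs (pc_inj (C P) y) <= 1.
  rewrite -[pc_inj _ _](subKr (pcInt_val x)) (le_trans (pc_absD _ _))//.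
  by rewrite ge_max pc_absN (ltW y1) andbT; case: x {ye y1}.
have [c [a [nc ca]]] := clear_denominator hE y1'.
have [c' hc'] := iabs_inv_approx e0 nc.
exists (c' * a); rewrite pc_dist_toE -(subrKA (pc_inj (C P) y)).
apply: pc_absD_lt => //; rewrite ringInt_valM -ca mulrA -ringInt_valM -{1}[y]mul1r.
rewrite -(ringInt_val1 K) -rmorphB -mulrBl -ringInt_valN -ringInt_valD.
rewrite rmorphM pc_absM mulrC (mulrC c').
by rewrite (le_lt_trans _ hc')// ler_piMl// pc_abs_ge0.
Qed.

(** By maximality there is y in Q with y = 1 modulo P. A power z of y is small at Q and still 1
    modulo P; then [1 - (1 - z) ^+ m] approaches 1 at P and remains a multiple of z. *)
Lemma crt_pair (P Q : nzprime K) (e : R) : 0 < e -> P <> Q ->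
  exists a, iabs (C P) (1 - a) < e /\ iabs (C Q) a < e.
Proof.
move=> e0 PQ.
have [x hx nx] : exists2 x, Q x & ~~ P x.
  apply: contrapT => h; apply: PQ; symmetry; apply: (nzprime_sub hE) => x hx.
  by apply: contrapT => /negP nx; apply: h; exists x.
have [t ht] := nzprime_exp1 hE nx; pose y := x ^+ t.+1.
have hy : Q y by rewrite nzprimeX.
have [m hm] : exists m, iabs (C P) (1 - y) ^+ m < e.
  by apply: expr_small; rewrite // iabs_ge0 (iabs_lt1 hE).
have [m' hm'] : exists m, iabs (C Q) y ^+ m < e.
  by apply: expr_small; rewrite // iabs_ge0 (iabs_lt1 hE).
pose z := y ^+ m'.
exists (1 - (1 - z) ^+ m); split.
  rewrite subKr iabsX (le_lt_trans _ hm)// lerXn2r ?nnegrE ?iabs_ge0//.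
  have [q hq] := subr_exp_factor (1 - y) m'.
  by rewrite /z -{1}(subKr 1 y) hq mulrC iabsMl_le.
have [q ->] := subr_exp_factor z m.
by rewrite mulrC (le_lt_trans (iabsMl_le _ _ _))// iabsX.
Qed.

Lemma crt_unit (P : nzprime K) (s : seq (nzprime K)) (e : R) : 0 < e -> P \notin s ->
  exists a, iabs (C P) (1 - a) < e /\ forall Q, Q \in s -> iabs (C Q) a < e.
Proof.
move=> e0; elim: s => [|Q s ih]; first by exists 1; rewrite subrr /iabs ringInt_val0 rmorph0 pc_abs0.
rewrite inE negb_or => /andP[/eqP PQ /ih[a [a1 as0]]].
have [b [b1 bQ]] := crt_pair e0 PQ.
exists (a * b); split.
  have -> : 1 - a * b = (1 - a) + a * (1 - b) by ring.
  rewrite (le_lt_trans (iabsD _ _ _))// gt_max a1 /=.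
  exact: le_lt_trans (iabsMl_le _ _ _) b1.
move=> Q'; rewrite inE => /predU1P[->|hQ']; first exact: le_lt_trans (iabsMl_le _ _ _) bQ.
by rewrite mulrC (le_lt_trans (iabsMl_le _ _ _))// as0.
Qed.

(** An approximation on [s] is corrected at P by adding [u * b], with [u] close to 1 at P and to 0
    at the places of [s]. *)
Lemma weak_approximation (s : seq (nzprime K)) (x : forall P, pcInt (C P)) (e : R) :
  0 < e -> uniq s ->
  exists a : o, forall P, P \in s -> pc_dist (x P) (to_pcInt (C P) a) < e.
Proof.
move=> e0; elim: s => [_|P s ih /= /andP[Ps /ih[a ha]]]; first by exists 0.
have [b hb] := pcInt_dense (x P - to_pcInt (C P) a) e0.
have [u [u1 us]] := crt_unit e0 Ps.
exists (a + u * b) => Q; rewrite inE => /predU1P[->|hQ].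
  move: hb; rewrite !pc_dist_toE => hb.
  have -> : pcInt_val (x P) - pc_inj (C P) (ringInt_val (a + u * b)) =
    (pcInt_val (x P) - pc_inj (C P) (ringInt_val a) - pc_inj (C P) (ringInt_val b))
    + pc_inj (C P) (ringInt_val (b * (1 - u))).
    rewrite !(ringInt_valM, ringInt_valD, ringInt_valN, ringInt_val1).
    by rewrite !(rmorphM, rmorphD, rmorphN, rmorph1)/=; ring.
  apply: pc_absD_lt => //; exact: le_lt_trans (iabsMl_le _ _ _) u1.
rewrite pc_dist_toE ringInt_valD rmorphD opprD addrA; apply: pc_absD_lt.
  exact: ha.
by rewrite pc_absN mulrC (le_lt_trans (iabsMl_le _ _ _))// us.
Qed.

End WeakApproximation.
(** * Approximation by finite cell decompositions *)

Section CellDecomposition.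
Variables (R : realType) (T : ptopologicalType).
Variables (I : nat -> finType) (c : forall m, I m -> set T).

Hypothesis c_borel : forall m i, borel_sets (c (m := m) i).
Hypothesis c_triv : forall m (i j : I m) x, c i x -> c j x -> i = j.

Definition cells m (W : {set I m}) : set T := \bigcup_(i in [set` W]) c i.
Definition inner_cells (U : set T) m : {set I m} := [set i | `[< c i `<=` U >]]%SET.
Definition outer_cells (U : set T) m : {set I m} := [set i | `[< c i `&` U !=set0 >]]%SET.
Definition bad_cells U m : {set I m} := outer_cells U m :\: inner_cells U m.

Lemma cells_measurable m (W : {set I m}) : measurable (cells W : set (borel T)).
Proof.
by apply: fin_bigcup_measurable => [|i _]; [exact: finite_finset|exact: c_borel].
Qed.

Section Measure.
Variable mu : {measure set (borel T) -> \bar R}.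
Variable w : nat -> R.
Hypothesis mu_c : forall m (i : I m), mu (c i) = (w m)%:E.

Lemma measure_cells m (W : {set I m}) : mu (cells W) = (#|W|%:R * w m)%:E.
Proof.
rewrite [mu _](@content_fin_bigcup _ _ _ mu (I m)); last 4 first.
- exact: finite_finset.
- by move=> i j _ _ [x [xi xj]]; exact: c_triv xi xj.
- by move=> i _; exact: c_borel.
- exact: cells_measurable.
rewrite -(@bigfs _ _ _ _ (index_enum (I m)) (mem W))//; last first.
- by move=> i _; rewrite mem_index_enum.
- exact: index_enum_uniq.
rewrite (eq_bigr (fun=> (w m)%:E)) => [|i _]; last exact: mu_c.
by rewrite sumEFin sumr_const mulr_natl.
Qed.

(** [D] is the region tiled by the cells: all of the space at a prime, the half-open box at
    infinity. Monotonicity of the outer measure suffices, so U need not be Borel. *)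
Lemma cells_cover_bounds (D U : set T) m : (forall x, D x <-> exists i : I m, c i x) ->
  ((#|inner_cells U m|%:R * w m)%:E <= mu_ext mu (U `&` D) <=
   (#|outer_cells U m|%:R * w m)%:E)%E.
Proof.
move=> cD; rewrite -!measure_cells -!measurable_mu_extE; do ?exact: cells_measurable.
apply/andP; split; apply: le_mu_ext => x.
  move=> [i /=]; rewrite inE => /asboolP iU cix; split; first exact: iU.
  by apply/cD; exists i.
by move=> [Ux /cD[i cix]]; exists i => //=; rewrite inE; apply/asboolP; exists x.
Qed.

End Measure.

Lemma card_outer_cells U m : (#|outer_cells U m| <= #|inner_cells U m| + #|bad_cells U m|)%N.
Proof. by rewrite -(cardsID (inner_cells U m)) leq_add2r subset_leq_card// subsetIr. Qed.

Hypothesis c_nest : forall m (i : I m.+1), exists j : I m, c i `<=` c j.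
Hypothesis c_shrink : forall x N, nbhs x N ->
  exists m, forall i : I m, c i x -> c i `<=` N.

(* A point lying in a bad cell at every level is a boundary point, as the cells
   containing it form a neighbourhood basis. *)
Lemma cvg_bad_cells (mu : {measure set (borel T) -> \bar R}) (w : nat -> R) U :
  (forall m (i : I m), mu (c i) = (w m)%:E) -> mu (boundary U) = 0%E ->
  (#|bad_cells U m|%:R * w m) @[m --> \oo] --> (0 : R).
Proof.
move=> mu_c dU.
pose Z m := cells (bad_cells U m).
have Zm m : measurable (Z m : set (borel T)) by exact: cells_measurable.
have Zfin m : mu (Z m) = (#|bad_cells U m|%:R * w m)%:E by exact: measure_cells.
have Zdec m : Z m.+1 `<=` Z m.
  move=> x [i /=]; rewrite !inE => /andP[/asboolPn nU /asboolP[y [ciy Uy]]] cix.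
  have [j cij] := c_nest i; exists j; last exact: cij.
  rewrite /= !inE; apply/andP; split; last by apply/asboolP; exists y; split=> //; exact: cij.
  by apply/asboolPn => cjU; apply: nU => z /cij /cjU.
have Zcap : \bigcap_m Z m `<=` boundary U.
  move=> x Zx; split.
    move=> N /c_shrink[m hm]; have [i /=] := Zx m Logic.I.
    rewrite !inE => /andP[_ /asboolP[y [ciy Uy]]] cix; exists y; split=> //.
    exact: hm ciy.
  move=> /c_shrink[m hm]; have [i /=] := Zx m Logic.I.
  rewrite !inE => /andP[/asboolPn nU _] cix; exact/nU/hm.
have cap0 : mu (\bigcap_m Z m) = 0%E.
  apply/eqP; rewrite -measure_le0 -dU; apply: le_measure => //.
  - by rewrite inE; apply: bigcap_measurable => // m _; exact: Zm.
  - rewrite inE; apply: measurableD.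
      rewrite -[closure U]setCK; apply: measurableC; apply: sub_sigma_algebra.
      exact/closed_openC/closed_closure.
    by apply: sub_sigma_algebra; exact: open_interior.
have Zfin0 : (mu (Z 0%N) < +oo)%E by rewrite Zfin ltry.
have := @nonincreasing_cvg_mu _ _ _ mu Z Zfin0 Zm (bigcapT_measurable Zm).
rewrite cap0.
have -> : mu \o Z = fun m => (#|bad_cells U m|%:R * w m)%:E.
  by apply/funext => m /=; rewrite Zfin.
move=> h; have /h/fine_cvgP[_] // : {homo Z : n m / (n <= m)%N >-> (m <= n)%O}.
apply/nonincreasing_seqP => m; exact/subsetPset.
Qed.

(** The decay of the bad cells is a hypothesis, not a consequence of a null boundary for [mu],
    because at infinity it is proved with one measure and applied with another. *)
Lemma cvg_inner_outer_cells (mu : {measure set (borel T) -> \bar R}) (w : nat -> R) D U :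
  (forall m (i : I m), mu (c i) = (w m)%:E) ->
  (forall m x, D x <-> exists i : I m, c i x) ->
  (#|bad_cells U m|%:R * w m) @[m --> \oo] --> (0 : R) ->
  (#|inner_cells U m|%:R * w m) @[m --> \oo] --> fine (mu_ext mu (U `&` D)) /\
  (#|outer_cells U m|%:R * w m) @[m --> \oo] --> fine (mu_ext mu (U `&` D)).
Proof.
move=> mu_c cD bad0.
pose v := fine (mu_ext mu (U `&` D)).
have w0 m (i : I m) : 0 <= w m by rewrite -lee_fin -(mu_c _ i).
have hv m : #|inner_cells U m|%:R * w m <= v <= #|outer_cells U m|%:R * w m.
  have /andP[] := cells_cover_bounds mu_c U (cD m).
  rewrite /v; case: (mu_ext mu _) => [r| |]//=; first by rewrite !lee_fin => -> ->.
have hb m : #|outer_cells U m|%:R * w m <= #|inner_cells U m|%:R * w m + #|bad_cells U m|%:R * w m.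
  (* Without a cell of level m nothing makes [w m] non-negative, but then all the counts vanish. *)
  have [i _|h] := pickP (fun i : I m => true).
    by rewrite -mulrDl ler_wpM2r ?(w0 _ i)// -natrD ler_nat card_outer_cells.
  have e (W : {set I m}) : #|W| = 0%N by apply: eq_card0 => i; have := h i.
  by rewrite !e !mul0r addr0.
have h0 : (v - (#|bad_cells U m|%:R * w m)) @[m --> \oo] --> v.
  by rewrite -[X in _ --> X]subr0; apply: cvgB bad0; exact: cvg_cst.
have h1 : (v + (#|bad_cells U m|%:R * w m)) @[m --> \oo] --> v.
  by rewrite -[X in _ --> X]addr0; apply: cvgD bad0; exact: cvg_cst.
split; apply: (@squeeze_cvgr _ _ _ _ _ _ _ _ _ h0 h1); apply: nearW => m;
  have /andP[] := hv m; have := hb m; rewrite -/v;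
  move: (_ * _) (_ * _) (_ * _) => x y z *; apply/andP; split; lra.
Qed.

End CellDecomposition.

(** * Residue cells at a prime *)

Section AdicCells.
Variables (R : realType) (d : nat) (K : fieldExtType rat).
Variable E : 'I_(\dim {:K}) -> ringInt K.
Hypothesis hE : integral_basis E.
Local Notation o := (ringInt K).
Variable C : forall P : nzprime K, padic_completion R P.
Variable P : nzprime K.
Local Notation X := 'rV[pcInt (C P)]_d.

(** By the ultrametric inequality this is an equivalence relation, and its classes are the cosets of
    an open subgroup. The radius does not involve P, so that one level m serves several places at
    once. *)
Definition adic_near (m : nat) (x y : X) : Prop :=
  forall i, pc_dist (x 0 i) (y 0 i) < 2 ^- m.

Definition embed (A : 'rV[o]_d) : X := map_mx (@to_pcInt R K P (C P)) A.

Lemma pow2V_gt0 m : 0 < 2 ^- m :> R.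
Proof. by rewrite invr_gt0 exprn_gt0. Qed.

Lemma embedD A B : embed (A + B) = embed A + embed B.
Proof.
apply/rowP => i; rewrite !mxE; apply: val_inj.
rewrite -[LHS]/(pc_inj (C P) (ringInt_val (A 0 i + B 0 i))).
by rewrite ringInt_valD rmorphD.
Qed.

Lemma adic_near_refl m x : adic_near m x x.
Proof. by move=> i; rewrite pc_distxx pow2V_gt0. Qed.

Lemma adic_near_sym m x y : adic_near m x y -> adic_near m y x.
Proof. by move=> h i; rewrite pc_dist_sym. Qed.

Lemma adic_near_trans m y x z :
  adic_near m x y -> adic_near m y z -> adic_near m x z.
Proof.
move=> h1 h2 i; rewrite /pc_dist -(subrKA (pcInt_val (y 0 i))).
by apply: pc_absD_lt; [exact: h1|exact: h2].
Qed.

Lemma adic_nearD m x y z : adic_near m (z + x) (z + y) <-> adic_near m x y.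
Proof.
by split=> h i; have := h i; rewrite !mxE /pc_dist /= opprD addrACA subrr add0r.
Qed.

Lemma adic_near_le m n x y : (m <= n)%N -> adic_near n x y -> adic_near m x y.
Proof.
move=> mn h i; apply: lt_le_trans (h i) _.
by rewrite lef_pV2 ?posrE ?exprn_gt0// ler_weXn2l// ler1n.
Qed.

Lemma embed_dense m x : exists A, adic_near m (embed A) x.
Proof.
have [A hA] := choice (fun i => pcInt_dense hE (x 0 i) (pow2V_gt0 m)).
by exists (\row_i A i) => i; rewrite !mxE pc_dist_sym.
Qed.

(** A high power of an integer in P is small at P, so congruence modulo it implies nearness. This
    bounds the number of classes. *)
Lemma adic_near_res m : exists N, forall A B : 'rV[o]_d,
  (forall i, res E N (A 0 i) = res E N (B 0 i)) -> adic_near m (embed A) (embed B).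
Proof.
have [N hN] := nzprime_nat P.
have [e he] : exists e, iabs (C P) N.+1%:R ^+ e < 2 ^- m.
  by apply: expr_small; rewrite ?pow2V_gt0// iabs_ge0 (iabs_lt1 hE).
exists (N.+1 ^ e).-1 => A B AB i.
have [z] := res_eq hE (AB i); rewrite prednK ?expn_gt0// natrX => hz.
rewrite !mxE pc_dist_toE/= -rmorphB -ringInt_valN -ringInt_valD hz mulrC.
by rewrite -/(iabs _ _) (le_lt_trans (iabsMl_le _ _ _))// iabsX.
Qed.

Lemma adic_classes m : exists n (rep : 'I_n -> 'rV[o]_d),
  (forall x, exists i, adic_near m (embed (rep i)) x) /\
  (forall i j, adic_near m (embed (rep i)) (embed (rep j)) -> i = j).
Proof.
have [N hN] := adic_near_res m.
pose T := {ffun 'I_d -> {ffun 'I_(\dim {:K}) -> 'I_N.+1}}.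
pose q (A : 'rV[o]_d) : T := [ffun i => res E N (A 0 i)].
have hq A B : q A = q B -> adic_near m (embed A) (embed B).
  by move=> /ffunP e; apply: hN => i; have := e i; rewrite !ffunE.
have /choice[r hr] : forall t : T, exists A, (exists B, q B = t) -> q A = t.
  by move=> t; have [[B hB]|h] := pselect (exists B, q B = t); [exists B|exists 0].
(* A class of [adic_near] is encoded by the residue vectors whose chosen lattice points lie in it;
   [S] lists each class once. The default point 0 in the choice of [r] is harmless, as it belongs to
   a class like any other point. *)
pose cls t := [set t' : T | `[< adic_near m (embed (r t)) (embed (r t')) >]]%SET.
have clsP t t' : reflect (adic_near m (embed (r t)) (embed (r t'))) (t' \in cls t).
  by rewrite inE; exact: asboolP.
pose S := [set cls t | t in [set: T]]%SET.
have /choice[g hg] : forall i : 'I_#|S|, exists t, cls t = enum_val i.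
  by move=> i; have /imsetP[t _ ->] := enum_valP i; exists t.
exists #|S|, (r \o g); split=> [x|i j /= hij].
  have [A hA] := embed_dense m x; pose t := q A.
  have tS : cls t \in S by apply: imset_f.
  exists (enum_rank_in tS (cls t)) => /=; set i := enum_rank_in _ _.
  apply: adic_near_trans hA; apply: (@adic_near_trans _ (embed (r t))).
    apply/clsP; rewrite hg enum_rankK_in//; apply/clsP; exact: adic_near_refl.
  by apply: hq; apply: hr; exists A.
apply: enum_val_inj; rewrite -!hg; apply/finset.setP => t; apply/clsP/clsP => h.
  by apply: adic_near_trans h; exact: adic_near_sym.
exact: adic_near_trans h.
Qed.

Definition adic_ncells m : nat := projT1 (cid (adic_classes m)).
Definition adic_rep m : 'I_(adic_ncells m) -> 'rV[o]_d :=
  projT1 (cid (projT2 (cid (adic_classes m)))).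

Definition adic_cell m (i : 'I_(adic_ncells m)) : set X :=
  [set x | adic_near m (embed (adic_rep i)) x].

Lemma adic_cell_cover m x : exists i : 'I_(adic_ncells m), adic_cell i x.
Proof. by have [h _] := projT2 (cid (projT2 (cid (adic_classes m)))); exact: h. Qed.

Lemma adic_cell_triv m (i j : 'I_(adic_ncells m)) x :
  adic_cell i x -> adic_cell j x -> i = j.
Proof.
have [_ h] := projT2 (cid (projT2 (cid (adic_classes m)))) => hi hj.
apply: h; apply: adic_near_trans hi _; exact: adic_near_sym.
Qed.

Lemma adic_ncells_gt0 m : (0 < adic_ncells m)%N.
Proof. by have [i _] := adic_cell_cover m 0; apply: leq_ltn_trans (ltn_ord i). Qed.

Lemma adic_near_open m a : open [set x | adic_near m a x].
Proof.
rewrite openE => x ax; apply/nbhs_ballP; exists (2 ^- m); first exact: pow2V_gt0.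
by move=> y [_ hy]; apply: adic_near_trans ax _ => i; exact: (hy 0 i).
Qed.

Lemma adic_cell_nest m (i : 'I_(adic_ncells m.+1)) :
  exists j : 'I_(adic_ncells m), adic_cell i `<=` adic_cell j.
Proof.
have [j hj] := adic_cell_cover m (embed (adic_rep i)).
exists j => x hx; apply: adic_near_trans hj _.
exact: adic_near_le (leqnSn m) hx.
Qed.

Lemma adic_cell_shrink x N : nbhs x N ->
  exists m, forall i : 'I_(adic_ncells m), adic_cell i x -> adic_cell i `<=` N.
Proof.
move=> /nbhs_ballP[e /= e0 he].
have [m] : exists m, (2^-1 : R) ^+ m < e.
  by apply: expr_small => //; rewrite invr_ge0 ler0n invf_lt1 ?ltr1n.
rewrite exprVn => hm; exists m => i hi y hy; apply: he; split=> // i0 j.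
rewrite (ord1 i0); apply: lt_trans hm.
by apply: adic_near_trans hy _; exact: adic_near_sym.
Qed.

Section Haar.
Variable nu : probability (borel X) R.
Hypothesis hnu : translation_invariant (@borel_sets X) nu.

Lemma nu_adic_cell m (i : 'I_(adic_ncells m)) :
  nu (adic_cell i) = ((adic_ncells m)%:R^-1)%:E.
Proof.
pose w m : R := fine (nu [set x | adic_near m 0 x]).
have B0 n : borel_sets [set x : X | adic_near n 0 x].
  by apply: sub_sigma_algebra; exact: adic_near_open.
have cB n (j : 'I_(adic_ncells n)) : borel_sets (adic_cell j).
  by apply: sub_sigma_algebra; exact: adic_near_open.
have hw n (j : 'I_(adic_ncells n)) : nu (adic_cell j) = (w n)%:E.
  have fin : nu [set x : X | adic_near n 0 x] \is a fin_num.
    exact: (@fin_num_measure _ _ _ nu _ (B0 n)).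
  rewrite /w fineK//.
  rewrite -(hnu (embed (adic_rep j)) (B0 n)); congr (nu _).
  apply/seteqP; split => [x hx|_ [x hx <-]].
    exists (x - embed (adic_rep j)); last by rewrite addrC subrK.
    by apply/(adic_nearD _ _ _ (embed (adic_rep j))); rewrite addr0 addrC subrK.
  by move/(adic_nearD _ _ _ (embed (adic_rep j))): hx; rewrite addr0.
have := measure_cells cB (@adic_cell_triv) hw [set: 'I_(adic_ncells m)]%SET.
have -> : cells adic_cell [set: 'I_(adic_ncells m)]%SET = setT.
  rewrite -subTset => x _; have [j hj] := adic_cell_cover m x.
  by exists j => //=; rewrite inE.
have nuT : nu setT = 1%E by exact: probability_setT.
move=> /(etrans (esym nuT)); rewrite cardsT card_ord => -[h].
have n0 : ((adic_ncells m)%:R : R) != 0 by rewrite pnatr_eq0 -lt0n adic_ncells_gt0.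
by rewrite hw; congr (_%:E); apply: (mulfI n0); rewrite -h mulfV.
Qed.

Lemma cvg_adic_cells U : nu (boundary U) = 0%E ->
  (#|inner_cells adic_cell U m|%:R / (adic_ncells m)%:R) @[m --> \oo] --> vol nu U /\
  (#|outer_cells adic_cell U m|%:R / (adic_ncells m)%:R) @[m --> \oo] --> vol nu U.
Proof.
move=> dU.
have cB n (j : 'I_(adic_ncells n)) : borel_sets (adic_cell j).
  by apply: sub_sigma_algebra; exact: adic_near_open.
have bad0 := cvg_bad_cells cB (@adic_cell_triv) adic_cell_nest adic_cell_shrink
  nu_adic_cell dU.
have := cvg_inner_outer_cells cB (@adic_cell_triv) (D := setT) nu_adic_cell _ bad0.
by rewrite setIT; apply=> m x; split=> // _; exact: adic_cell_cover.
Qed.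

End Haar.
End AdicCells.
Lemma eq_cvgn (R : realType) (f g : nat -> R) (l : R) :
  f =1 g -> g @ \oo --> l -> f @ \oo --> l.
Proof. by move=> /funext ->. Qed.

Lemma cvg_exprn (R : realType) (f : nat -> R) (l : R) n :
  f @ \oo --> l -> (f m ^+ n) @[m --> \oo] --> l ^+ n.
Proof.
move=> h; elim: n => [|n ih]; first by rewrite expr0; exact: cvg_cst.
by rewrite exprS; apply: (@eq_cvgn _ _ _ _ _ (cvgM h ih)) => m; rewrite exprS.
Qed.

(** * Dyadic cubes at infinity *)

Section Cubes.
Variables (R : realType) (d : nat) (K : fieldExtType rat).
Local Notation k := (\dim {:K}).
Local Notation X := (kinfd R d K).
Local Notation ix m := {ffun 'I_d * 'I_k -> 'I_(2 ^ m.+1)}.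

(** The shift by 1 puts index 0 at the corner -1 of the box. Arbitrary natural indices are allowed
    because covering the closed box takes one more layer of cubes than tiling the half-open one. *)
Definition gcube m (g : 'I_d * 'I_k -> nat) : set X :=
  [set x | forall i j, (g (i, j))%:R <= (x i j + 1) * 2 ^+ m < (g (i, j)).+1%:R].

Definition cube m (z : ix m) : set X := gcube m (fun p => z p : nat).

Definition half_open_BE : set X := [set x | forall i j, -1 <= x i j < 1].

Definition half_open_unit : set X := [set x | forall i j, 0 <= x i j < 1].

Lemma kinfdD (x y : X) i j : (x + y) i j = x i j + y i j.
Proof. by rewrite mxE. Qed.

Lemma pow2_gt0 m : 0 < 2 ^+ m :> R. Proof. exact: exprn_gt0. Qed.

Lemma closed_borel (T : ptopologicalType) (A : set T) : closed A -> borel_sets A.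
Proof.
move=> cA; rewrite -[A]setCK.
apply: (@measurableC _ (borel T)); apply: sub_sigma_algebra; exact: closed_openC.
Qed.

Lemma fin_bigcap_borel (T : ptopologicalType) (I : finType) (F : I -> set T) :
  (forall i, borel_sets (F i)) -> borel_sets (\bigcap_(i in [set: I]) F i).
Proof.
move=> hF; rewrite -[X in borel_sets X]setCK setC_bigcap.
apply: (@measurableC _ (borel T)); apply: (@fin_bigcup_measurable _ (borel T)).
  exact: finite_finset.
by move=> i _; apply: (@measurableC _ (borel T)); exact: hF.
Qed.

Lemma kinfd_borel (f : 'I_d -> 'I_k -> set R) :
  (forall i j, borel_sets (f i j)) -> borel_sets [set x : X | forall i j, f i j (x i j)].
Proof.
move=> mf.
have coord_borel i j (A : set R) : borel_sets A -> borel_sets [set x : X | A (x i j)].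
  move=> mA; pose h (x : borel X) : borel R := x i j.
  suff mh : measurable_fun setT h.
    by have := mh measurableT A mA; rewrite setTI.
  apply: (@measurability _ _ (borel X) (borel R) setT h (@open R)) => //.
  move=> _ [B oB <-]; rewrite setTI; apply: sub_sigma_algebra.
  by apply: open_comp oB => x _; exact: coord_continuous.
rewrite (_ : [set x : X | _] = \bigcap_(i in [set: 'I_d]) \bigcap_(j in [set: 'I_k])
   [set x : X | f i j (x i j)]).
  by apply: fin_bigcap_borel => i; apply: fin_bigcap_borel => j; exact: coord_borel.
by apply/seteqP; split => x h i => [_ j _|j]; exact: h.
Qed.

Lemma itvco_borel (a b : R) : borel_sets [set y : R | a <= y < b].
Proof.
rewrite (_ : [set y | _] = [set y | a <= y] `&` [set y | y < b]); last first.
  by apply/seteqP; split=> y /=; [move=> /andP[]|move=> [h1 h2]; apply/andP].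
apply: (@measurableI _ (borel R)).
  by apply: (@closed_borel R); exact: closed_ge.
by apply: sub_sigma_algebra; exact: open_lt.
Qed.

Lemma gcube_borel m g : borel_sets (gcube m g).
Proof.
apply: (@kinfd_borel (fun i j => [set y | (g (i, j))%:R <= (y + 1) * 2 ^+ m < (g (i, j)).+1%:R])).
move=> i j.
rewrite (_ : [set y | _] = [set y | (g (i, j))%:R / 2 ^+ m - 1 <= y < (g (i, j)).+1%:R / 2 ^+ m - 1]).
  exact: itvco_borel.
by apply/seteqP; split => y /=;
  rewrite lerBlDr ler_pdivrMr ?pow2_gt0// ltrBrDr ltr_pdivlMr ?pow2_gt0.
Qed.

Lemma cube_borel m (z : ix m) : borel_sets (cube z).
Proof. exact: gcube_borel. Qed.

Lemma gcube_triv m g g' x p : gcube m g x -> gcube m g' x -> g p = g' p.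
Proof.
case: p => i j h h'.
have /andP[a1 a2] := h i j; have /andP[b1 b2] := h' i j.
have := le_lt_trans a1 b2; have := le_lt_trans b1 a2.
by rewrite !ltr_nat !ltnS => h1 h2; apply/eqP; rewrite eqn_leq h1 h2.
Qed.

Lemma cube_triv m (z z' : ix m) x : cube z x -> cube z' x -> z = z'.
Proof.
by move=> h h'; apply/ffunP => p; apply: ord_inj; exact: gcube_triv h h'.
Qed.

Lemma cube_cover m x : half_open_BE x <-> exists z : ix m, cube z x.
Proof.
split=> [h|[z h] i j].
  pose y i j := (x i j + 1) * 2 ^+ m.
  have y0 i j : 0 <= y i j.
    by rewrite mulr_ge0 ?exprn_ge0//; have /andP[] := h i j; lra.
  have ylt i j : (Num.truncn (y i j) < 2 ^ m.+1)%N.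
    rewrite truncn_lt_nat// natrX exprS /y ltr_pM2r ?pow2_gt0//.
    by have /andP[] := h i j; lra.
  exists [ffun p => Ordinal (ylt p.1 p.2)] => i j; rewrite ffunE /=.
  exact: truncn_itv.
have /andP[h1 h2] := h i j.
have p := pow2_gt0 m.
have z0 : 0 <= (x i j + 1) * 2 ^+ m by apply: le_trans h1; rewrite ler0n.
have z1 : (x i j + 1) * 2 ^+ m < 2 * 2 ^+ m.
  by apply: lt_le_trans h2 _; rewrite -exprS -natrX ler_nat.
rewrite ltr_pM2r// in z1; rewrite pmulr_lge0// in z0.
by apply/andP; split; lra.
Qed.

Lemma cube_nest m (z : ix m.+1) : exists z' : ix m, cube z `<=` cube z'.
Proof.
have hz p : ((z p)./2 < 2 ^ m.+1)%N.
  have := ltn_ord (z p); have := expnS 2 m.+1; move: (nat_of_ord _) => n; lia.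
exists [ffun p => Ordinal (hz p)] => x h i j; rewrite ffunE /=.
have /andP[] := h i j; rewrite exprS mulrCA.
set y := (x i j + 1) * _; set n := z (i, j) => h1 h2.
have : ((n./2).*2 <= n)%N by lia.
have : (n.+1 <= (n./2).+1.*2)%N by lia.
rewrite -!(ler_nat R) -!muln2 !natrM => a b.
by apply/andP; split; lra.
Qed.

Lemma cube_dist m (z : ix m) x y i j : cube z x -> cube z y -> `|x i j - y i j| < 2 ^- m.
Proof.
move=> /(_ i j)/andP[x1 x2] /(_ i j)/andP[y1 y2].
have p := pow2_gt0 m.
rewrite -(ltr_pM2r p) mulVf ?gt_eqF// -[X in _ * X](ger0_norm (ltW p)) -normrM.
rewrite ltr_norml; move: x1 x2 y1 y2; rewrite -!natr1 !mulrDl mulNr !mul1r => *.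
by apply/andP; split; lra.
Qed.

Lemma cube_shrink x N : nbhs x N -> exists m, forall z : ix m, cube z x -> cube z `<=` N.
Proof.
move=> /nbhs_ballP[e /= e0 he].
have [m] : exists m, (2^-1 : R) ^+ m < e.
  by apply: expr_small => //; rewrite invr_ge0 ler0n invf_lt1 ?ltr1n.
rewrite exprVn => hm; exists m => z zx y zy; apply: he; split=> // i j.
by apply: lt_trans hm; exact: cube_dist zx zy.
Qed.

Section Translation.
Variable mu : {measure set (borel X) -> \bar R}.
Hypothesis mu_tr : translation_invariant (@borel_sets X) mu.

Lemma half_open_unit_borel : borel_sets half_open_unit.
Proof.
by apply: (@kinfd_borel (fun i j => [set y | 0 <= y < 1])) => i j; exact: itvco_borel.
Qed.

Let z0 m : ix m := [ffun=> Ordinal (expn_gt0 2 m.+1)].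

Lemma mu_gcube_eq m g g' : mu (gcube m g) = mu (gcube m g').
Proof.
pose t : X := \matrix_(i, j) (((g (i, j))%:R - (g' (i, j))%:R) / 2 ^+ m).
rewrite -(mu_tr t (gcube_borel m g')); congr (mu _).
have tE i j : t i j * 2 ^+ m = (g (i, j))%:R - (g' (i, j))%:R.
  by rewrite mxE divfK// gt_eqF ?pow2_gt0.
have key (x : X) : gcube m g' x <-> gcube m g (t + x).
  by split=> h i j; have := h i j; rewrite kinfdD !mulrDl tE -!natr1 => /andP[a b];
    apply/andP; split; lra.
apply/seteqP; split=> [x hx|_ [x hx <-]]; last exact/key.
by exists (x - t); [apply/key|]; rewrite addrC subrK.
Qed.

(** The cubes of a level have equal mass, and every level tiles the same half-open box; level m is
    compared with level 0, whose cubes are translates of the half-open unit cube. The mass [kap] of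
    the latter is a parameter, since Lebesgue measure is normalised on the closed cube. *)
Lemma mu_cube (kap : R) : mu half_open_unit = kap%:E ->
  forall m (z : ix m), mu (cube z) = (kap / 2 ^+ (m * (d * k)))%:E.
Proof.
move=> mu1.
have hc0 (z : ix 0) : mu (cube z) = kap%:E.
  rewrite -mu1 (mu_gcube_eq 0 (fun p => z p) (fun p => z0 0 p)).
  rewrite -(mu_tr (const_mx (-1)) half_open_unit_borel).
  congr (mu _); apply/seteqP; split=> [x hx|_ [x hx <-] i j].
    exists (x - const_mx (-1)); last by rewrite addrC subrK.
    by move=> i j; have := hx i j; rewrite !mxE ffunE/= mulr1 opprK.
  by rewrite !mxE ffunE/= mulr1 addrAC addNr add0r; exact: hx.
pose w m := fine (mu (cube (z0 m))).
have cube_fin m (z : ix m) : exists z' : ix 0, cube z `<=` cube z'.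
  elim: m z => [|m ih] z; first by exists z.
  have [z' h] := cube_nest z; have [z'' h'] := ih z'.
  by exists z''; exact: subset_trans h h'.
have hw m (z : ix m) : mu (cube z) = (w m)%:E.
  rewrite /w fineK; first exact: mu_gcube_eq.
  have [z' h] := cube_fin m (z0 m).
  rewrite ge0_fin_numE//; apply: le_lt_trans (ltry kap); rewrite -(hc0 z').
  by apply: le_measure => //; rewrite inE; exact: cube_borel.
have hall m : mu half_open_BE = (#|{: ix m}|%:R * w m)%:E.
  have := measure_cells cube_borel cube_triv hw [set: ix m]%SET.
  rewrite cardsT => <-; congr (mu _); apply/seteqP; split=> x.
    by move=> /(cube_cover m)[z hz]; exists z => //=; rewrite inE.
  by move=> [z _ hz]; apply/(cube_cover m); exists z.
move=> m z; rewrite hw; congr (_%:E).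
have := hall m; rewrite (hall 0%N) => -[].
rewrite -[w 0%N]/(fine (mu (cube (z0 0)))) hc0/=.
rewrite !card_ffun !card_prod !card_ord !natrX -!exprM.
rewrite mul1n mulSn exprD -mulrA => /mulfI -> //.
by rewrite mul1n mulrAC mulfV ?mul1r// gt_eqF// pow2_gt0.
Qed.

Lemma mu_half_open_BE (kap : R) : mu half_open_unit = kap%:E ->
  mu half_open_BE = (2 ^+ (d * k) * kap)%:E.
Proof.
move=> mu1.
have := measure_cells (@cube_borel) (@cube_triv) (mu_cube mu1) [set: ix 0]%SET.
rewrite cardsT mul0n divr1 card_ffun card_prod !card_ord natrX => <-.
congr (mu _); apply/seteqP; split=> x.
  by move=> /(cube_cover 0)[z hz]; exists z => //=; rewrite inE.
by move=> [z _ hz]; apply/(cube_cover 0); exists z.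
Qed.

End Translation.

Lemma BE_borel : borel_sets (@BE R d K).
Proof.
apply: (@kinfd_borel (fun i j => [set y | -1 <= y <= 1])) => i j.
rewrite (_ : [set y | _] = [set y | -1 <= y] `&` [set y | y <= 1]); last first.
  by apply/seteqP; split=> y /=; [move=> /andP[]|move=> [h1 h2]; apply/andP].
by apply: (@measurableI _ (borel R)); apply: (@closed_borel R);
  [exact: closed_ge|exact: closed_le].
Qed.

Lemma half_open_BE_borel : borel_sets half_open_BE.
Proof.
by apply: (@kinfd_borel (fun i j => [set y | -1 <= y < 1])) => i j; exact: itvco_borel.
Qed.

Section Lebesgue.
Variable mu : {measure set (borel X) -> \bar R}.
Hypothesis mu_leb : is_lebesgue mu.

Lemma unit_cube_sub : @unit_cube R d K `<=` [set const_mx 1 + x | x in half_open_BE].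
Proof.
move=> x hx; exists (x - const_mx 1); last by rewrite addrC subrK.
move=> i j; rewrite kinfdD !mxE; have /andP[] := hx i j.
by move: (x i j) => y *; apply/andP; split; lra.
Qed.

(** If the half-open unit cube were null, so would be the half-open box, of which a translate
    contains the closed unit cube of mass 1. *)
Lemma lebesgue_half_open : exists2 kap : R, 0 < kap & mu half_open_unit = kap%:E.
Proof.
have [mu_tr mu1] := mu_leb.
have ub : borel_sets (@unit_cube R d K).
  apply: (@kinfd_borel (fun i j => [set y | 0 <= y <= 1])) => i j.
  rewrite (_ : [set y | _] = [set y | 0 <= y] `&` [set y | y <= 1]); last first.
    by apply/seteqP; split=> y /=; [move=> /andP[]|move=> [h1 h2]; apply/andP].
  by apply: (@measurableI _ (borel R)); apply: (@closed_borel R);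
    [exact: closed_ge|exact: closed_le].
have le1 : (mu half_open_unit <= 1)%E.
  rewrite -mu1; apply: le_measure; rewrite ?inE//; first exact: half_open_unit_borel.
  by move=> x h i j; have /andP[-> /ltW ->] := h i j.
have fin : mu half_open_unit \is a fin_num.
  by rewrite ge0_fin_numE//; apply: le_lt_trans le1 _; rewrite ltry.
exists (fine (mu half_open_unit)); last by rewrite fineK.
rewrite lt_neqAle fine_ge0// andbT eq_sym; apply/eqP => k0.
have := mu_half_open_BE mu_tr (esym (fineK fin)); rewrite k0 mulr0 => D0.
have : (mu (@unit_cube R d K) <= mu half_open_BE)%E.
  rewrite -(mu_tr (const_mx 1) _ half_open_BE_borel); apply: le_measure.
  - by rewrite inE.
  - rewrite inE (_ : image _ _ = [set x : X | forall i j, 0 <= x i j < 2]).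
      by apply: (@kinfd_borel (fun i j => [set y | 0 <= y < 2])) => i j; exact: itvco_borel.
    apply/seteqP; split => [_ [x hx <-] i j|x hx].
      rewrite kinfdD !mxE; have /andP[] := hx i j.
      by move: (x i j) => y *; apply/andP; split; lra.
    exists (x - const_mx 1); last by rewrite addrC subrK.
    move=> i j; rewrite kinfdD !mxE; have /andP[] := hx i j.
    by move: (x i j) => y *; apply/andP; split; lra.
  - exact: unit_cube_sub.
by rewrite mu1 D0 lee_fin ler10.
Qed.

(** Dividing by [kap] removes the measure from the conclusion, which can then be used with the Haar
    measure. *)
Lemma cvg_bad_cubes U : mu (boundary U) = 0%E ->
  (#|bad_cells (@cube) U m|%:R / 2 ^+ (m * (d * k))) @[m --> \oo] --> (0 : R).
Proof.
move=> dU; have [kap kap0 hkap] := lebesgue_half_open; have [mu_tr _] := mu_leb.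
have := cvg_bad_cells (@cube_borel) (@cube_triv) (@cube_nest) (@cube_shrink)
  (mu_cube mu_tr hkap) dU.
move=> h; rewrite -(mul0r kap^-1).
apply: (@eq_cvgn _ _ _ _ _ (cvgM h (cvg_cst kap^-1))) => m.
by rewrite /= -mulrA; congr (_ * _); rewrite mulrAC mulfV ?mul1r// gt_eqF.
Qed.

End Lebesgue.

Section HaarCovolumeOne.
Variable E : 'I_k -> ringInt K.
Hypothesis hE : integral_basis E.
Variable nu : {measure set (borel X) -> \bar R}.
Hypothesis hnu : is_haar_covol1 E nu.

Lemma range_to_kinf (x : X) :
  range (to_kinf R E (d := d)) x <-> exists a : 'I_d -> 'I_k -> int, forall i j, x i j = (a i j)%:~R.
Proof.
split=> [[A _ <-]|[a ha]].
  by exists (fun i j => coord_int E (A 0 i) 0 j) => i j; rewrite mxE.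
exists (\row_i of_coord E (\row_j a i j)) => //.
by apply/matrixP => i j; rewrite !mxE of_coordK// mxE ha.
Qed.

Lemma fundamental_half_open_unit : fundamental_domain E half_open_unit.
Proof.
split; first exact: half_open_unit_borel.
move=> x; exists (\matrix_(i, j) (Num.floor (x i j))%:~R); split.
  split; first by apply/range_to_kinf; exists (fun i j => Num.floor (x i j)) => i j; rewrite mxE.
  move=> i j; rewrite !mxE.
  have := floor_le (x i j); have := floorD1_gt (x i j); rewrite intrD mulr1z.
  by move=> h1 h2; rewrite subr_ge0 ltrBlDl h1 h2.
move=> l [/range_to_kinf[a ha] hl]; apply/matrixP => i j; rewrite mxE ha.
congr (_%:~R); apply: floor_def; have := hl i j; rewrite !mxE ha subr_ge0 ltrBlDl => /andP[h1 h2].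
by rewrite h1 intrD mulr1z h2.
Qed.

Let nu_tr : translation_invariant (@borel_sets X) nu := hnu.1.
Let nu1 : nu half_open_unit = 1%:E := hnu.2 _ fundamental_half_open_unit.

(** The closed box is covered by (2^(m+1) + 1)^(dk) cubes of side 2^-m, of total mass (2 +
    2^-m)^(dk). Consequently the faces missing from the half-open box are null. *)
Lemma nu_BE : nu (@BE R d K) = (2 ^+ (d * k))%:E.
Proof.
apply/eqP; rewrite eq_le; apply/andP; split; last first.
  have := mu_half_open_BE nu_tr nu1; rewrite mulr1 => <-.
  apply: le_measure; rewrite ?inE; [exact: half_open_BE_borel|exact: BE_borel|].
  by move=> x hx i j; have /andP[-> /ltW] := hx i j.
pose J m : finType := {ffun 'I_d * 'I_k -> 'I_(2 ^ m.+1).+1}.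
pose c m (z : J m) := gcube m (fun p => z p : nat).
have cB m (z : J m) : borel_sets (c m z) by exact: gcube_borel.
have cT m (z z' : J m) x : c m z x -> c m z' x -> z = z'.
  by move=> h h'; apply/ffunP => p; apply: ord_inj; exact: gcube_triv h h'.
have nuc m (z : J m) : nu (c m z) = (1 / 2 ^+ (m * (d * k)))%:E.
  by rewrite -(mu_cube nu_tr nu1 [ffun=> Ordinal (expn_gt0 2 m.+1)]); exact: mu_gcube_eq.
have bound m : (nu (@BE R d K) <= ((2 + 2 ^- m) ^+ (d * k))%:E)%E.
  have := measure_cells cB cT nuc [set: J m]%SET.
  rewrite cardsT card_ffun card_prod !card_ord natrX.
  have -> : (2 ^ m.+1).+1%:R ^+ (d * k) * (1 / 2 ^+ (m * (d * k))) = (2 + 2 ^- m) ^+ (d * k) :> R.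
    move: (d * k)%N => n; rewrite div1r exprM -exprVn -exprMn -natr1 natrX exprS mulrDl mulfK ?mul1r//.
  move=> <-; apply: le_measure; rewrite ?inE; [exact: BE_borel|exact: cells_measurable|].
  move=> x hx.
  have y0 i j : 0 <= (x i j + 1) * 2 ^+ m.
    by rewrite mulr_ge0 ?exprn_ge0//; have /andP[] := hx i j; lra.
  have ylt i j : (Num.truncn ((x i j + 1) * 2 ^+ m) < (2 ^ m.+1).+1)%N.
    rewrite ltnS truncn_le_nat -[(2 ^ m.+1).+1%:R]natr1 natrX exprS.
    rewrite (@le_lt_trans _ _ (2 * 2 ^+ m)) ?ltrDl// ler_pM2r ?pow2_gt0//.
    by have /andP[] := hx i j; lra.
  exists [ffun p => Ordinal (ylt p.1 p.2)] => [|i j]; first by rewrite /= inE.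
  by rewrite ffunE/=; exact: truncn_itv.
have fin : nu (@BE R d K) \is a fin_num.
  by rewrite ge0_fin_numE//; apply: le_lt_trans (bound 0%N) _; rewrite ltry.
rewrite -(fineK fin) lee_fin.
have h2 : (2 + (2^-1 : R) ^+ m) ^+ (d * k) @[m --> \oo] --> (2 : R) ^+ (d * k).
  apply: cvg_exprn; rewrite -[X in _ --> X]addr0.
  apply: cvgD; first exact: cvg_cst.
  by apply: cvg_expr; rewrite ger0_norm ?invr_ge0 ?ler0n// invf_lt1 ?ltr1n.
rewrite -(cvg_lim _ h2)//; apply: limr_ge; first by apply/cvg_ex; exists (2 ^+ (d * k)).
by apply: nearW => m; rewrite -lee_fin (fineK fin) exprVn; exact: bound.
Qed.

Lemma mu_ext_BE U :
  mu_ext nu (U `&` @BE R d K) = mu_ext nu (U `&` half_open_BE).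
Proof.
have DB : half_open_BE `<=` @BE R d K.
  by move=> x hx i j; have /andP[-> /ltW] := hx i j.
apply/eqP; rewrite eq_le; apply/andP; split; last by apply: le_mu_ext; exact: setIS.
have mD : measurable (@BE R d K `\` half_open_BE : set (borel X)).
  by apply: measurableD; [exact: BE_borel|exact: half_open_BE_borel].
have null : nu (@BE R d K `\` half_open_BE) = 0%E.
  have fin : (nu (@BE R d K) < +oo)%E by rewrite nu_BE ltry.
  have -> : nu (@BE R d K `\` half_open_BE) =
      (nu (@BE R d K) - nu (@BE R d K `&` half_open_BE))%E.
    exact: (@measureD _ (borel X) _ nu _ _ BE_borel half_open_BE_borel fin).
  rewrite nu_BE setIidr//; have := mu_half_open_BE nu_tr nu1; rewrite mulr1 => ->.
  by rewrite -EFinB subrr.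
apply: (@le_trans _ _ (mu_ext nu ((U `&` half_open_BE) `|` (@BE R d K `\` half_open_BE)))).
  apply: le_mu_ext => x [Ux Bx].
  by have [h|h] := pselect (half_open_BE x); [left|right].
have h A B : (mu_ext nu (A `|` B) <= mu_ext nu A + mu_ext nu B)%E.
  exact: outer_measureU2.
by apply: le_trans (h _ _) _; rewrite (measurable_mu_extE nu mD) null adde0.
Qed.

(** The denominator 2^((m+1)dk) is the number of all cubes of level m, so these are proportions of
    cubes, and their limit is s_oo. *)
Lemma cvg_cubes U :
  (#|bad_cells (@cube) U m|%:R / 2 ^+ (m * (d * k))) @[m --> \oo] --> (0 : R) ->
  (#|inner_cells (@cube) U m|%:R / 2 ^+ (m.+1 * (d * k))) @[m --> \oo] -->
    (vol nu (U `&` @BE R d K) / 2 ^+ (d * k)) /\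
  (#|outer_cells (@cube) U m|%:R / 2 ^+ (m.+1 * (d * k))) @[m --> \oo] -->
    (vol nu (U `&` @BE R d K) / 2 ^+ (d * k)).
Proof.
move=> bad0; rewrite /vol mu_ext_BE.
have nuc m (z : ix m) : nu (cube z) = (2 ^+ (m * (d * k)))^-1%:E.
  by rewrite (mu_cube nu_tr nu1) div1r.
have eqw (x : R) m : x / 2 ^+ (m.+1 * (d * k)) = x / 2 ^+ (m * (d * k)) / 2 ^+ (d * k).
  by rewrite mulSn exprD invfM mulrA mulrAC.
have [h1 h2] := cvg_inner_outer_cells (@cube_borel) (@cube_triv) nuc cube_cover bad0.
by split; [apply: eq_cvgn (cvgM h1 (cvg_cst _)) => m|
  apply: eq_cvgn (cvgM h2 (cvg_cst _)) => m]; rewrite eqw.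
Qed.

End HaarCovolumeOne.
End Cubes.
(** * Densities of lattice points *)

Lemma card_ord_itv n l u : (u <= n)%N -> #|[set x : 'I_n | l <= x < u]%N|%SET = (u - l)%N.
Proof.
move=> un; rewrite -sum1dep_card -(big_mkord (fun x => l <= x < u)%N (fun=> 1%N)).
rewrite -big_filter big_const_seq count_filter.
have -> : count (predI xpredT (fun x => (l <= x < u)%N)) (index_iota 0 n) = (u - l)%N.
  rewrite -size_filter.
  have -> : [seq x <- index_iota 0 n | predI xpredT (fun x => (l <= x < u)%N) x] = index_iota l u.
    apply: (@irr_sorted_eq _ ltn) => //; first exact: ltn_trans.
    - exact: ltnn.
    - by apply: sorted_filter; [exact: ltn_trans|exact: iota_ltn_sorted].
    - exact: iota_ltn_sorted.
    - by move=> x; rewrite mem_filter !mem_index_iota /=; lia.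
  by rewrite size_iota.
by rewrite iter_addn_0 mul1n.
Qed.

Lemma cvg_prodn (R : realType) (I : Type) (s : seq I) (f : I -> nat -> R) (l : I -> R) :
  (forall i, f i @ \oo --> l i) ->
  (\prod_(i <- s) f i m) @[m --> \oo] --> \prod_(i <- s) l i.
Proof.
move=> h; elim: s => [|i s ih].
  by rewrite big_nil; apply: (@eq_cvgn _ _ _ _ _ (cvg_cst (1 : R))) => m; rewrite big_nil.
by rewrite big_cons; apply: (@eq_cvgn _ _ _ _ _ (cvgM (h i) ih)) => m; rewrite big_cons.
Qed.

Lemma cvg_sumn (R : realType) (I : Type) (s : seq I) (p : pred I) (f : I -> nat -> R) (l : I -> R) :
  (forall i, p i -> f i @ \oo --> l i) ->
  (\sum_(i <- s | p i) f i m) @[m --> \oo] --> \sum_(i <- s | p i) l i.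
Proof.
move=> h; elim: s => [|i s ih].
  by rewrite big_nil; apply: (@eq_cvgn _ _ _ _ _ (cvg_cst (0 : R))) => m; rewrite big_nil.
rewrite big_cons; case: ifPn => pi.
  by apply: (@eq_cvgn _ _ _ _ _ (cvgD (h i pi) ih)) => m; rewrite big_cons pi.
by apply: (@eq_cvgn _ _ _ _ _ ih) => m; rewrite big_cons (negPf pi).
Qed.

Section CoordinateCount.
Variable R : realType.

(* Those [x] for which both [x] and [x + a] lie in the [z]-th of the subintervals
   of length [H / 2 ^ m] of [0, 2 H). *)
Definition shift_itv m (z : nat) (a : int) H : {set 'I_(H.*2)} :=
  [set x : 'I_(H.*2) | (z * H <= x * 2 ^ m < z.+1 * H)%N &&
     ((z * H)%N%:Z <= (x%:Z + a) * (2 ^ m)%N%:Z < (z.+1 * H)%N%:Z)]%SET.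

(** With [q1] and [q2] the integer parts of z H / 2^m and (z+1) H / 2^m, every element lies between
    [q1] and [q2], and every x with q1 + 1 + |a| <= x < q2 - |a| is an element. For fixed m and a
    the error is thus bounded independently of H. *)
Lemma card_shift_itv m z a H : (z < 2 ^ m.+1)%N ->
  (#|shift_itv m z a H| * 2 ^ m <= H + 2 * 2 ^ m)%N /\
  (H <= (#|shift_itv m z a H| + 2 * `|a|%N + 2) * 2 ^ m)%N.
Proof.
rewrite expnS => zJ; set J := (2 ^ m)%N in zJ *.
have J0 : (0 < J)%N by rewrite expn_gt0.
pose q1 := (z * H %/ J)%N; pose q2 := (z.+1 * H %/ J)%N.
have e1 := divn_eq (z * H) J; have e2 := divn_eq (z.+1 * H) J.
have l1 : (z * H %% J < J)%N by rewrite ltn_mod.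
have l2 : (z.+1 * H %% J < J)%N by rewrite ltn_mod.
rewrite -/q1 in e1; rewrite -/q2 in e2.
have q2H : (q2 <= H.*2)%N.
  rewrite -muln2 mulnC /q2; apply: (@leq_trans (2 * J * H %/ J)).
    by apply: leq_div2r; rewrite leq_mul2r zJ orbT.
  by rewrite mulnAC mulnK.
split.
  have -> : (H + 2 * J = (z.+1 * H - z * H) + 2 * J)%N by rewrite mulSn addnK.
  apply: (@leq_trans ((q2.+1 - q1) * J)); last by nia.
  rewrite leq_mul2r; apply/orP; right.
  apply: (@leq_trans (#|[set x : 'I_(H.*2) | q1 <= x < q2.+1]%N|%SET)).
    apply: subset_leq_card; apply/fintype.subsetP => x; rewrite !inE => /andP[/andP[h1 h2] _].
    by apply/andP; split; nia.
  have [h|h] := leqP q2.+1 H.*2; first by rewrite card_ord_itv.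
  have -> : [set x : 'I_(H.*2) | q1 <= x < q2.+1]%N%SET = [set x : 'I_(H.*2) | q1 <= x < H.*2]%N%SET.
    by apply/finset.setP => x; rewrite !inE; have := ltn_ord x; lia.
  by rewrite card_ord_itv//; lia.
have [h|h] := leqP (q2 - `|a|) (q1.+1 + `|a|)%N; first by nia.
apply: (@leq_trans (((q2 - `|a|) - (q1.+1 + `|a|) + 2 * `|a| + 2) * J)%N); first by nia.
rewrite leq_mul2r !leq_add2r; apply/orP; right.
rewrite -(@card_ord_itv H.*2) 1?(leq_trans (leq_subr _ _))//.
apply: subset_leq_card; apply/fintype.subsetP => x; rewrite !inE => /andP[h1 h2].
apply/andP; split; first by apply/andP; split; nia.
by apply/andP; split; nia.
Qed.

Lemma cvg_shift_itv m z a : (z < 2 ^ m.+1)%N ->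
  (#|shift_itv m z a H|%:R / (2 * H%:R)) @[H --> \oo] --> (2 ^- m.+1 : R).
Proof.
move=> zJ; pose B : R := (2 * `|a|%N + 2)%:R.
have Bh : (B / 2 * (H%:R)^-1) @[H --> \oo] --> (0 : R).
  rewrite -(mulr0 (B / 2)); apply: (cvgM (cvg_cst _)).
  apply/gtr0_cvgV0; last exact: cvgr_idn.
  by near=> H; rewrite ltr0n; near: H; exact: nbhs_infty_gt.
have h1 : (2 ^- m.+1 - B / 2 * (H%:R)^-1) @[H --> \oo] --> (2 ^- m.+1 : R).
  by rewrite -[X in _ --> X]subr0; exact: (cvgB (cvg_cst _) Bh).
have h2 : (2 ^- m.+1 + B / 2 * (H%:R)^-1) @[H --> \oo] --> (2 ^- m.+1 : R).
  by rewrite -[X in _ --> X]addr0; exact: (cvgD (cvg_cst _) Bh).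
apply: (@squeeze_cvgr _ _ _ _ _ _ _ _ _ h1 h2); near=> H.
have H0 : (0 < H%:R :> R) by rewrite ltr0n; near: H; exact: nbhs_infty_gt.
have [] := @card_shift_itv m z a H zJ; move: #|_| => c; rewrite -!(ler_nat R).
rewrite !natrD !natrM natrX => u l; have p : 0 < 2 ^+ m :> R by exact: exprn_gt0.
have pV : 2 ^+ m * 2 ^- m = 1 :> R by rewrite mulfV// gt_eqF.
have HV : H%:R * H%:R^-1 = 1 :> R by rewrite mulfV// gt_eqF.
have l' : H%:R * 2 ^- m <= c%:R + B.
  by rewrite ler_pdivrMr// /B -natrD addnA.
have u' : c%:R <= H%:R * 2 ^- m + B.
  rewrite -(ler_pM2r p) mulrDl mulfVK ?gt_eqF//.
  have : 2 * 2 ^+ m <= B * 2 ^+ m by rewrite ler_pM2r// /B ler_nat; lia.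
  by move: u; rewrite addr0; lra.
have h0 : 0 < H%:R^-1 :> R by rewrite invr_gt0.
have -> : 2 ^- m.+1 = 2 ^- m / 2 :> R by rewrite exprSr invfM.
rewrite invfM; set h := H%:R^-1; set t := 2 ^- m in l' u' *.
have e : H%:R * t * h = t by rewrite mulrAC HV mul1r.
move: l'; rewrite -(ler_pM2r h0) -/h e mulrDl => l'.
move: u'; rewrite -(ler_pM2r h0) -/h mulrDl e => u'.
have -> : c%:R * (2^-1 * h) = c%:R * h / 2 by rewrite mulrA mulrAC.
have -> : B / 2 * h = B * h / 2 by rewrite mulrAC.
by apply/andP; split; lra.
Unshelve. all: end_near.
Qed.

End CoordinateCount.

(** * Lattice points of the box in a dyadic cell *)

Section LatticeDensity.
Variables (R : realType) (d : nat) (K : fieldExtType rat).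
Local Notation k := (\dim {:K}).
Local Notation o := (ringInt K).
Local Notation pos := ('I_d * 'I_k)%type.
Variable E : 'I_k -> o.
Hypothesis hE : integral_basis E.

Definition box_index H : finType := {ffun pos -> 'I_(H.*2)}.

Definition box_point H (f : box_index H) : 'rV[o]_d :=
  \row_i of_coord E (\row_j ((f (i, j))%:Z - H%:Z)).

(** The coordinate f p - H, divided by H and shifted by 1 as in [gcube], is f p / H; cleared of the
    denominator, the condition of the cube becomes this inequality between integers. *)
Definition in_cell m (z : pos -> nat) H (f : box_index H) : bool :=
  [forall p, z p * H <= f p * 2 ^ m < (z p).+1 * H]%N.

Definition cell_count m z (Y : set 'rV[o]_d) H : nat :=
  #|[set f : box_index H | in_cell m z f && `[< Y (box_point f) >]]%SET|.

Definition bvol (H : nat) : R := (2 * H%:R) ^+ (d * k).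

Lemma cvg_card_shift m (z : pos -> nat) (a : pos -> int) :
  (forall p, z p < 2 ^ m.+1)%N ->
  (#|[set f : box_index H | [forall p, f p \in shift_itv m (z p) (a p) H]]%SET|%:R / bvol H)
    @[H --> \oo] --> ((2 ^- m.+1) ^+ (d * k) : R).
Proof.
move=> zJ.
have -> : (2 ^- m.+1) ^+ (d * k) = \prod_(p : pos) 2 ^- m.+1 :> R.
  by rewrite prodr_const card_prod !card_ord.
have h (p : pos) : (#|shift_itv m (z p) (a p) H|%:R / (2 * H%:R)) @[H --> \oo] --> (2 ^- m.+1 : R).
  exact: cvg_shift_itv.
have h2 : (\prod_(p : pos) (#|shift_itv m (z p) (a p) H|%:R / (2 * H%:R))) @[H --> \oo]
    --> (\prod_(p : pos) 2 ^- m.+1 : R).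
  exact: (@cvg_prodn R pos (index_enum _) _ (fun=> 2 ^- m.+1) h).
apply: (@eq_cvgn _ _ _ _ _ h2) => H.
rewrite big_split [X in _ = _ * X]prodr_const card_prod !card_ord exprVn -/(bvol H) /=; congr (_ / _).
rewrite -natr_prod; congr (_%:R).
transitivity #|family (fun p : pos => mem (shift_itv m (z p) (a p) H))|.
  by apply: eq_card => f; rewrite !inE; apply: eq_forallb => p.
rewrite card_family foldrE big_map big_enum.
by apply: eq_bigr => p _; apply: eq_card.
Qed.

Lemma in_cellE m z H (f : box_index H) :
  in_cell m z f = [forall p, f p \in shift_itv m (z p) 0 H].
Proof. by apply: eq_forallb => p; rewrite inE addr0 -!PoszM !lez_nat !ltz_nat andbb. Qed.

Lemma cvg_cell_count_setT m z : (forall p, z p < 2 ^ m.+1)%N ->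
  ((cell_count m z setT H)%:R / bvol H) @[H --> \oo] --> ((2 ^- m.+1) ^+ (d * k) : R).
Proof.
move=> zJ; apply: (@eq_cvgn _ _ _ _ _ (cvg_card_shift (fun=> 0) zJ)) => H.
congr (_%:R / _); apply: eq_card => f; rewrite !inE -in_cellE.
by rewrite (_ : `[< _ >] = true) ?andbT//; apply/asboolP.
Qed.

(** Let T be the points of Y in the cell and S the points of the cell that stay in it when A is
    added. Translation injects their intersection into Y', their union lies in the cell, and |T| +
    |S| is the sum of the sizes of union and intersection. *)
Lemma cell_count_shift m z (A : 'rV[o]_d) (Y Y' : set 'rV[o]_d) H :
  (forall p, z p < 2 ^ m.+1)%N -> (forall B, Y B -> Y' (B + A)) ->
  (cell_count m z Y H + #|[set f : box_index H | [forall p,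
     f p \in shift_itv m (z p) (coord_int E (A ord0 p.1) ord0 p.2) H]]%SET| <=
   cell_count m z Y' H + cell_count m z setT H)%N.
Proof.
move=> zJ YY'; pose a := fun p : pos => coord_int E (A ord0 p.1) ord0 p.2.
set S := (X in (_ + #|pred_of_set X| <= _)%N).
set T := [set f : box_index H | in_cell m z f && `[< Y (box_point f) >]]%SET.
rewrite /cell_count -/T.
have TS : (#|T :&: S| <= cell_count m z Y' H)%N.
  (* Translation by A on indices; the default of [insubd] and the absolute value never intervene on
     [S]. *)
  pose g (f : box_index H) : box_index H := [ffun p => insubd (f p) (absz ((f p)%:Z + a p))].
  have gE f p : f \in S -> (g f p)%:Z = (f p)%:Z + a p.
    rewrite inE => /forallP/(_ p); rewrite inE -/(a p) => /andP[_].
    have J0 : (0 < 2 ^ m)%N by rewrite expn_gt0.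
    move=> /andP[h1 h2]; have ge0 : 0 <= (f p)%:Z + a p by nia.
    rewrite ffunE val_insubd; case: ifPn => [_|]; first exact: gez0_abs.
    move/negP; case; rewrite -ltz_nat (gez0_abs ge0).
    have := zJ p; rewrite expnS => zp.
    by move: (f p : nat) h1 h2 ge0 => x h1 h2 ge0; nia.
  rewrite -(@card_in_imset _ _ g).
    apply: subset_leq_card; apply/fintype.subsetP => _ /imsetP[f + ->].
    rewrite !inE => /andP[/andP[/forallP fz /asboolP fY] fS].
    have {}fS : f \in S by rewrite inE.
    apply/andP; split.
      apply/forallP => p; move: (fS); rewrite inE => /forallP/(_ p).
      by rewrite inE => /andP[_]; rewrite -(gE f p fS) -PoszM lez_nat ltz_nat.
    apply/asboolP; suff -> : box_point (g f) = box_point f + A by apply: YY'.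
    apply/rowP => i; rewrite !mxE -[A 0 i](coord_intK hE) -of_coordD; congr of_coord.
    by apply/rowP => j; rewrite !mxE gE// addrAC.
  move=> f f'; rewrite !inE => /andP[_ fS] /andP[_ f'S] /ffunP gff'.
  have {}fS : f \in S by rewrite inE.
  have {}f'S : f' \in S by rewrite inE.
  apply/ffunP => p; apply: ord_inj; apply/eqP; rewrite -eqz_nat -(eqr_int int).
  have /(congr1 (fun x : 'I__ => (x : nat)%:Z)) := gff' p.
  by rewrite !gE// => /addIr ->.
have TUS : (#|T :|: S| <= cell_count m z setT H)%N.
  apply: subset_leq_card; apply/fintype.subsetP => f; rewrite !inE => h.
  have -> : `[< setT (box_point f) >] = true by apply/asboolP.
  case/orP: h => [/andP[->]//|h]; rewrite andbT.
  by apply/forallP => p; move/forallP: h => /(_ p); rewrite inE => /andP[].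
by rewrite -cardsUI addnC; apply: leq_add.
Qed.

End LatticeDensity.

(** * Joint equidistribution of cells *)

Section JointCells.
Variables (R : realType) (d : nat) (K : fieldExtType rat).
Local Notation k := (\dim {:K}).
Local Notation o := (ringInt K).
Local Notation pos := ('I_d * 'I_k)%type.
Variable E : 'I_k -> o.
Hypothesis hE : integral_basis E.

Lemma cell_count_bigcup m z H n (W : {set 'I_n}) (Y : 'I_n -> set 'rV[o]_d) :
  (forall i j B, Y i B -> Y j B -> i = j) ->
  cell_count E m z (\bigcup_(i in [set` W]) Y i) H = (\sum_(i in W) cell_count E m z (Y i) H)%N.
Proof.
move=> disj; pose p i (f : box_index d K H) := in_cell m z f && `[< Y i (box_point E f) >].
have cE (Z : set 'rV[o]_d) : cell_count E m z Z H =
    (\sum_(f : box_index d K H) (in_cell m z f && `[< Z (box_point E f) >] : nat))%N.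
  by rewrite /cell_count -sum1dep_card [LHS]big_mkcond; apply: eq_bigr => f _; case: ifP.
rewrite cE (eq_bigr (fun i => \sum_f (p i f : nat))%N); last by move=> i _; rewrite cE.
rewrite exchange_big/=; apply: eq_bigr => f _; rewrite /p.
case: (in_cell m z f) => /=; last by rewrite big1.
have [[i iW iY]|nY] := asboolP ((\bigcup_(i in [set` W]) Y i) (box_point E f)).
  rewrite (bigD1 i)//= (_ : `[< Y i _ >] = true); last exact/asboolP.
  rewrite big1 ?addn0// => j /andP[_ ji]; case: asboolP => // jY.
  by rewrite (disj _ _ _ jY iY) eqxx in ji.
by rewrite big1// => i iW; case: asboolP => // iY; case: nY; exists i.
Qed.

(* Translating by [A] maps one piece into another, up to points leaving the
   cell; these are negligible, so all pieces have the same density. *)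
Lemma cvg_cell_count_piece m z n (Y : set 'rV[o]_d) (Yi : 'I_n -> set 'rV[o]_d) (del : R) :
  (forall p : pos, z p < 2 ^ m.+1)%N -> (0 < n)%N ->
  (forall i j B, Yi i B -> Yi j B -> i = j) ->
  (forall B, Y B <-> exists i, Yi i B) ->
  (forall i j, exists A, forall B, Yi i B -> Yi j (B + A)) ->
  ((cell_count E m z Y H)%:R / bvol R d K H) @[H --> \oo] --> del ->
  forall j, ((cell_count E m z (Yi j) H)%:R / bvol R d K H) @[H --> \oo] --> del / n%:R.
Proof.
move=> zJ n0 disj cover trans hY j.
have bv0 H : 0 <= bvol R d K H by rewrite exprn_ge0// mulr_ge0.
have YE : Y = \bigcup_(i in [set` [set: 'I_n]%SET]) Yi i.
  apply/seteqP; split=> B; first by move=> /cover[i hi]; exists i => //=; rewrite inE.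
  by move=> [i _ hi]; apply/cover; exists i.
pose q i H : R := (cell_count E m z (Yi i) H)%:R / bvol R d K H.
have qsum H : (cell_count E m z Y H)%:R / bvol R d K H = \sum_i q i H.
  rewrite YE cell_count_bigcup// natr_sum mulr_suml.
  by apply: eq_bigl => i; rewrite inE.
have cmp i i' : exists2 e : nat -> R, e @ \oo --> (0 : R) & forall H, q i H <= q i' H + e H.
  have [A hA] := trans i i'.
  pose s H : R := (cell_count E m z setT H)%:R / bvol R d K H -
     #|[set f : box_index d K H | [forall p,
     f p \in shift_itv m (z p) (coord_int E (A ord0 p.1) ord0 p.2) H]]%SET|%:R / bvol R d K H.
  exists s => [|H].
    rewrite -(subrr ((2 ^- m.+1) ^+ (d * k) : R)).
    apply: cvgB; first exact: cvg_cell_count_setT.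
    exact: (cvg_card_shift (fun p => coord_int E (A ord0 p.1) ord0 p.2) zJ).
  rewrite /q /s -mulrBl -mulrDl ler_wpM2r ?invr_ge0//.
  by rewrite addrA lerBrDr -!natrD ler_nat; exact: cell_count_shift.
have /choice[e1 he1] i : exists e : nat -> R,
    e @ \oo --> (0 : R) /\ forall H, q i H <= q j H + e H.
  by have [e] := cmp i j; exists e.
have /choice[e2 he2] i : exists e : nat -> R,
    e @ \oo --> (0 : R) /\ forall H, q j H <= q i H + e H.
  by have [e] := cmp j i; exists e.
have e0 : (0 : R) = \sum_(i < n) 0 by rewrite big1.
have s1 : (\sum_(i < n) e1 i H) @[H --> \oo] --> (0 : R).
  rewrite [X in _ --> X]e0.
  by apply: cvg_sumn => i _; have [] := he1 i.
have s2 : (\sum_(i < n) e2 i H) @[H --> \oo] --> (0 : R).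
  rewrite [X in _ --> X]e0.
  by apply: cvg_sumn => i _; have [] := he2 i.
have nR : (0 : R) < n%:R by rewrite ltr0n.
have h1 : (((cell_count E m z Y H)%:R / bvol R d K H - \sum_(i < n) e1 i H) / n%:R)
    @[H --> \oo] --> del / n%:R.
  by rewrite -[in X in _ --> X](subr0 del); exact: cvgM (cvgB hY s1) (cvg_cst (n%:R^-1 : R)).
have h2 : (((cell_count E m z Y H)%:R / bvol R d K H + \sum_(i < n) e2 i H) / n%:R)
    @[H --> \oo] --> del / n%:R.
  by rewrite -[in X in _ --> X](addr0 del); exact: cvgM (cvgD hY s2) (cvg_cst (n%:R^-1 : R)).
apply: (@squeeze_cvgr _ _ _ _ _ _ _ _ _ h1 h2); apply: nearW => H.
have -> : (cell_count E m z (Yi j) H)%:R / bvol R d K H = q j H by [].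
have qn : q j H * n%:R = \sum_(i < n) q j H by rewrite sumr_const card_ord mulr_natr.
rewrite ler_pdivrMr// ler_pdivlMr// qn qsum.
apply/andP; split.
  by rewrite lerBlDr -big_split/=; apply: ler_sum => i _; have [] := he1 i.
by rewrite -big_split/=; apply: ler_sum => i _; have [] := he2 i.
Qed.

Variable C : forall P : nzprime K, padic_completion R P.
Local Notation ncl P m := (adic_ncells d hE C P m).

Definition local_cells m (s : seq (nzprime K)) (W : forall P, {set 'I_(ncl P m)}) : set 'rV[o]_d :=
  [set A | forall P, P \in s -> cells (@adic_cell R d K E hE C P) (W P) (embed C P A)].

(** When a place P is added, the set for [s] is split according to the cell at P. Independence
    amounts to equal densities of the pieces, and these are exchanged by a lattice vector that is
    negligible at the places of [s]. *)
Lemma cvg_cell_count_local m z (s : seq (nzprime K)) (W : forall P, {set 'I_(ncl P m)}) :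
  (forall p : pos, z p < 2 ^ m.+1)%N -> uniq s ->
  ((cell_count E m z (local_cells s W) H)%:R / bvol R d K H) @[H --> \oo] -->
    ((2 ^- m.+1) ^+ (d * k) * \prod_(P <- s) (#|W P|%:R / (ncl P m)%:R) : R).
Proof.
move=> zJ; elim: s => [_|P s ih /= /andP[Ps us]].
  rewrite big_nil mulr1 (_ : local_cells _ _ = setT); first exact: cvg_cell_count_setT.
  by apply/seteqP; split=> // A _ P.
pose Yi (i : 'I_(ncl P m)) := [set A | local_cells s W A /\ adic_cell i (embed C P A)].
have disj i j B : Yi i B -> Yi j B -> i = j by move=> [_ hi] [_ hj]; exact: adic_cell_triv hi hj.
have E1 : local_cells (P :: s) W = \bigcup_(i in [set` W P]) Yi i.
  apply/seteqP; split=> A.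
    move=> h; have [i iW hi] := h P (mem_head _ _).
    by exists i => //; split=> // Q Qs; apply: h; rewrite inE Qs orbT.
  move=> [i iW [hs hi]] Q; rewrite inE => /predU1P[->|]; last exact: hs.
  by exists i.
have piece := @cvg_cell_count_piece m z (ncl P m) (local_cells s W) Yi _ zJ
  (adic_ncells_gt0 d hE C P m) disj.
have {}piece := piece _ _ _ (ih us).
rewrite E1 big_cons.
have -> : (2 ^- m.+1) ^+ (d * k) * (#|W P|%:R / (ncl P m)%:R *
   \prod_(j <- s) (#|W j|%:R / (ncl j m)%:R)) = \sum_(i in W P)
   ((2 ^- m.+1) ^+ (d * k) * (\prod_(j <- s) (#|W j|%:R / (ncl j m)%:R)) / (ncl P m)%:R) :> R.
  have aux (a w n p : R) : a * (w / n * p) = w * (a * p / n) by ring.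
  by rewrite sumr_const -[RHS]mulr_natl aux.
apply: (@eq_cvgn _ _ (fun H => \sum_(i in W P) (cell_count E m z (Yi i) H)%:R / bvol R d K H)).
  by move=> H; rewrite cell_count_bigcup// natr_sum mulr_suml.
apply: cvg_sumn => i _; apply: piece.
  move=> B; split=> [h|[j []]//].
  by have [j hj] := @adic_cell_cover R d K E hE C P m (embed C P B); exists j.
move=> j j'.
(* The target of weak approximation: the difference of the two representatives at P, and 0 at the
   other places. *)
pose t Q : 'rV[pcInt (C Q)]_d :=
  if pselect (Q = P) is left _ then embed C Q (adic_rep j' - adic_rep j) else 0.
have /choice[A hA] : forall l : 'I_d, exists a : o, forall Q, Q \in P :: s ->
    pc_dist (t Q 0 l) (to_pcInt (C Q) a) < 2 ^- m.
  move=> l; apply: (weak_approximation hE (fun Q => t Q 0 l)); first exact: pow2V_gt0.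
  by rewrite /= Ps.
pose A' : 'rV[o]_d := \row_l A l.
have hA' Q : Q \in P :: s -> adic_near m (t Q) (embed C Q A').
  by move=> Qs l; rewrite !mxE; exact: hA.
exists A' => B [hs hj]; split.
  move=> Q Qs; have [l lW hl] := hs Q Qs; exists l => //.
  apply: adic_near_trans hl _; rewrite embedD -[X in adic_near _ X]addr0.
  apply/adic_nearD; have := hA' Q; rewrite inE Qs orbT => /(_ isT).
  by rewrite /t; case: pselect => // QP; exfalso; move: Ps; rewrite -QP Qs.
have := hA' P; rewrite mem_head => /(_ isT); rewrite /t; case: pselect => // _ h.
rewrite /adic_cell/= embedD.
have -> : adic_rep j' = adic_rep j' - adic_rep j + adic_rep j.
  by rewrite subrK.
rewrite embedD; apply: (@adic_near_trans _ _ _ _ _ _ (embed C P A' + embed C P (adic_rep j))).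
  by rewrite ![_ + embed C P (adic_rep _)]addrC; apply/adic_nearD.
by rewrite [embed C P B + _]addrC; apply/adic_nearD.
Qed.

End JointCells.
(** First m is fixed so that both [L m] and [M m] are close to l, then H grows; no uniformity in m
    of the limits over H is required. *)
Lemma double_squeeze (R : realType) (c : nat -> R) (lo up : nat -> nat -> R)
    (L M : nat -> R) (l : R) :
  (forall m H, (0 < H)%N -> lo m H <= c H <= up m H) ->
  (forall m, lo m @ \oo --> L m) -> (forall m, up m @ \oo --> M m) ->
  L @ \oo --> l -> M @ \oo --> l -> c @ \oo --> l.
Proof.
move=> hc hlo hup hL hM; apply/cvgrPdist_lt => e e0.
have e2 : 0 < e / 2 by rewrite divr_gt0.
have [m [hLm hMm]] : exists m, `|l - L m| < e / 2 /\ `|l - M m| < e / 2.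
  have /cvgrPdist_lt/(_ _ e2) [N1 _ h1] := hL.
  have /cvgrPdist_lt/(_ _ e2) [N2 _ h2] := hM.
  by exists (maxn N1 N2); split; [apply: h1|apply: h2]; rewrite /= ?leq_maxl ?leq_maxr.
have /cvgrPdist_lt/(_ _ e2) h1 := hlo m.
have /cvgrPdist_lt/(_ _ e2) h2 := hup m.
near=> H.
have H0 : (0 < H)%N by near: H; exact: nbhs_infty_gt.
have /andP[c1 c2] := hc m H H0.
have b1 : `|L m - lo m H| < e / 2 by near: H.
have b2 : `|M m - up m H| < e / 2 by near: H.
move: b1 b2 hLm hMm; rewrite !ltr_norml => /andP[? ?] /andP[? ?] /andP[? ?] /andP[? ?].
by apply/andP; split; lra.
Unshelve. all: end_near.
Qed.

(** * Joint density of finitely many local conditions *)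

Section JointDensity.
Variables (R : realType) (d : nat) (K : fieldExtType rat).
Local Notation k := (\dim {:K}).
Local Notation o := (ringInt K).
Local Notation pos := ('I_d * 'I_k)%type.
Local Notation ix m := {ffun 'I_d * 'I_k -> 'I_(2 ^ m.+1)}.
Variable E : 'I_k -> o.
Hypothesis hE : integral_basis E.
Variable C : forall P : nzprime K, padic_completion R P.
Local Notation ncl P m := (adic_ncells d hE C P m).

Definition joint_count m (Z : {set ix m}) (Y : set 'rV[o]_d) H : nat :=
  #|[set f : box_index d K H | [exists z in Z, in_cell m (fun p => z p : nat) f] &&
     `[< Y (box_point E f) >]]%SET|.

Lemma in_cell_uniq m (z z' : pos -> nat) H (f : box_index d K H) :
  in_cell m z f -> in_cell m z' f -> z =1 z'.
Proof.
move=> /forallP h /forallP h' p; have := h p; have := h' p => /andP[a b] /andP[a' b'].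
by have := leq_ltn_trans a b'; have := leq_ltn_trans a' b;
  rewrite !ltn_mul2r => /andP[_] h1 /andP[_] h2; lia.
Qed.

Lemma in_cell_exists m H (f : box_index d K H) : (0 < H)%N ->
  exists z : ix m, in_cell m (fun p => z p : nat) f.
Proof.
move=> H0.
have hz p : (f p * 2 ^ m %/ H < 2 ^ m.+1)%N.
  rewrite ltn_divLR// expnS; have := ltn_ord (f p).
  have : (0 < 2 ^ m)%N by rewrite expn_gt0.
  by move: (f p : nat) => x; nia.
exists [ffun p => Ordinal (hz p)]; apply/forallP => p; rewrite ffunE /=.
by rewrite leq_trunc_div -ltn_divLR // ltnSn.
Qed.

Lemma joint_countE m (Z : {set ix m}) (Y : set 'rV[o]_d) H :
  joint_count Z Y H = (\sum_(z in Z) cell_count E m (fun p => z p : nat) Y H)%N.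
Proof.
pose g (z : ix m) (f : box_index d K H) := in_cell m (fun p => z p : nat) f && `[< Y (box_point E f) >].
rewrite (eq_bigr (fun z => \sum_f (g z f : nat))%N); last first.
  move=> z _; rewrite /cell_count -sum1dep_card [LHS]big_mkcond.
  by apply: eq_bigr => f _; rewrite -/(g z f); case: (g z f).
rewrite exchange_big /joint_count -sum1dep_card [LHS]big_mkcond; apply: eq_bigr => f _; rewrite /g.
case: `[< _ >] => /=; last by rewrite andbF big1// => z _; rewrite andbF.
rewrite andbT; case: existsP => [[z /andP[zZ fz]]|nz].
  rewrite (bigD1 z)//= fz big1 ?addn0// => z' /andP[_ z'z].
  rewrite andbT; case h: (in_cell _ _ _) => //; case/eqP: z'z.
  by apply/ffunP => p; apply: ord_inj; exact: (in_cell_uniq h fz).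
rewrite big1// => z zZ; rewrite andbT; case h: (in_cell _ _ _) => //.
by case: nz; exists z; rewrite zZ.
Qed.

Lemma cvg_joint_count m (Z : {set ix m}) (s : seq (nzprime K)) (W : forall P, {set 'I_(ncl P m)}) :
  uniq s ->
  ((joint_count Z (local_cells s W) H)%:R / bvol R d K H) @[H --> \oo] -->
    (#|Z|%:R / 2 ^+ (m.+1 * (d * k)) * \prod_(P <- s) (#|W P|%:R / (ncl P m)%:R) : R).
Proof.
move=> us.
have -> : #|Z|%:R / 2 ^+ (m.+1 * (d * k)) * \prod_(P <- s) (#|W P|%:R / (ncl P m)%:R) =
  \sum_(z in Z) ((2 ^- m.+1) ^+ (d * k) * \prod_(P <- s) (#|W P|%:R / (ncl P m)%:R)) :> R.
  by rewrite sumr_const -[RHS]mulr_natl mulrA exprVn -exprM.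
apply: (@eq_cvgn _ _ (fun H => \sum_(z in Z)
  (cell_count E m (fun p => z p : nat) (local_cells s W) H)%:R / bvol R d K H)).
  by move=> H; rewrite joint_countE natr_sum mulr_suml.
by apply: cvg_sumn => z _; apply: cvg_cell_count_local.
Qed.

Lemma box_point_kinf H (f : box_index d K H) i j :
  to_kinf R E (box_point E f) i j = (f (i, j))%:R - H%:R.
Proof. by rewrite !mxE of_coordK// mxE intrB. Qed.

Lemma in_cell_cube m (z : ix m) H (f : box_index d K H) : (0 < H)%N ->
  in_cell m (fun p => z p : nat) f -> cube z (H%:R^-1 *: to_kinf R E (box_point E f)).
Proof.
move=> H0 /forallP h i j; have := h (i, j).
have HR : 0 < H%:R :> R by rewrite ltr0n.
rewrite mxE box_point_kinf mulrBr mulVf ?gt_eqF// subrK -mulrA mulrC ler_pdivlMr//.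
by rewrite ltr_pdivrMr// -natrX -!natrM ler_nat ltr_nat.
Qed.

Variable nu : forall P : nzprime K, probability (borel 'rV[pcInt (C P)]_d) R.
Hypothesis hnu : forall P, translation_invariant (@borel_sets 'rV[pcInt (C P)]_d) (nu P).
Variables mu_inf nu_inf : {measure set (borel (kinfd R d K)) -> \bar R}.
Hypothesis hmu_inf : is_lebesgue mu_inf.
Hypothesis hnu_inf : is_haar_covol1 E nu_inf.
Variable U : forall P : nzprime K, set 'rV[pcInt (C P)]_d.
Hypothesis hU : forall P, nu P (boundary (@U P)) = 0%E.
Variable Uinf : set (kinfd R d K).
Hypothesis hUinf : mu_inf (boundary Uinf) = 0%E.
Hypothesis hcone : [set r *: x | r in [set r : R | 0 <= r] & x in Uinf] = Uinf.

Local Notation loc := (in_local E U Uinf).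
Local Notation sloc := (s_local U Uinf nu nu_inf).

Lemma cone_scale (r : R) x : 0 < r -> Uinf (r *: x) <-> Uinf x.
Proof.
have h (t : R) y : 0 < t -> Uinf y -> Uinf (t *: y).
  by move=> t0 hy; rewrite -hcone; exists t; [exact: ltW|exists y].
move=> r0; split; last exact: h.
by move=> /(@h r^-1 (r *: x)); rewrite invr_gt0 scalerA mulVf ?gt_eqF// scale1r; apply.
Qed.

Definition local_count (s : seq (option (nzprime K))) H : nat :=
  #|[set f : box_index d K H | `[< forall eta, eta \in s -> loc (box_point E f) eta >]]%SET|.

Lemma cvg_local_count s : uniq s ->
  ((local_count s H)%:R / bvol R d K H) @[H --> \oo] --> (\prod_(eta <- s) sloc eta : R).
Proof.
move=> us; pose t := pmap id s; pose b := None \in s.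
have ut : uniq t by rewrite (pmap_uniq (g := some))// => -[].
have memt P : (P \in t) = (Some P \in s) by rewrite mem_pmap map_id.
have -> : \prod_(eta <- s) sloc eta = (if b then sloc None else 1) * \prod_(P <- t) sloc (Some P).
  rewrite /b /t; elim: (s) us => [|[P|] s' ih] /=; first by rewrite !big_nil mulr1.
    by move=> /andP[_ /ih]; rewrite !big_cons inE/= => ->; rewrite mulrCA.
  move=> /andP[nN /ih]; rewrite big_cons => ->.
  by rewrite (negPf nN) mul1r.
pose Zlo m : {set ix m} := if b then inner_cells (@cube R d K) Uinf m else [set: ix m]%SET.
pose Zup m : {set ix m} := if b then outer_cells (@cube R d K) Uinf m else [set: ix m]%SET.
pose Wlo m P := inner_cells (@adic_cell R d K E hE C P) (@U P) m.
pose Wup m P := outer_cells (@adic_cell R d K E hE C P) (@U P) m.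
have condE A : (forall eta, eta \in s -> loc A eta) <->
    (b -> Uinf (to_kinf R E A)) /\ forall P, P \in t -> @U P (embed C P A).
  split=> [h|[h1 h2] [P|] hs]; [split=> [/h//|P]|..].
  - by rewrite memt => /h.
  - by apply: h2; rewrite memt.
  - exact: h1.
(* Here the null boundary for [mu_inf] turns into a limit expressed by [nu_inf]. *)
have [hc1 hc2] := cvg_cubes hE hnu_inf (cvg_bad_cubes hmu_inf hUinf).
have ad P := cvg_adic_cells hE (@hnu P) (@hU P).
have full : (#|[set: ix m]%SET|%:R / 2 ^+ (m.+1 * (d * k))) @[m --> \oo] --> (1 : R).
  apply: (@eq_cvgn _ _ _ _ _ (cvg_cst (1 : R))) => m.
  by rewrite cardsT card_ffun card_prod !card_ord natrX natrX -exprM mulfV// gt_eqF// exprn_gt0.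
apply: (@double_squeeze _ _
  (fun m H => (joint_count (Zlo m) (local_cells t (Wlo m)) H)%:R / bvol R d K H)
  (fun m H => (joint_count (Zup m) (local_cells t (Wup m)) H)%:R / bvol R d K H)
  (fun m => #|Zlo m|%:R / 2 ^+ (m.+1 * (d * k)) * \prod_(P <- t) (#|Wlo m P|%:R / (ncl P m)%:R))
  (fun m => #|Zup m|%:R / 2 ^+ (m.+1 * (d * k)) * \prod_(P <- t) (#|Wup m P|%:R / (ncl P m)%:R))).
- move=> m H H0; have bv : 0 <= (bvol R d K H)^-1 by rewrite invr_ge0 exprn_ge0// mulr_ge0.
  have HR : 0 < H%:R^-1 :> R by rewrite invr_gt0 ltr0n.
  apply/andP; split; apply: ler_wpM2r => //; rewrite ler_nat; apply: subset_leq_card;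
    apply/fintype.subsetP => f; rewrite !inE.
    move=> /andP[/existsP[z /andP[zZ fz]] /asboolP hl]; apply/asboolP/condE; split.
      move=> hb; move: zZ; rewrite /Zlo hb inE => /asboolP zU.
      by apply/(cone_scale _ HR)/zU; exact: in_cell_cube.
    by move=> P /hl[i]; rewrite /= inE => /asboolP; apply.
  move=> /asboolP/condE[hb hP]; apply/andP; split.
    have [z fz] := in_cell_exists m f H0; apply/existsP; exists z; rewrite fz andbT /Zup.
    case: (b) hb => // /(_ isT) hb; rewrite inE; apply/asboolP.
    exists (H%:R^-1 *: to_kinf R E (box_point E f)); split; first exact: in_cell_cube.
    exact/cone_scale.
  apply/asboolP => P /hP hPU.
  have [i hi] := adic_cell_cover hE m (embed C P (box_point E f)).
  by exists i => //=; rewrite inE; apply/asboolP; exists (embed C P (box_point E f)).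
- by move=> m; exact: cvg_joint_count.
- by move=> m; exact: cvg_joint_count.
- apply: cvgM; first by rewrite /Zlo; case: (b).
  by apply: cvg_prodn => P; have [] := ad P.
- apply: cvgM; first by rewrite /Zup; case: (b).
  by apply: cvg_prodn => P; have [] := ad P.
Qed.

End JointDensity.
(** * Set partitions and powers of sums of indicators *)

Section MomentCombinatorics.
Variables (R : comNzRingType) (I : finType) (x : I -> R).

Definition inj_sum (l : nat) : R :=
  \sum_(e : {ffun 'I_l -> I} | injectiveb e) \prod_(m < l) x (e m).

Variable n : nat.
Implicit Types (g : {ffun 'I_n -> I}) (Q : {set {set 'I_n}}).

Lemma kernel_partitionE g Q : finset.partition Q [set: 'I_n]%SET ->
  (preim_partition g [set: 'I_n]%SET == Q) =
  [forall a, forall b, (g a == g b) == (b \in finset.pblock Q a)].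
Proof.
move=> partQ; apply/eqP/forallP => [<- a|h].
  apply/forallP => b; apply/eqP; rewrite /preim_partition.
  rewrite (@pblock_equivalence_partition _ _ [set: 'I_n]%SET) ?inE//.
  by split=> // /eqP ->.
rewrite -(equivalence_partition_pblock partQ).
rewrite /preim_partition /equivalence_partition.
apply: eq_in_imset => a _; apply/finset.setP => b; rewrite !inE.
by have /forallP/(_ b)/eqP := h a.
Qed.

(** Maps with kernel Q are the injective maps on the blocks, composed with the block map [rk]; [sg]
    picks a point of each block and so inverts the correspondence. *)
Lemma sum_kernel Q : finset.partition Q [set: 'I_n]%SET ->
  \sum_(g : {ffun 'I_n -> I} | preim_partition g [set: 'I_n]%SET == Q)
     \prod_(i in g @: [set: 'I_n]%SET) x i = inj_sum #|Q|.
Proof.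
move=> partQ; have /and3P[/eqP covQ trivQ set0Q] := partQ.
have bQ a : finset.pblock Q a \in Q by rewrite finset.pblock_mem// covQ inE.
pose rk a : 'I_#|Q| := enum_rank_in (bQ a) (finset.pblock Q a).
have rkE a b : (rk a == rk b) = (b \in finset.pblock Q a).
  rewrite -finset.eq_pblock ?covQ ?inE//; apply/eqP/eqP => [h|h].
    have : enum_val (rk a) = enum_val (rk b) by rewrite h.
    by rewrite !enum_rankK_in.
  by apply: enum_val_inj; rewrite !enum_rankK_in.
have /choice[sg hsg] : forall i : 'I_#|Q|, exists a, rk a = i.
  move=> i; have iQ := enum_valP i.
  have /set0Pn[a ai] : enum_val i != finset.set0 by apply: contraNneq set0Q => <-.
  exists a; apply: enum_val_inj; rewrite enum_rankK_in//.
  by rewrite (finset.def_pblock trivQ iQ ai).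
rewrite (reindex_onto (fun e : {ffun 'I_#|Q| -> I} => [ffun a => e (rk a)])
  (fun g => [ffun i => g (sg i)])) /=; last first.
  move=> g; rewrite kernel_partitionE// => /forallP h; apply/ffunP => a; rewrite !ffunE.
  by have /forallP/(_ a)/eqP := h (sg (rk a)); rewrite -rkE hsg eqxx => /eqP.
rewrite /inj_sum; apply: eq_big => [e|e].
  rewrite kernel_partitionE// andbC (_ : [ffun _ => _] == e = true); last first.
    by apply/eqP/ffunP => i; rewrite !ffunE hsg.
  apply/forallP/injectiveP => [h i j eij|einj a].
    have /forallP/(_ (sg j)) := h (sg i).
    by rewrite !ffunE !hsg eij eqxx -rkE !hsg => /eqP/esym/eqP.
  by apply/forallP => b; rewrite !ffunE -rkE inj_eq.
rewrite kernel_partitionE// => /andP[/forallP h _].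
have einj : injective e.
  move=> i j eij; have /forallP/(_ (sg j)) := h (sg i).
  by rewrite !ffunE !hsg eij eqxx -rkE !hsg => /eqP/esym/eqP.
have -> : [ffun a => e (rk a)] @: [set: 'I_n]%SET = e @: [set: 'I_#|Q|]%SET.
  apply/finset.setP => i; apply/imsetP/imsetP => [[a _ ->]|[j _ ->]].
    by exists (rk a); rewrite ?inE ?ffunE.
  by exists (sg j); rewrite ?inE ?ffunE ?hsg.
rewrite big_imset/=; last by move=> i j _ _; exact: einj.
by apply: eq_bigl => m; rewrite inE.
Qed.

Definition block_type Q : {ffun 'I_n -> 'I_n.+1} :=
  [ffun j : 'I_n => inord #|[set B in Q | #|B| == j.+1]%SET|].

Lemma block_typeE Q (j : 'I_n) : finset.partition Q [set: 'I_n]%SET ->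
  block_type Q j = #|[set B in Q | #|B| == j.+1]%SET| :> nat.
Proof.
move=> partQ; rewrite ffunE inordK// ltnS.
have /and3P[_ _ set0Q] := partQ.
have cQ := card_partition partQ; rewrite cardsT card_ord in cQ.
apply: (@leq_trans #|Q|).
  by apply: subset_leq_card; apply/fintype.subsetP => B; rewrite inE => /andP[].
rewrite [leqRHS]cQ -sum1_card; apply: leq_sum => B BQ.
by rewrite card_gt0; apply: contraNneq set0Q => <-.
Qed.

(** Used with F the identity, for the total size n, and with F constant 1, for the number of
    blocks. *)
Lemma sum_block_size (F : nat -> nat) Q : finset.partition Q [set: 'I_n]%SET ->
  (\sum_(B in Q) F #|B| = \sum_(j < n) F j.+1 * #|[set B in Q | #|B| == j.+1]%SET|)%N.
Proof.
move=> partQ; have /and3P[_ _ set0Q] := partQ.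
have B0 B : B \in Q -> (0 < #|B|)%N.
  by move=> BQ; rewrite card_gt0; apply: contraNneq set0Q => <-.
have Bn (B : {set 'I_n}) : B \in Q -> (#|B|.-1 < n)%N.
  by move=> BQ; rewrite prednK ?B0// -[leqRHS]card_ord max_card.
(* The block index [c] needs a default value in ['I_n], hence the separate case n = 0. *)
have [n0|n0] := posnP n.
  rewrite !big1// => [j _|B /Bn h].
    by have := leq_trans (ltn_ord j) (eq_leq n0).
  by have := leq_trans h (eq_leq n0).
pose c (B : {set 'I_n}) : 'I_n := insubd (Ordinal n0) #|B|.-1.
have cE B : B \in Q -> c B = #|B|.-1 :> nat.
  by move=> BQ; rewrite val_insubd Bn.
rewrite (partition_big c xpredT)//=; apply: eq_bigr => j _.
rewrite (eq_bigr (fun=> F j.+1)); last first.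
  by move=> B /andP[BQ /eqP <-]; rewrite cE// prednK// B0.
rewrite sum_nat_const mulnC; congr (_ * _)%N; apply: eq_card => B; rewrite !inE.
rewrite unfold_in; case BQ: (B \in Q) => //; rewrite !andTb -(inj_eq (@ord_inj n)) cE//.
by have := B0 B BQ; case: #|B|.
Qed.

(** The product runs over the image of g because an indicator is idempotent: a place hit several
    times imposes one condition. The densities are not idempotent, which is why the kernels of the
    maps survive in the formula. *)
Lemma sum_image_partition_types :
  \sum_(g : {ffun 'I_n -> I}) \prod_(i in g @: [set: 'I_n]%SET) x i =
  \sum_(tau : {ffun 'I_n -> 'I_n.+1} | partition_type tau)
    (num_partitions tau)%:R * inj_sum (ell tau).
Proof.
have setT0 (g : {ffun 'I_n -> I}) : finset.partition (preim_partition g [set: 'I_n]%SET) [set: 'I_n]%SET.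
  exact: preim_partitionP.
rewrite (partition_big (fun g : {ffun 'I_n -> I} => preim_partition g [set: 'I_n]%SET)
  (fun Q => finset.partition Q [set: 'I_n]%SET))//=.
rewrite (eq_bigr (fun Q => inj_sum #|Q|)); last by move=> Q; exact: sum_kernel.
rewrite (partition_big block_type (fun tau : {ffun 'I_n -> 'I_n.+1} => partition_type tau)) /=; last first.
  move=> Q partQ; rewrite /partition_type.
  have -> : (\sum_(j < n) j.+1 * block_type Q j = #|[set: 'I_n]%SET|)%N.
    rewrite (card_partition partQ) (sum_block_size id partQ).
    by apply: eq_bigr => j _; rewrite block_typeE.
  by rewrite cardsT card_ord.
apply: eq_bigr => tau _.
rewrite (eq_bigr (fun=> inj_sum (ell tau))); last first.
  move=> Q /andP[partQ /eqP <-]; congr inj_sum.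
  rewrite -sum1_card (sum_block_size (fun=> 1%N) partQ) /ell.
  by apply: eq_bigr => j _; rewrite mul1n block_typeE.
rewrite sumr_const mulr_natl; congr (_ *+ _); apply: eq_card => Q.
rewrite unfold_in !inE; case partQ: (finset.partition Q [set: 'I_n]%SET) => //=.
apply/eqP/forallP => [<- j|h]; first by rewrite block_typeE.
by apply/ffunP => j; apply: ord_inj; rewrite block_typeE//; apply/eqP.
Qed.

End MomentCombinatorics.
(** * Truncation of moments *)

Lemma expnD_le (a b n : nat) : ((a + b) ^ n <= 2 ^ n * (a ^ n + b ^ n))%N.
Proof.
wlog ab : a b / (a <= b)%N.
  by move=> h; have [/h//|/ltnW/h] := leqP a b; rewrite addnC [(b ^ n + _)%N]addnC.
apply: (@leq_trans ((2 * b) ^ n)%N); first by case: (n) => // m; rewrite leq_exp2r//; lia.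
by rewrite expnMn leq_mul2l leq_addl orbT.
Qed.

Lemma count_le_size (T : eqType) (p : pred T) (r s : seq T) : uniq r ->
  (forall x, x \in r -> p x -> x \in s) -> (count p r <= size s)%N.
Proof.
move=> ur h; rewrite -size_filter; apply: uniq_leq_size; first exact: filter_uniq.
by move=> x; rewrite mem_filter => /andP[px xr]; exact: h.
Qed.

Section AbstractMoment.
Variables (R : realType) (T : choiceType) (B : nat -> finType).
Variable loc : forall H, B H -> option T -> Prop.
Variable vol : nat -> R.
Hypothesis vol_gt0 : forall H, (0 < H)%N -> 0 < vol H.
Variable nm : nat -> {fset T}.
Hypothesis nm_incr : forall M N, (M <= N)%N -> {subset nm M <= nm N}.
Hypothesis nm_cover : forall P, exists M, P \in nm M.
Variable sl : option T -> R.
Variable n : nat.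
Hypothesis n_gt0 : (0 < n)%N.

Definition good H (f : B H) : bool := `[< finite_set [set eta | loc f eta] >].

Hypothesis dens : forall s, uniq s ->
  (#|[set f : B H | `[< forall eta, eta \in s -> loc f eta >]]%SET|%:R / vol H)
    @[H --> \oo] --> (\prod_(eta <- s) sl eta : R).

Hypothesis tail : forall e : R, 0 < e -> exists M0, forall M, (M0 <= M)%N ->
  exists H0, forall H, (H0 <= H)%N ->
  #|[set f : B H | `[< exists2 P, P \notin nm M & loc f (Some P) >]]%SET|%:R <= e * vol H.

Variables (c0 : nat) (ab : nat -> set T).
Hypothesis large : forall H (f : B H), (0 < H)%N -> good f ->
  (set_card [set P | ab H P /\ loc f (Some P)] <= c0)%N.

Variable v : T -> R.
Hypothesis small : forall H (g : 'I_n -> T), (0 < H)%N -> (forall j, ~ ab H (g j)) ->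
  #|[set f : B H | good f && `[< forall j, loc f (Some (g j)) >]]%SET|%:R
    <= vol H * \prod_(j < n) v (g j).
Hypothesis v_summable : summable [set: T] (EFin \o v).

(** The symbol oo belongs to every truncation, so that the error concerns primes only. *)
Definition NM M : {fset option T} := (None |` [fset Some P | P in nm M])%fset.

Lemma NM_Some M P : (Some P \in NM M) = (P \in nm M).
Proof.
rewrite !inE /=; apply/imfsetP/idP => [[Q /= hQ [->]]//|hP]; by exists P.
Qed.

Lemma NM_None M : None \in NM M.
Proof. by rewrite !inE. Qed.

Lemma NM_incr M N : (M <= N)%N -> {subset NM M <= NM N}.
Proof. by move=> MN [P|_]; rewrite ?NM_None// !NM_Some; exact: nm_incr. Qed.

Lemma NM_cover (A : set (option T)) : finite_set A ->
  exists M, forall eta, A eta -> eta \in NM M.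
Proof.
move=> /finite_fsetP[F ->].
have [h hh] : {h : option T -> nat & forall eta, eta \in NM (h eta)}.
  apply: (@choice _ _ (fun eta M => eta \in NM M)) => -[P|]; last by exists 0%N; exact: NM_None.
  by have [M hM] := nm_cover P; exists M; rewrite NM_Some.
exists (\max_(eta <- F) h eta)%N => eta /= hF.
by apply: NM_incr (hh eta); exact: leq_bigmax_seq.
Qed.

Definition trunc_count M H (f : B H) : nat :=
  (\sum_(i : NM M) (`[< loc f (val i) >] : nat))%N.

Lemma expn_sum_indic (I : finType) (b : I -> bool) :
  ((\sum_i (b i : nat)) ^ n = \sum_(g : {ffun 'I_n -> I}) ([forall j, b (g j)] : nat))%N.
Proof.
rewrite -[n in LHS]card_ord -prod_nat_const bigA_distr_bigA/=.
apply: eq_bigr => g _; case: forallP => [h|h]; first by rewrite big1// => j _; rewrite h.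
have [j hj] : exists j, ~~ b (g j).
  by apply/existsP; rewrite -negb_forall; apply/negP => /forallP.
by rewrite (bigD1 j)//= (negPf hj) mul0n.
Qed.

Definition mu_trunc M : R :=
  \sum_(tau : {ffun 'I_n -> 'I_n.+1} | partition_type tau)
    (num_partitions tau)%:R * inj_sum (fun i : NM M => sl (val i)) (ell tau).

(** All points of the box are summed here, also those that are not [good], since [dens] counts them
    too. *)
Lemma cvg_trunc M :
  ((\sum_(f : B H) (trunc_count M f ^ n)%N%:R) / vol H) @[H --> \oo] --> mu_trunc M.
Proof.
rewrite /mu_trunc -sum_image_partition_types.
pose s (g : {ffun 'I_n -> NM M}) := [seq val i | i <- enum (g @: [set: 'I_n]%SET)].
have us g : uniq (s g) by rewrite map_inj_uniq ?enum_uniq//; exact: val_inj.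
have h : (\sum_(g : {ffun 'I_n -> NM M})
    (#|[set f : B H | `[< forall eta, eta \in s g -> loc f eta >]]%SET|%:R / vol H))
    @[H --> \oo] --> (\sum_(g : {ffun 'I_n -> NM M}) \prod_(i in g @: [set: 'I_n]%SET) sl (val i) : R).
  apply: cvg_sumn => g _; have := dens (us g).
  by rewrite {2}/s big_map big_enum.
apply: (@eq_cvgn _ _ _ _ _ h) => H.
rewrite -mulr_suml -!natr_sum; congr (_%:R / _).
rewrite (eq_bigr (fun f => \sum_(g : {ffun 'I_n -> NM M})
  ([forall j, `[< loc f (val (g j)) >]] : nat))%N); last first.
  by move=> f _; exact: expn_sum_indic.
rewrite exchange_big/=; apply: eq_bigr => g _.
rewrite -sum1dep_card [RHS]big_mkcond; apply: eq_bigr => f _.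
congr (nat_of_bool _); rewrite [RHS]/=.
apply/forallP/asboolP => [h1 eta /mapP[i + ->]|h1 j].
  by rewrite mem_enum => /imsetP[j _ ->]; exact/asboolP/(h1 j).
by apply/asboolP/h1/map_f; rewrite mem_enum; apply: imset_f.
Qed.

(** A finite set A whose sum of |v P| is within e of the total is absorbed into [nm M0]; whatever is
    disjoint from it contributes at most e. Absolute values are taken because the v P may have
    either sign. *)
Lemma v_tail (e : R) : 0 < e -> exists M0, forall G : {fset T},
  (forall P, P \in G -> P \notin nm M0) -> \sum_(P : G) `|v (val P)| <= e.
Proof.
move=> e0; have fin : (\esum_(P in [set: T]) `|(EFin \o v) P|)%E \is a fin_num.
  by rewrite -summableE.
have [_ [A [Afin _] <-] hA] := ub_ereal_sup_adherent e0 fin.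
have [M0 hM0] := NM_cover (finite_image Some Afin).
exists M0 => G hG.
have /finite_fsetP[F AF] := Afin.
have uGF : uniq (enum_fset G ++ enum_fset F).
  rewrite cat_uniq !fset_uniq andbT/=; apply/hasPn => P PF; apply/negP => PG.
  by have := hG P PG; rewrite -NM_Some hM0//; exists P => //; rewrite AF.
have sumE (r : seq T) : uniq r ->
    (\sum_(P \in [set` r]) `|(EFin \o v) P|)%E = (\sum_(P <- r) `|v P|)%:E.
  by move=> ur; rewrite -fsbig_seq// -sumEFin.
have le : ((\sum_(P <- enum_fset G ++ enum_fset F) `|v P|)%:E <=
    \esum_(P in [set: T]) `|(EFin \o v) P|)%E.
  rewrite -sumE//; apply: ereal_sup_ubound.
  by exists [set` (enum_fset G ++ enum_fset F)] => //; split=> //; exact: finite_seq.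
have {}hA : (\esum_(P in [set: T]) `|(EFin \o v) P| - e%:E < \sum_(P \in A) `|(EFin \o v) P|)%E.
  exact: hA.
move: hA le; rewrite AF sumE ?fset_uniq// -(fineK fin) -EFinB lte_fin lee_fin.
rewrite big_cat/= -(big_seq_fsetE _ _ xpredT (fun P => `|v P|))/=.
by move: (\sum_(_ <- F) _) (\sum_(_ <- G) _) => y z h1 h2; lra.
Qed.

(** Expanding the power gives a sum over all tuples; [small] admits tuples with repetitions, so it
    applies to each term without regrouping. *)
Lemma sum_pow_small H (G : {fset T}) : (0 < H)%N -> (forall P, P \in G -> ~ ab H P) ->
  (\sum_(f : B H | good f) ((\sum_(P : G) (`[< loc f (Some (val P)) >] : nat)) ^ n)%N)%:R
    <= vol H * (\sum_(P : G) `|v (val P)|) ^+ n.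
Proof.
move=> H0 hG.
rewrite (eq_bigr (fun f => \sum_(g : {ffun 'I_n -> G})
  ([forall j, `[< loc f (Some (val (g j))) >]] : nat))%N); last first.
  by move=> f _; exact: expn_sum_indic.
rewrite exchange_big/= natr_sum.
have -> : (\sum_(P : G) `|v (val P)|) ^+ n = \sum_(g : {ffun 'I_n -> G}) \prod_(j < n) `|v (val (g j))|.
  by rewrite -[n in LHS]card_ord -prodr_const bigA_distr_bigA.
rewrite mulr_sumr; apply: ler_sum => g _.
apply: (@le_trans _ _ (vol H * \prod_(j < n) v (val (g j)))); last first.
  rewrite ler_pM2l ?vol_gt0//; apply: le_trans (ler_norm _) _.
  by rewrite normr_prod.
apply: le_trans (small (g := fun j => val (g j)) H0 _); last by move=> j; exact/hG/valP.
rewrite ler_nat -sum1dep_card big_mkcond [leqRHS]big_mkcond/=.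
apply: leq_sum => f _; case: (good f) => //=.
case: forallP => // h; case: asboolP => // nh; case: nh => j; exact/asboolP/h.
Qed.

(* Outside I, the number of conditions met is at most [c0] from the primes above
   the threshold, plus a constant from those in [nm L], plus the count over the
   remaining finite set [G]. *)
Lemma card_loc_bound L H : (0 < H)%N -> exists G : {fset T},
  (forall P, P \in G -> ~ ab H P /\ P \notin nm L) /\
  forall f : B H, good f -> (set_card [set eta | loc f eta] <=
    c0 + #|` NM L| + \sum_(P : G) (`[< loc f (Some (val P)) >] : nat))%N.
Proof.
move=> H0.
(* Only primes met by some good point of the box are kept: the box is finite and a good point meets
   finitely many, so [S] is finite. *)
pose S := [set P | (~ ab H P /\ P \notin nm L) /\ exists2 f : B H, good f & loc f (Some P)].
have Sfin : finite_set S.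
  apply: (@sub_finite_set _ _ (\bigcup_(f in [set f : B H | good f]) [set P | loc f (Some P)])).
    by move=> P [_ [f gf hf]]; exists f.
  apply: bigcup_finite; first exact: finite_finset.
  move=> f /asboolP fin; apply: (@finite_preimage _ _ [set eta | loc f eta] Some) => // x y _ _ [].
exists (fset_set S); split.
  by move=> P; rewrite in_fset_set// inE => -[].
move=> f gf; have fin : finite_set [set eta | loc f eta] by exact/asboolP.
have finA : finite_set [set P | ab H P /\ loc f (Some P)].
  apply: (@sub_finite_set _ _ (Some @^-1` [set eta | loc f eta])); first by move=> P [].
  by apply: finite_preimage => // x y _ _ [].
rewrite /set_card; set r := enum_fset (fset_set [set eta | loc f eta]).
have ur : uniq r by exact: fset_uniq.
have memr eta : eta \in r -> loc f eta by rewrite /r in_fset_set// inE.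
pose p1 (eta : option T) := if eta is Some P then `[< ab H P >] else false.
pose p2 eta := eta \in NM L.
pose p3 (eta : option T) := if eta is Some P then P \in fset_set S else false.
have cover : {in r, forall eta, [|| p1 eta, p2 eta | p3 eta]}.
  move=> [P|] hr; last by rewrite /p2 NM_None orbT.
  rewrite /p1 /p2 /p3 NM_Some; case: asboolP => //= nab; case: (boolP (P \in nm L)) => //= nL.
  by rewrite in_fset_set// inE; split=> //; exists f => //; exact: memr hr.
apply: (@leq_trans (count p1 r + (count p2 r + count p3 r))%N).
  rewrite -(count_predT r) (eq_in_count (a2 := predU p1 (predU p2 p3))); last first.
    by move=> eta hr; rewrite /= cover.
  apply: (@leq_trans (count p1 r + count (predU p2 p3) r)%N).
    by rewrite -count_predUI leq_addr.
  by rewrite leq_add2l -count_predUI leq_addr.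
rewrite -addnA; apply: leq_add; last apply: leq_add.
- apply: leq_trans (large H0 gf); rewrite /set_card.
  rewrite -(size_map Some); apply: count_le_size => // -[P|] hr //= /asboolP hab.
  by apply: map_f; rewrite in_fset_set// inE; split=> //; exact: memr hr.
- by apply: count_le_size.
- have -> : (\sum_(P : fset_set S) (`[< loc f (Some (val P)) >] : nat))%N =
      count (fun P => `[< loc f (Some P) >]) (fset_set S).
    rewrite -(big_seq_fsetE _ _ xpredT (fun P => `[< loc f (Some P) >] : nat)).
    by rewrite -sum1_count [RHS]big_mkcond; apply: eq_bigr => P _; case: `[< _ >].
  rewrite -[leqRHS]size_filter -[leqRHS](size_map Some); apply: count_le_size => // -[P|] hr //= hS.
  by apply: map_f; rewrite mem_filter hS andbT; apply/asboolP; exact: memr hr.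
Qed.

Lemma trunc_count_le M H (f : B H) : good f ->
  (trunc_count M f <= set_card [set eta | loc f eta])%N.
Proof.
move=> /asboolP fin; rewrite /trunc_count -(big_seq_fsetE _ _ xpredT (fun eta => `[< loc f eta >] : nat)).
rewrite (_ : (\sum_(_ <- _) _)%N = count (fun eta => `[< loc f eta >]) (NM M)); last first.
  by rewrite -sum1_count [RHS]big_mkcond; apply: eq_bigr => P _; case: `[< _ >].
apply: count_le_size; first exact: fset_uniq.
by move=> eta _ /asboolP h; rewrite in_fset_set// inE.
Qed.

Lemma trunc_count_eq M H (f : B H) : good f ->
  ~ (exists2 P, P \notin nm M & loc f (Some P)) ->
  trunc_count M f = set_card [set eta | loc f eta].
Proof.
move=> gf no; apply/eqP; rewrite eqn_leq trunc_count_le//=.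
have fin : finite_set [set eta | loc f eta] by exact/asboolP.
rewrite /trunc_count -(big_seq_fsetE _ _ xpredT (fun eta => `[< loc f eta >] : nat)).
rewrite (_ : (\sum_(_ <- _) _)%N = count (fun eta => `[< loc f eta >]) (NM M)); last first.
  by rewrite -sum1_count [RHS]big_mkcond; apply: eq_bigr => P _; case: `[< _ >].
rewrite -size_filter; apply: uniq_leq_size; first exact: fset_uniq.
move=> eta; rewrite in_fset_set// inE => h; rewrite mem_filter; apply/andP; split.
  exact/asboolP.
case: eta h => [P|] h; last exact: NM_None.
by rewrite NM_Some; apply: contrapT => /negP nP; apply: no; exists P.
Qed.

Lemma trunc_count_card M H (f : B H) : (trunc_count M f <= #|` NM M|)%N.
Proof.
rewrite /trunc_count cardfE -sum1_card; apply: leq_sum => i _; exact: leq_b1.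
Qed.

Definition loc_moment H : R :=
  (\sum_(f : B H | good f) ((set_card [set eta | loc f eta]) ^ n)%N%:R) / vol H.

Definition trunc_moment M H : R :=
  (\sum_(f : B H) (trunc_count M f ^ n)%N%:R) / vol H.

Definition tail_set M H : {set B H} :=
  [set f : B H | `[< exists2 P, P \notin nm M & loc f (Some P) >]]%SET.

(** A pointwise estimate: off the tail set of M the truncated count is exact; on it [expnD_le]
    separates the constant from the sum over G, at the cost of 2^n. *)
Lemma sum_good_le L M H (G : {fset T}) :
  (forall f : B H, good f -> (set_card [set eta | loc f eta] <=
    c0 + #|` NM L| + \sum_(P : G) (`[< loc f (Some (val P)) >] : nat))%N) ->
  (\sum_(f : B H | good f) (set_card [set eta | loc f eta]) ^ n <=
   \sum_(f : B H) trunc_count M f ^ n +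
   2 ^ n * ((c0 + #|` NM L|) ^ n * #|tail_set M H| +
     \sum_(f : B H | good f) (\sum_(P : G) (`[< loc f (Some (val P)) >] : nat)) ^ n))%N.
Proof.
move=> hG; set CL := (c0 + #|` NM L|)%N in hG *.
have -> : (CL ^ n * #|tail_set M H| = \sum_(f : B H) CL ^ n * (f \in tail_set M H))%N.
  by rewrite -big_distrr/= -sum1_card [in LHS]big_mkcond; congr (_ * _)%N;
    apply: eq_bigr => f _; case: (f \in _).
rewrite big_mkcond [X in (_ <= _ + _ * (_ + X))%N]big_mkcond/= -big_split/= big_distrr/= -big_split/=.
apply: leq_sum => f _; case: ifPn => // gf.
have [fT|nT] := boolP (f \in tail_set M H).
  apply: leq_trans (leq_addl _ _); rewrite muln1.
  by apply: leq_trans (expnD_le _ _ _); rewrite leq_exp2r// hG.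
apply: leq_trans (leq_addr _ _); rewrite (trunc_count_eq (M := M))//.
by move=> h; move/negP: nT; apply; rewrite inE; exact/asboolP.
Qed.

(** At a good point the truncated count is at most the full one. A point that is not good meets
    infinitely many places, hence some prime outside [nm M'] for any M', while its truncated count
    is at most the size of [NM M]. *)
Lemma sum_trunc_le M M' H :
  (\sum_(f : B H) trunc_count M f ^ n <=
   \sum_(f : B H | good f) (set_card [set eta | loc f eta]) ^ n +
   #|` NM M| ^ n * #|tail_set M' H|)%N.
Proof.
have -> : (#|` NM M| ^ n * #|tail_set M' H| =
    \sum_(f : B H) #|` NM M| ^ n * (f \in tail_set M' H))%N.
  by rewrite -big_distrr/= -sum1_card [in LHS]big_mkcond; congr (_ * _)%N;
    apply: eq_bigr => f _; case: (f \in _).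
rewrite [X in (_ <= X + _)%N]big_mkcond -big_split/=; apply: leq_sum => f _.
case: ifPn => [gf|bf].
  by apply: leq_trans (leq_addr _ _); rewrite leq_exp2r// trunc_count_le.
rewrite add0n (_ : f \in _ = true); first by rewrite muln1 leq_exp2r// trunc_count_card.
rewrite inE; apply/asboolP; apply: contrapT => no; move/negP: bf; apply; apply/asboolP.
apply: (@sub_finite_set _ _ [set` NM M']); last exact: finite_fset.
move=> [P|] /= h; last exact: NM_None.
by rewrite NM_Some; apply: contrapT => /negP nP; apply: no; exists P.
Qed.

(* [L] is chosen first so that the n-th power of the tail of the sum of the
   [|v P|] beyond [L] is small; the remaining error is a constant depending on
   [L] only times the density of the tail set of [M]. *)
Lemma loc_moment_trunc (e : R) : 0 < e -> exists M0, forall M, (M0 <= M)%N ->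
  exists H0, forall H, (H0 <= H)%N -> `|loc_moment H - trunc_moment M H| <= e.
Proof.
move=> e0; pose q : R := 2 ^+ n; have q0 : 0 < q by exact: exprn_gt0.
(* The bound 1 gives eL^n <= eL, the other one makes 2^n eL at most e / 2. *)
pose eL := Num.min 1 (e / (2 * q)).
have eL0 : 0 < eL by rewrite lt_min ltr01 divr_gt0// mulr_gt0.
have [L hL] := v_tail eL0.
pose CL : R := ((c0 + #|` NM L|) ^ n)%N%:R.
have CL0 : 0 <= CL by exact: ler0n.
(* The summand 1 keeps the denominator positive when [CL] is 0. *)
have d0 : 0 < e / (2 * (q * CL + 1)).
  by rewrite divr_gt0// mulr_gt0// ltr_wpDl// mulr_ge0// ltW.
have [M0 hM0] := tail d0.
exists M0 => M /hM0[H1 hH1].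
pose NMn : R := (#|` NM M| ^ n)%N%:R.
have NM0 : 0 <= NMn by exact: ler0n.
have d1 : 0 < e / (NMn + 1) by rewrite divr_gt0// ltr_wpDl.
(* A second tail level, chosen after M because it has to beat the constant [NMn], which depends on
   M. *)
have [M' /(_ M' (leqnn _))[H2 hH2]] := tail d1.
exists (maxn 1 (maxn H1 H2)) => H; rewrite !geq_max => /and3P[H0 /hH1 t1 /hH2 t2].
have V0 := vol_gt0 H0.
have [G [hG hb]] := card_loc_bound L H0.
have up := sum_good_le M hb; have dn := sum_trunc_le M M' H.
have sm := sum_pow_small H0 (fun P PG => (hG P PG).1).
have vG : \sum_(P : G) `|v (val P)| <= eL by apply: hL => P /hG[].
move: up dn sm; rewrite -!(ler_nat R) !natrD !natrM !natrD !natrM natrX !natr_sum -/CL -/q -/NMn.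
rewrite -/(tail_set M H) in t1; rewrite -/(tail_set M' H) in t2.
rewrite /loc_moment /trunc_moment -mulrBl normrM (@gtr0_norm _ (vol H)^-1) ?invr_gt0// ler_pdivrMr//.
set A := \sum_(f | good f) (_ ^ n)%N%:R.
set Bt := \sum_f _; set b := \sum_(f | good f) _.
move=> up dn sm; rewrite ler_norml.
have t1' : q * (CL * #|tail_set M H|%:R) <= e / 2 * vol H.
  have aux (x : R) : 0 <= x -> x * (e / (2 * (x + 1))) <= e / 2.
    move=> x0; have x1 : 0 < x + 1 by rewrite ltr_wpDl.
    rewrite invfM [e * _]mulrA mulrCA -[leRHS]mulr1 ler_pM2l ?divr_gt0//.
    by rewrite ler_pdivrMr// mul1r lerDl.
  apply: (@le_trans _ _ (q * CL * (e / (2 * (q * CL + 1))) * vol H)).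
    by rewrite mulrA -[leRHS]mulrA ler_wpM2l// mulr_ge0// ltW.
  by rewrite ler_pM2r// aux// mulr_ge0// ltW.
have t2' : NMn * #|tail_set M' H|%:R <= e * vol H.
  apply: (@le_trans _ _ (NMn * (e / (NMn + 1) * vol H))); first by rewrite ler_wpM2l.
  rewrite mulrA ler_pM2r// mulrA ler_pdivrMr ?ltr_wpDl//.
  by rewrite mulrC ler_pM2l// lerDl.
have b' : q * b <= e / 2 * vol H.
  apply: (@le_trans _ _ (q * (vol H * eL))).
    rewrite ler_pM2l//; apply: le_trans sm _; rewrite ler_pM2l//.
    have s0 : 0 <= \sum_(P : G) `|v (val P)| by apply: sumr_ge0.
    apply: (@le_trans _ _ (eL ^+ n)); first by rewrite lerXn2r// nnegrE ltW.
    rewrite -[leRHS]expr1; apply: ler_wiXn2l; rewrite ?(ltW eL0)// /eL ge_min lexx//.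
  rewrite mulrCA mulrC ler_pM2r//.
  apply: (@le_trans _ _ (q * (e / (2 * q)))); first by rewrite ler_pM2l// /eL ge_min lexx orbT.
  have aux (x : R) : 0 < x -> x * (e / (2 * x)) = e / 2.
    by move=> x0; rewrite mulrCA invfM (mulrCA x) mulfV ?gt_eqF// mulr1.
  by rewrite aux.
by apply/andP; split; lra.
Qed.

(** No candidate for the limit is known beforehand. One estimate, valid for all M beyond M0 and all
    large H, gives both the Cauchy property in H and the convergence of the truncated values in
    M. *)
Lemma cvg_loc_moment : exists mu : R, loc_moment @ \oo --> mu /\ mu_trunc @ \oo --> mu.
Proof.
have key (e : R) : 0 < e -> exists M0, forall M, (M0 <= M)%N ->
    exists H0, forall H, (H0 <= H)%N -> `|loc_moment H - mu_trunc M| < e.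
  move=> e0; have e2 : 0 < e / 2 by rewrite divr_gt0.
  have [M0 hM0] := loc_moment_trunc e2; exists M0 => M /hM0[H1 hH1].
  have /cvgrPdist_lt/(_ _ e2)[H2 _ hH2] := @cvg_trunc M.
  exists (maxn H1 H2) => H; rewrite geq_max => /andP[/hH1 h1 /hH2 h2].
  rewrite -(subrKA (trunc_moment M H)) (le_lt_trans (ler_normD _ _))//.
  rewrite (splitr e) ler_ltD// distrC; exact: h2.
have cv : cvg (loc_moment @ \oo).
  apply/cauchy_cvgP/cauchy_exP => e e0.
  have [M0 /(_ M0 (leqnn _))[H0 hH0]] := key e e0.
  exists (mu_trunc M0); exists H0 => // H /= hH; rewrite /ball/= distrC; exact: hH0.
exists (lim (loc_moment @ \oo)); split=> //.
apply/cvgrPdist_lt => e e0; have e2 : 0 < e / 2 by rewrite divr_gt0.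
have [M0 hM0] := key _ e2; exists M0 => // M /= /hM0[H1 hH1].
have /cvgrPdist_lt/(_ _ e2)[H2 _ hH2] := cv.
have h1 := hH1 _ (leq_maxl H1 H2); have h2 := hH2 _ (leq_maxr H1 H2).
rewrite -(subrKA (loc_moment (maxn H1 H2))) (le_lt_trans (ler_normD _ _))//.
by rewrite (splitr e) ltrD.
Qed.

Hypothesis sl_ge0 : forall eta, 0 <= sl eta.

Definition distinct_tuples l : set (l.-tuple (option T)) :=
  [set e | forall i j : 'I_l, (i < j)%N -> tnth e i <> tnth e j].

(** Injective maps into [NM M] are the tuples of distinct entries from [NM M]. These finite sets
    increase with M and eventually contain any finite set of such tuples, so for non-negative terms
    the supremum defining the sum is the limit along them. *)
Lemma cvg_inj_sum l :
  ((inj_sum (fun i : NM M => sl (val i)) l)%:E) @[M --> \oo] -->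
  (\esum_(e in @distinct_tuples l) (\prod_(m < l) sl (tnth e m))%:E)%E.
Proof.
pose a (e : l.-tuple (option T)) : \bar R := (\prod_(m < l) sl (tnth e m))%:E.
have a0 e : (0 <= a e)%E by rewrite lee_fin prodr_ge0.
pose tup M (e : {ffun 'I_l -> NM M}) : l.-tuple (option T) := [tuple val (e m) | m < l].
have tup_inj M : injective (@tup M).
  move=> e e' h; apply/ffunP => m; apply: val_inj.
  by have := congr1 (fun t => tnth t m) h; rewrite !tnth_mktuple.
pose r M := [seq tup M e | e <- enum [pred e : {ffun 'I_l -> NM M} | injectiveb e]].
have ur M : uniq (r M) by rewrite map_inj_uniq ?enum_uniq//; exact: tup_inj.
have rP M (e : l.-tuple (option T)) :
    e \in r M <-> distinct_tuples e /\ forall m, tnth e m \in NM M.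
  split=> [/mapP[g + ->]|[de eM]].
    rewrite mem_enum inE => /injectiveP ginj; split=> [i j ij|m]; last by rewrite tnth_mktuple; exact: fsvalP.
    by rewrite !tnth_mktuple => /val_inj/ginj eij; rewrite eij ltnn in ij.
  apply/mapP; exists [ffun m => FSetSub (eM m)].
    rewrite mem_enum inE; apply/injectiveP => i j; rewrite !ffunE => /(congr1 val)/= eij.
    apply/eqP; apply: contrapT => /negP; rewrite neq_ltn => /orP[] /de; apply; by rewrite eij.
  by apply: eq_from_tnth => m; rewrite tnth_mktuple ffunE.
have rE M : (inj_sum (fun i : NM M => sl (val i)) l)%:E = (\sum_(e \in [set` r M]) a e)%E.
  rewrite -fsbig_seq// big_map big_enum/= /inj_sum -sumEFin; apply: eq_bigr => e _.
  by congr (_%:E); apply: eq_bigr => m _; rewrite tnth_mktuple.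
have -> : (fun M => (inj_sum (fun i : NM M => sl (val i)) l)%:E) =
    (fun M => \sum_(e \in [set` r M]) a e)%E by apply/funext => M; exact: rE.
have mono M N : (M <= N)%N ->
    (\sum_(e \in [set` r M]) a e <= \sum_(e \in [set` r N]) a e)%E.
  move=> MN; apply: lee_fsum_nneg_subset => //; try exact: finite_seq.
  move=> e; rewrite !inE /= => /rP[de eM]; apply/rP; split=> // m.
  exact: NM_incr (eM m).
have -> : (\esum_(e in @distinct_tuples l) (\prod_(m < l) sl (tnth e m))%:E)%E =
    ereal_sup (range (fun M => \sum_(e \in [set` r M]) a e)%E).
  apply/eqP; rewrite eq_le; apply/andP; split.
    apply: ge_ereal_sup => _ [A [Afin AS] <-].
    have [M hM] := NM_cover (bigcup_finite Afin (fun e _ => finite_image (tnth e) (@finite_finset _ setT))).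
    apply: (@le_trans _ _ (\sum_(e \in [set` r M]) a e)%E); last first.
      by apply: ereal_sup_ubound; exists M.
    apply: lee_fsum_nneg_subset => [//||e|e _]; [exact: finite_seq| |exact: a0].
    rewrite !inE => eA; apply/rP; split; first exact: AS.
    by move=> m; apply: hM; exists e => //; exists m.
  apply: ge_ereal_sup => _ [M _ <-]; apply: ereal_sup_ubound.
  exists [set` r M] => //; split; first exact: finite_seq.
  by move=> e /= /rP[].
exact: ereal_nondecreasing_cvgn.
Qed.

(** The truncated values have a real limit, and a limit in the extended reals by monotonicity;
    uniqueness of limits identifies the two, which also shows that the formula is finite. *)
Theorem moment_formula : exists mu : R, loc_moment @ \oo --> mu /\
  mu%:E = (\sum_(tau : {ffun 'I_n -> 'I_n.+1} | partition_type tau)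
      (num_partitions tau)%:R%:E *
      \esum_(e in @distinct_tuples (ell tau)) (\prod_(m < ell tau) sl (tnth e m))%:E)%E.
Proof.
have [mu [h1 h2]] := cvg_loc_moment; exists mu; split=> //.
have h3 : (mu_trunc M)%:E @[M --> \oo] --> mu%:E by apply: cvg_EFin => //; exact: nearW.
have h4 : (mu_trunc M)%:E @[M --> \oo] -->
    (\sum_(tau : {ffun 'I_n -> 'I_n.+1} | partition_type tau)
      (num_partitions tau)%:R%:E *
      \esum_(e in @distinct_tuples (ell tau)) (\prod_(m < ell tau) sl (tnth e m))%:E)%E.
  have -> : (fun M => (mu_trunc M)%:E) = (fun M =>
      \sum_(tau : {ffun 'I_n -> 'I_n.+1} | partition_type tau) (num_partitions tau)%:R%:E *
       (inj_sum (fun i : NM M => sl (val i)) (ell tau))%:E)%E.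
    by apply/funext => M; rewrite /mu_trunc -sumEFin.
  apply: cvg_nnesum => tau _.
    apply: nearW => M; rewrite -EFinM lee_fin mulr_ge0// sumr_ge0// => e _.
    by apply: prodr_ge0.
  by apply: cvgeZl => //; exact: cvg_inj_sum.
by rewrite -(cvg_lim _ h3)// -(cvg_lim _ h4).
Qed.

End AbstractMoment.

(** * Application to the lattice points of a number field *)

Lemma set_card_seq (T : choiceType) (r : seq T) : uniq r -> set_card [set` r] = size r.
Proof.
move=> ur; rewrite /set_card; apply/eqP; rewrite eqn_leq; apply/andP; split; apply: uniq_leq_size => // x;
  by rewrite in_fset_set ?inE//; exact: finite_seq.
Qed.

Section BoxPoints.
Variables (R : realType) (d : nat) (K : fieldExtType rat).
Local Notation k := (\dim {:K}).
Variable E : 'I_k -> ringInt K.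
Hypothesis hE : integral_basis E.

Lemma box_point_inj H : injective (@box_point d K E H).
Proof.
move=> f g fg; apply/ffunP => -[i j]; apply: ord_inj; apply/eqP.
have := congr1 (fun A : 'rV_d => coord_int E (A 0 i) 0 j) fg.
by rewrite !mxE !of_coordK// !mxE => /addIr[->].
Qed.

Lemma boxE H (A : 'rV[ringInt K]_d) : box E H A <-> exists f, @box_point d K E H f = A.
Proof.
split=> [|[f <-] i]; last first.
  exists (fun j => (f (i, j))%:Z - H%:Z); split=> [j|]; last first.
    by rewrite mxE; apply: eq_bigr => j _; rewrite mxE.
  by have := ltn_ord (f (i, j)); move: (f (i, j) : nat) => x; lia.
move=> /choice[a ha].
have hlt p : (absz (a p.1 p.2 + H%:Z)%R < H.*2)%N by have := (ha p.1).1 p.2; lia.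
exists [ffun p => Ordinal (hlt p)]; apply/rowP => i; rewrite mxE (ha i).2.
apply: eq_bigr => j _; rewrite mxE ffunE/= gez0_abs ?addrK//.
by have := (ha i).1 j; lia.
Qed.

Lemma set_box_seq H (S : set 'rV[ringInt K]_d) :
  S `&` box E H = [set` [seq @box_point d K E H f | f <- enum [set f | `[< S (box_point E f) >]]%SET]].
Proof.
apply/seteqP; split=> A /=.
  by move=> [SA /boxE[f fA]]; apply/mapP; exists f => //; rewrite mem_enum inE; apply/asboolP; rewrite fA.
move=> /mapP[f + ->]; rewrite mem_enum inE => /asboolP hS; split=> //.
by apply/boxE; exists f.
Qed.

Lemma set_card_box H (S : set 'rV[ringInt K]_d) :
  set_card (S `&` box E H) = #|[set f : box_index d K H | `[< S (box_point E f) >]]%SET|.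
Proof.
rewrite set_box_seq set_card_seq ?size_map -?cardE//.
by rewrite map_inj_uniq ?enum_uniq//; exact: box_point_inj.
Qed.

Lemma limn_esup_lt (u : nat -> \bar R) (e : \bar R) : (limn_esup u < e)%E ->
  exists N, forall m, (N <= m)%N -> (u m < e)%E.
Proof.
rewrite /limn_esup /limf_esup => /ereal_inf_lt[_ [V [N _ NV] <-] hV].
exists N => m Nm; apply: le_lt_trans hV; apply: ereal_sup_ubound.
by exists m => //; exact: NV.
Qed.

End BoxPoints.

Theorem theorem11 (R : realType) (d n : nat) (hd : (0 < d)%N) (hn : (0 < n)%N)
  (K : fieldExtType rat)
  (E : 'I_(\dim {:K}) -> ringInt K) (hE : integral_basis E)
  (C : forall P : nzprime K, padic_completion R P)
  (nu : forall P : nzprime K, probability (borel 'rV[pcInt (C P)]_d) R)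
  (hnu : forall P : nzprime K,
    translation_invariant (@borel_sets 'rV[pcInt (C P)]_d) (nu P))
  (mu_inf : {measure set (borel (kinfd R d K)) -> \bar R})
  (hmu_inf : is_lebesgue mu_inf)
  (nu_inf : {measure set (borel (kinfd R d K)) -> \bar R})
  (hnu_inf : is_haar_covol1 E nu_inf)
  (U : forall P : nzprime K, set 'rV[pcInt (C P)]_d)
  (hU : forall P : nzprime K, nu P (boundary (U P)) = 0%E)
  (Uinf : set (kinfd R d K))
  (hUinf : mu_inf (boundary Uinf) = 0%E)
  (hcone : [set r *: x | r in [set r : R | 0 <= r] & x in Uinf] = Uinf)
  (htail : (fun M : R => upper_density R E
      (\bigcup_(p in [set p : nat | prime p /\ M < p%:R])
         \bigcup_(P in [set P : nzprime K | lies_over P p])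
           [set A | in_local E U Uinf A (Some P)])) @ +oo --> 0%E)
  (alpha : \bar R) (halpha : (0 <= alpha)%E) (c' c : int)
  (hlarge : forall (H : nat) (A : 'rV[ringInt K]_d), (1 <= H)%N ->
    box_I E U Uinf H A ->
    let S := [set P : nzprime K | above P (threshold c' H alpha) /\
                                  in_local E U Uinf A (Some P)] in
    finite_set S /\ (set_card S)%:Z < c)
  (v : nzprime K -> R)
  (hsmall : forall (H : nat) (P : 'I_n -> nzprime K), (1 <= H)%N ->
    (forall j, below (P j) (threshold c' H alpha)) ->
    (set_card ((\bigcap_(j in [set: 'I_n])
              [set A | in_local E U Uinf A (Some (P j))])
           `&` box_I E U Uinf H))%:R
      <= (2 * H%:R) ^+ (\dim {:K} * d) * \prod_(j < n) v (P j))
  (hv : summable [set: nzprime K] (EFin \o v)) :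
  exists mu : R,
    moment E U Uinf n @ \oo --> mu /\
    mu%:E = (\sum_(tau : {ffun 'I_n -> 'I_n.+1} | partition_type tau)
      (num_partitions tau)%:R%:E *
      \esum_(e in [set e : (ell tau).-tuple (option (nzprime K)) |
                     forall i j : 'I_(ell tau), (i < j)%N ->
                       tnth e i <> tnth e j])
        (\prod_(m < ell tau) s_local U Uinf nu nu_inf (tnth e m))%:E)%E.
Proof.
pose loc H (f : box_index d K H) := in_local E U Uinf (box_point E f).
(* Truncation is by the residue characteristic, matching the union over p > M in the tail
   condition. *)
pose nmS M := [set P : nzprime K | exists2 p, (p <= M)%N & lies_over P p].
have nmfin M : finite_set (nmS M).
  apply: (@sub_finite_set _ _ (\bigcup_(p in `I_M.+1) [set P : nzprime K | lies_over P p])).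
    by move=> P [p pM hP]; exists p.
  by apply: bigcup_finite; [exact: finite_II|move=> p _; exact: finite_lies_over hE p].
pose nm M := fset_set (nmS M).
have nmP M P : reflect (nmS M P) (P \in nm M).
  by rewrite in_fset_set//; apply: (iffP idP); rewrite inE.
have vol_gt0 H : (0 < H)%N -> 0 < bvol R d K H.
  by move=> H0; rewrite exprn_gt0// mulr_gt0// ltr0n.
have nm_incr M N : (M <= N)%N -> {subset nm M <= nm N}.
  by move=> MN P /nmP[p pM hP]; apply/nmP; exists p => //; exact: leq_trans MN.
have nm_cover P : exists M, P \in nm M.
  by have [p hp] := lies_over_exists P; exists p; apply/nmP; exists p.
have dens := cvg_local_count hE hnu hmu_inf hnu_inf hU hUinf hcone.
have goodE H (f : box_index d K H) : good (T := nzprime K) loc f = `[< ~ I_set E U Uinf (box_point E f) >].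
  by apply/asboolP/asboolP => [h h'|/contrapT].
have boxIE H : box_I E U Uinf H = (~` I_set E U Uinf) `&` box E H.
  by rewrite /box_I setDE setIC.
have tail (e : R) : 0 < e -> exists M0, forall M, (M0 <= M)%N ->
  exists H0, forall H, (H0 <= H)%N ->
  #|[set f : box_index d K H | `[< exists2 P, P \notin nm M & loc H f (Some P) >]]%SET|%:R
    <= e * bvol R d K H.
  move=> e0; have [M1 [_ hM1]] := htail _ (open_ereal_lt' (x := 0%E) (y := e%:E) e0).
  exists (Num.truncn M1).+1 => M M0M.
  have M1M : M1 < M%:R by apply: lt_le_trans (truncnS_gt M1) _; rewrite ler_nat.
  have [N hN] := limn_esup_lt (hM1 _ M1M).
  exists (maxn 1 N) => H; rewrite geq_max => /andP[H0 /hN].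
  rewrite (set_card_box hE) lte_fin ltr_pdivrMr ?vol_gt0// => /ltW; apply: le_trans.
  rewrite ler_nat; apply: subset_leq_card; apply/fintype.subsetP => f.
  rewrite !inE => -[P /nmP nP hP].
  have [p hp] := lies_over_exists P; exists p; last by exists P.
  split; first by case: hp.
  by rewrite ltr_nat ltnNge; apply/negP => pM; apply: nP; exists p.
(* As [c] exceeds a cardinality, passing to [|c|] loses nothing and turns the bound into a natural
   number. *)
have large H (f : box_index d K H) : (0 < H)%N -> good (T := nzprime K) loc f ->
  (set_card [set P | above P (threshold c' H alpha) /\ loc H f (Some P)] <= `|c|)%N.
  rewrite goodE => H0 /asboolP nI.
  have hb : box_I E U Uinf H (box_point E f).
    by rewrite boxIE; split=> //; apply/boxE; exists f.
  have [_ lt] := hlarge H _ H0 hb.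
  by rewrite -lez_nat (le_trans (ltW lt))// lez_abs.
have small H (g : 'I_n -> nzprime K) : (0 < H)%N ->
  (forall j, ~ above (g j) (threshold c' H alpha)) ->
  #|[set f : box_index d K H |
     good (T := nzprime K) loc f && `[< forall j, loc H f (Some (g j)) >]]%SET|%:R
    <= bvol R d K H * \prod_(j < n) v (g j).
  move=> H0 nab.
  (* Every prime lies over some p and the order of the extended reals is total, so not being above
     the threshold means being below it. *)
  have hbel j : below (g j) (threshold c' H alpha).
    have [p hp] := lies_over_exists (g j); exists p => //.
    by rewrite leNgt; apply/negP => lt; apply: (nab j); exists p.
  have := hsmall H g H0 hbel; rewrite boxIE setIA (set_card_box hE) mulnC -/(bvol R d K H).
  apply: le_trans; rewrite ler_nat; apply: subset_leq_card; apply/fintype.subsetP => f.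
  rewrite !inE goodE => /andP[/asboolP nI /asboolP h]; split=> // j _.
  exact: h.
have sl_ge0 eta : 0 <= s_local U Uinf nu nu_inf eta.
  by case: eta => [P|] /=; rewrite ?divr_ge0 ?exprn_ge0// /vol fine_ge0// mu_ext_ge0.
have [mu [h1 h2]] := moment_formula vol_gt0 nm_incr nm_cover hn dens tail large small hv sl_ge0.
exists mu; split=> //.
apply: eq_cvgn h1 => H.
rewrite /moment /loc_moment mulnC -/(bvol R d K H); congr (_ / _).
rewrite boxIE set_box_seq -fsbig_seq; last first.
  by rewrite map_inj_uniq ?enum_uniq//; exact: box_point_inj.
rewrite big_map big_enum/=; apply: eq_big => [f|f _]; first by rewrite inE goodE.
by rewrite natrX.
Qed.
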